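(* Let $\phi:\mathbb{R}^n\to\mathbb{R}$ be $\mathcal{C}^2$ and suppose there exist $\theta>0$, $L>0$ with $|\nabla\phi(z')-\nabla\phi(z'')|\le L|z'-z''|$ and $(\nabla\phi(z')-\nabla\phi(z''))^\top(z'-z'')\ge\theta|z'-z''|^2$ for all $z',z''\in\mathbb{R}^n$; let $z^*$ be its unique minimizer and $\phi^*=\phi(z^* )$. Let $\kappa_1,\dots,\kappa_n$ be pairwise distinct positive rational numbers, $k>0$, and $0<T_{\min}<T_{\max}$ with \[ T_{\max}^2-T_{\min}^2\ge\frac{1}{2\theta k}. \] Consider the hybrid system $\mathcal{H}_{a,\varepsilon}$ ($a,\varepsilon>0$) with state $\tilde x=(x,\mu,\tau)$, $x=(x_1,x_2)\in\mathbb{R}^n\times\mathbb{R}^n$, $\mu\in\mathbb{R}^{2n}$, given by \[ \text{flows: } (x,\tau,\mu)\in\mathbb{R}^{2n}\times[T_{\min},T_{\max}]\times\mathbb{T}^n,\quad \dot x_1=\tfrac{2}{\tau}(x_2-x_1),\ \dot x_2=-\tfrac4a k\tau\phi(z)\tilde\mu,\ \dot\tau=\tfrac12,\ \dot\mu=\tfrac1\varepsilon R\mu, \] \[ \text{jumps: } (x,\tau,\mu)\in\mathbb{R}^{2n}\times\{T_{\max}\}\times\mathbb{T}^n,\quad x_1^+=x_1,\ x_2^+=x_1,\ \tau^+=T_{\min},\ \mu^+=\mu, \] with $z=x_1+a\tilde\mu$, $\tilde\mu=(\mu_1,\mu_3,\dots,\mu_{2n-1})$. Let $\mathcal{A}_x=\{z^*\}\times\{z^*\}$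 and $\mathcal{A}=\mathcal{A}_x\times[T_{\min},T_{\max}]\times\mathbb{T}^n$. Then: (a) there exists an exponential-form $\beta_2\in\mathcal{KL}$ such that $\mathcal{A}$ is SGPES as $(a,\varepsilon)\to0^+$ with $\beta_2$, and $\mathcal{H}_{a,\varepsilon}$ is Structurally Robust; (b) for each compact $K_0\subset\mathbb{R}^{2n}$ with $\mathcal{A}_x\subset\operatorname{int}(K_0)$ and each $\nu>0$, there exists $a^*>0$ such that for all $a\in(0,a^* )$ there exists $\varepsilon^*>0$ such that for all $\varepsilon\in(0,\varepsilon^* )$, every solution with $x(0,0)\in K_0$, $\tau(0,0)=T_{\min}$ and $x_1(0,0)=x_2(0,0)$ satisfies \[ \phi(z(t,j))-\phi^*\le\alpha_0\tilde\gamma^j\big(\phi(z(0,0))-\phi^*\big)+\nu \] for all $(t,j)\in\operatorname{dom}(\tilde x)$ with $t>\underline t_j:=\min\{t:(t,j)\in\operatorname{dom}(\tilde x)\}$, where $z(t,j)=x_1(t,j)+a\tilde\mu(t,j)$, $\tilde\gamma=\frac{1}{kT_{\max}^2}\left(\frac{1}{2\theta}+kT_{\min}^2\right)$ and $\alpha_0=T_{\max}^2/T_{\min}^2$.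
   Context: $\mathbb{T}^n=\mathbb{S}^1\times\cdots\times\mathbb{S}^1\subset\mathbb{R}^{2n}$ ($\mathbb{S}^1$ the unit circle in $\mathbb{R}^2$). $R\in\mathbb{R}^{2n\times2n}$ is block diagonal with $\ell$-th block $2\pi\kappa_\ell\begin{pmatrix}0&1\\-1&0\end{pmatrix}$. $|x|_{\mathcal{S}}$ denotes distance to a set. Solutions are hybrid arcs on hybrid time domains (Goebel–Sanfelice–Teel). SGPES as $(a,\varepsilon)\to0^+$ with $\beta(r,s)=c_1re^{-c_2s}$ ($c_1,c_2>0$): for every compact $K$ and $\nu>0$ there is $a^*>0$ such that for every $a\in(0,a^* )$ there is $\varepsilon^*>0$ such that for every $\varepsilon\in(0,\varepsilon^* )$ every solution starting in $K$ satisfies $|\tilde x(t,j)|_{\mathcal{A}}\le\beta(|\tilde x(0,0)|_{\mathcal{A}},t+j)+\nu$ on its domain, and all such solutions are complete (SGPpAS: same without completeness and with $\beta\in\mathcal{KL}$). Structural Robustness: for every measurable $e$ with $\sup_t|e(t)|\le\bar e$, the perturbed system $\tilde x+e\in C$, $\dot{\tilde x}=F(\tilde x+e)+e$; $\tilde x+e\in D$, $\tilde x^+=G(\tilde x+e)+e$ (with $C,F,D,G$ the flow set, flow map, jump set, jump map above) renders $\mathcal{A}$ SGPpAS as $(a,\varepsilon,\bar e)\to0^+$ with the same $\beta$. *)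

(* Defs.v *)
From mathcomp Require Import all_boot all_order all_algebra.
From mathcomp Require Import all_classical all_reals all_analysis.
Import Order.TTheory GRing.Theory Num.Theory.
Import numFieldNormedType.Exports.

Set Implicit Arguments.
Unset Strict Implicit.
Unset Printing Implicit Defensive.

Local Open Scope classical_set_scope.
Local Open Scope ring_scope.

Section HybridDefs.
Context {R : realType}.

Definition enorm m (v : 'rV[R]_m) : R := Num.sqrt (\sum_(i < m) v ord0 i ^+ 2).
Definition dotv m (u v : 'rV[R]_m) : R := \sum_(i < m) u ord0 i * v ord0 i.
Definition dist_set m (A : set 'rV[R]_m) (v : 'rV[R]_m) : R :=
  inf [set enorm (v - y) | y in A].

Definition is_gradient n (phi : 'rV[R]_n -> R) (g : 'rV[R]_n -> 'rV[R]_n) :=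
  forall (x : 'rV[R]_n) (i : 'I_n), is_derive x (delta_mx 0 i) phi (g x ord0 i).
Definition C2 n (phi : 'rV[R]_n -> R) :=
  exists g : 'rV[R]_n -> 'rV[R]_n, is_gradient phi g /\
    forall i j : 'I_n, exists h : 'rV[R]_n -> R,
      (forall x, is_derive x (delta_mx 0 j) (fun y => g y ord0 i) (h x)) /\
      continuous h.

Definition abs_cont_on (f : R -> R) (a b : R) : Prop :=
  forall eps : R, 0 < eps -> exists2 delta : R, 0 < delta &
    forall (N : nat) (s t : nat -> R),
      (forall k, (k < N)%N -> a <= s k /\ s k <= t k /\ t k <= b) ->
      (forall k l, (k < l)%N -> (l < N)%N -> t k <= s l) ->
      \sum_(k < N) (t k - s k) < delta ->
      \sum_(k < N) `|f (t k) - f (s k)| < eps.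

Definition lebesgue_mset (A : set R) : Prop :=
  exists B : set R, measurable B /\
    (@lebesgue_measure R).-negligible ((A `\` B) `|` (B `\` A)).
Definition lmeasurable_vfun m (e : R -> 'rV[R]_m) : Prop :=
  forall (i : 'I_m) (Y : set R), measurable Y ->
    lebesgue_mset [set t | Y (e t ord0 i)].

Definition compact_htd (E : set (R * nat)) : Prop :=
  exists (J : nat) (tt : nat -> R), tt 0%N = 0 /\
    (forall j, (j < J)%N -> tt j <= tt j.+1) /\
    E = [set p | (p.2 < J)%N /\ tt p.2 <= p.1 /\ p.1 <= tt p.2.+1].

Definition htd (E : set (R * nat)) : Prop :=
  (forall p, E p -> 0 <= p.1) /\
  forall (T : R) (J : nat), E (T, J) ->
    compact_htd (E `&` [set p | p.1 <= T /\ (p.2 <= J)%N]).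

Definition Ij (E : set (R * nat)) (j : nat) : set R := [set t | E (t, j)].

(* hybrid system data (C, F, D, G) with single-valued flow/jump maps;
   the data may depend on ordinary time t (needed for perturbations e(t)) *)
Record hsys (m : nat) := HSys {
  hC : R -> set 'rV[R]_m ;
  hf : R -> 'rV[R]_m -> 'rV[R]_m ;
  hD : R -> set 'rV[R]_m ;
  hg : R -> 'rV[R]_m -> 'rV[R]_m }.

(* x is a solution of H with hybrid time domain E (values of x off E irrelevant) *)
Definition is_solution m (H : hsys m) (E : set (R * nat))
    (x : R -> nat -> 'rV[R]_m) : Prop :=
  htd E /\ E (0, 0%N) /\
  (closure (hC H 0) (x 0 0%N) \/ hD H 0 (x 0 0%N)) /\
  (forall j : nat, (exists t, (Ij E j)° t) ->
     (forall t, (Ij E j)° t -> hC H t (x t j)) /\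
     (forall a b, Ij E j a -> Ij E j b ->
        forall i : 'I_m, abs_cont_on (fun t => x t j ord0 i) a b) /\
     {ae (@lebesgue_measure R), forall t, Ij E j t ->
        forall i : 'I_m, is_derive t 1 (fun s => x s j ord0 i) (hf H t (x t j) ord0 i)}) /\
  (forall (t : R) (j : nat), E (t, j) -> E (t, j.+1) ->
     hD H t (x t j) /\ x t j.+1 = hg H t (x t j)).

Definition maximal_solution m (H : hsys m) E x : Prop :=
  is_solution H E x /\
  forall E' x', is_solution H E' x' -> E `<=` E' ->
    (forall p, E p -> x' p.1 p.2 = x p.1 p.2) -> E' = E.

Definition complete_dom (E : set (R * nat)) : Prop :=
  forall M : R, exists p, E p /\ M <= p.1 + (p.2)%:R.

Definition perturb m (H : hsys m) (e : R -> 'rV[R]_m) : hsys m :=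
  HSys (fun t s => hC H t (s + e t)) (fun t s => hf H t (s + e t) + e t)
       (fun t s => hD H t (s + e t)) (fun t s => hg H t (s + e t) + e t).

Definition SGPES m (Hf : R -> R -> hsys m) (A : set 'rV[R]_m)
    (beta : R -> R -> R) : Prop :=
  forall K : set 'rV[R]_m, compact K -> forall nu : R, 0 < nu ->
  exists2 astar : R, 0 < astar & forall a : R, 0 < a < astar ->
  exists2 estar : R, 0 < estar & forall eps : R, 0 < eps < estar ->
    (forall E x, is_solution (Hf a eps) E x -> K (x 0 0%N) ->
       forall (t : R) (j : nat), E (t, j) ->
         dist_set A (x t j) <= beta (dist_set A (x 0 0%N)) (t + j%:R) + nu) /\
    (forall E x, maximal_solution (Hf a eps) E x -> K (x 0 0%N) -> complete_dom E).

Definition struct_robust m (Hf : R -> R -> hsys m) (A : set 'rV[R]_m)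
    (beta : R -> R -> R) : Prop :=
  forall K : set 'rV[R]_m, compact K -> forall nu : R, 0 < nu ->
  exists2 astar : R, 0 < astar & forall a : R, 0 < a < astar ->
  exists2 estar : R, 0 < estar & forall eps : R, 0 < eps < estar ->
  exists2 ebstar : R, 0 < ebstar & forall ebar : R, 0 < ebar < ebstar ->
  forall e : R -> 'rV[R]_m, lmeasurable_vfun e ->
    (forall t, 0 <= t -> enorm (e t) <= ebar) ->
    forall E x, is_solution (perturb (Hf a eps) e) E x -> K (x 0 0%N) ->
      forall (t : R) (j : nat), E (t, j) ->
        dist_set A (x t j) <= beta (dist_set A (x 0 0%N)) (t + j%:R) + nu.

(* State s in R^(4n+1), 0-indexed coordinates:
   x1 = s_0..s_{n-1}, x2 = s_n..s_{2n-1}, mu = s_{2n}..s_{4n-1}, tau = s_{4n}. *)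
Definition st n (s : 'rV[R]_(4 * n).+1) (k : nat) : R := s ord0 (inord k).
Definition x1_of n (s : 'rV[R]_(4 * n).+1) : 'rV[R]_n := \row_(i < n) st s i.
Definition x2_of n (s : 'rV[R]_(4 * n).+1) : 'rV[R]_n := \row_(i < n) st s (n + i).
(* mu~ = (mu_1, mu_3, ..., mu_{2n-1}) (1-indexed) = mu_{2i} (0-indexed) *)
Definition mut_of n (s : 'rV[R]_(4 * n).+1) : 'rV[R]_n :=
  \row_(i < n) st s (2 * n + 2 * i).
Definition tau_of n (s : 'rV[R]_(4 * n).+1) : R := st s (4 * n).
Definition on_torus n (s : 'rV[R]_(4 * n).+1) : Prop :=
  forall i : nat, (i < n)%N ->
    st s (2 * n + 2 * i) ^+ 2 + st s (2 * n + 2 * i + 1) ^+ 2 = 1.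
Definition z_of n (a : R) (s : 'rV[R]_(4 * n).+1) : 'rV[R]_n :=
  x1_of s + a *: mut_of s.
(* (R mu)_l for 0-indexed l in 0..2n-1; block i = l/2 is 2 pi kappa_i [[0,1],[-1,0]] *)
Definition Rmu n (kappa : nat -> rat) (s : 'rV[R]_(4 * n).+1) (l : nat) : R :=
  let c := 2 * pi * ratr (kappa l./2) in
  if odd l then - c * st s (2 * n + l).-1 else c * st s (2 * n + l).+1.

Definition flow_map n (kappa : nat -> rat) (k : R) (phi : 'rV[R]_n -> R)
    (a eps : R) (s : 'rV[R]_(4 * n).+1) : 'rV[R]_(4 * n).+1 :=
  \row_(j < (4 * n).+1)
    let q := nat_of_ord j in
    if (q < n)%N then 2 / tau_of s * (st s (n + q) - st s q)
    else if (q < 2 * n)%N then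
      - (4 / a) * k * tau_of s * phi (z_of a s) * st s (2 * n + 2 * (q - n))
    else if (q < 4 * n)%N then eps^-1 * Rmu kappa s (q - 2 * n)
    else 1 / 2.

Definition jump_map n (Tmin : R) (s : 'rV[R]_(4 * n).+1) : 'rV[R]_(4 * n).+1 :=
  \row_(j < (4 * n).+1)
    let q := nat_of_ord j in
    if (q < n)%N then st s q
    else if (q < 2 * n)%N then st s (q - n)
    else if (q < 4 * n)%N then st s q
    else Tmin.

Definition flow_set n (Tmin Tmax : R) : set 'rV[R]_(4 * n).+1 :=
  [set s | Tmin <= tau_of s <= Tmax /\ on_torus s].
Definition jump_set n (Tmax : R) : set 'rV[R]_(4 * n).+1 :=
  [set s | tau_of s = Tmax /\ on_torus s].

Definition H_ae n (kappa : nat -> rat) (k Tmin Tmax : R) (phi : 'rV[R]_n -> R)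
    (a eps : R) : hsys (4 * n).+1 :=
  HSys (fun _ => @flow_set n Tmin Tmax) (fun _ => flow_map kappa k phi a eps)
       (fun _ => @jump_set n Tmax) (fun _ => jump_map Tmin).

Definition Aset n (zstar : 'rV[R]_n) (Tmin Tmax : R) : set 'rV[R]_(4 * n).+1 :=
  [set s | x1_of s = zstar /\ x2_of s = zstar /\ Tmin <= tau_of s <= Tmax /\ on_torus s].

End HybridDefs.

(* Main.v *)
(** Write (p, q) = (x1, x2) and V = |p - q|^2 / 4 + |q - z*|^2 / 4 + k tau^2 (phi p - phi* ).
    For the averaged dynamics V decays exponentially along flows, and the condition on
    Tmax^2 - Tmin^2 makes V contract by the factor gamma <= 1 at jumps.  Averaging is carried
    out by the near-identity change of variable q + eps W: the fast rotation differentiates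
    W into the oscillating part of the q-dynamics up to O(a), and the cross terms cos_i cos_j
    have antiderivatives because the frequencies are distinct.  Subtracting a small affine
    function of tau from the corrected V turns the two decrease conditions into strict ones,
    with a margin absorbing the O(a) + O_a(eps) residuals and the perturbation e; the nominal
    system is the case e = 0.  Since the timer forces j <= C (1 + t), decay in t is decay in
    t + j.  A bounded maximal solution is complete: at the right end of a bounded hybrid time
    domain it could be prolonged by its left limit, by a jump, or by Picard iteration. *)
Require Import Defs.
From mathcomp Require Import all_boot all_order all_algebra.
From mathcomp Require Import all_classical all_reals all_analysis.
From mathcomp Require Import measurable_realfun ring lra zify.
Set Implicit Arguments.
Unset Strict Implicit.
Unset Printing Implicit Defensive.
Import Order.TTheory GRing.Theory Num.Theory.
Import numFieldNormedType.Exports.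
Local Open Scope classical_set_scope.
Local Open Scope ring_scope.

(** * Absolutely continuous functions *)

(** Expanding [phi] at x1 gives phi(z) cos_i the mean a g_i / 2 over the fast rotation, up to
    O(a^2), where g is the gradient at p. The gain 4 k tau / a of size 1 / a thus becomes the drift
    - 2 k tau g of q. The weights of V are tuned to this drift: all products of g with q cancel
    along flows, and what is left is - |p - q|^2 / tau - k tau (g . (p - zs) - (phi p - phi zs)),
    which strong convexity makes negative.

    The obstacle is that the residuals do not vanish on the attractor while gamma may equal 1: an
    additive error at every jump would accumulate over infinitely many jumps. Strict decrease with a
    margin avoids any such summation. The other constraint is the order of the constants: the ball
    that holds the solutions is fixed before a, then eps is chosen against W, whose size is 1 / a,
    and last the bound on e. W must therefore be controlled before x2 is known to be bounded. *)

Lemma interval_induction (R : realType) (P : R -> Prop) (a b : R) :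
  a <= b -> P a ->
  (forall t, a <= t <= b -> exists2 d, 0 < d & forall x y, a <= x -> x <= t ->
     t <= y -> y <= b -> t - d < x -> y < t + d -> P x -> P y) ->
  P b.
Proof.
move=> ab Pa step.
pose S := [set t | a <= t <= b /\ P t].
have S0 : S !=set0 by exists a; split => //; rewrite lexx.
have Sb : ubound S b by move=> t [/andP[_ ->]].
have hS : has_sup S by split => //; exists b.
have aT : a <= sup S by apply: ub_le_sup; [exists b|split => //; rewrite lexx].
have Tb : sup S <= b by exact: ge_sup.
have [|d d0 stepT] := step (sup S); first by rewrite aT.
(* A point [x] of [S] close below the supremum and a point beyond it lie on the two sides of
   [sup S], so one application of [step] both reaches the supremum and passes it. *)
have [x [/andP[ax xb] Px] Tx] := sup_adherent d0 hS.
have xT : x <= sup S by apply: ub_le_sup; [exists b|split => //; rewrite ax].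
have [bT|Tb'] := ltP b (sup S + d); first exact: (stepT x b).
have h1 : a <= sup S + d / 2 <= b by lra.
have h2 : sup S + d / 2 < sup S + d by lra.
have h3 : sup S <= sup S + d / 2 by lra.
have : S (sup S + d / 2).
  split => //; apply: (stepT x) => //; by case/andP: h1.
move=> /(ub_le_sup (ex_intro _ b Sb)); lra.
Qed.

(** Straddle estimate: the increment over an interval around [t] splits at [t], and each half has a
    difference quotient below [e]. Interval induction requires both ends to be free. *)
Lemma is_derive_near_ub (R : realType) (f : R -> R) (t v e : R) :
  is_derive t 1 f v -> v < e ->
  exists2 d, 0 < d & forall x y, x <= t -> t <= y -> t - d < x -> y < t + d ->
    f y - f x <= e * (y - x).
Proof.
move=> [dfx dfE] ve.
have := dfx; rewrite /derivable => /cvg_ex[l hl].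
have lE : l = v by rewrite -dfE /derive; apply/esym/cvg_lim.
rewrite {}lE in hl.
have /cvgrPdist_lt/(_ (e - v)) := hl.
rewrite subr_gt0 => /(_ ve) /nbhs_ballP [d /= d0 hd].
exists d => // x y xt ty tx yt.
have key h : 0 < `|h| < d -> h^-1 * (f (t + h) - f t) < e.
  move=> /andP[h0 hltd].
  have := hd h; rewrite /ball/= sub0r normrN => /(_ hltd).
  rewrite -normr_gt0 => /(_ h0).
  rewrite [h *: 1]mulr1 -[_ *: _]/(h^-1 * _) (addrC h t) ltr_norml => /andP[+ _].
  lra.
have ub : f y - f t <= e * (y - t).
  have [->|] := eqVneq y t; first by rewrite !subrr mulr0.
  move=> yneq; have yt0 : 0 < y - t by rewrite subr_gt0 lt_neqAle eq_sym yneq.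
  have := key (y - t); rewrite gtr0_norm// yt0 (addrC t) subrK /=.
  have -> : y - t < d by lra.
  move=> /(_ isT)/ltW; rewrite ler_pdivrMl// mulrC; by apply.
have lb : f t - f x <= e * (t - x).
  have [->|] := eqVneq x t; first by rewrite !subrr mulr0.
  move=> xneq; have xt0 : x - t < 0 by rewrite subr_lt0 lt_neqAle xneq.
  have := key (x - t); rewrite ltr0_norm// oppr_gt0 xt0 (addrC t) subrK /=.
  have -> : - (x - t) < d by lra.
  move=> /(_ isT)/ltW; rewrite ler_ndivrMl// mulrC; lra.
lra.
Qed.

Lemma ae_closed_interval (R : realType) (a b : R) (P : R -> Prop) :
  {ae (@lebesgue_measure R), forall t, a < t < b -> P t} ->
  {ae (@lebesgue_measure R), forall t, a <= t <= b -> P t}.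
Proof.
move=> h; have : (@lebesgue_measure R).-negligible
    (~` [set t | a < t < b -> P t] `|` ([set a] `|` [set b])).
  apply: negligibleU; first exact: h.
  by apply: negligibleU; apply/negligibleP => //; exact: lebesgue_measure_set1.
apply: negligibleS => t /=; apply: contra_notP; rewrite not_orE => -[/contrapT h1].
rewrite not_orE => -[/= na nb] /andP[ta tb]; apply: h1.
rewrite !lt_neqAle ta tb !andbT; apply/andP; split; apply/eqP => //.
by move=> e; apply: na.
Qed.

Lemma null_open_cover (R : realType) (N : set R) (d : R) :
  (@lebesgue_measure R).-negligible N -> 0 < d ->
  exists U : set R, [/\ open U, N `<=` U & (lebesgue_measure U < d%:E)%E].
Proof.
move=> [A [mA A0 NA]] d0.
have Aoo : (lebesgue_measure A < +oo)%E by rewrite A0 ltry.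
have [U [oU AU UA]] := lebesgue_regularity_outer mA Aoo d0.
exists U; split => //; first exact: subset_trans AU.
have mU := open_measurable oU.
apply: le_lt_trans UA.
rewrite -[X in (_ X <= _)%E](setDUK AU).
rewrite -[leRHS]add0e -[X in (_ <= X + _)%E]A0.
apply: measureU2 => //; exact: measurableD.
Qed.

Lemma sum_length_le (R : realType) (U : set R) (n : nat) (s t : nat -> R) :
  open U ->
  (forall k, (k < n)%N -> s k <= t k) ->
  (forall k l, (k < l)%N -> (l < n)%N -> t k <= s l) ->
  (forall k, (k < n)%N -> `[s k, t k] `<=` U) ->
  ((\sum_(k < n) (t k - s k))%:E <= lebesgue_measure U)%E.
Proof.
move=> oU st tsl sU.
(* Without their endpoints the intervals are disjoint even when consecutive closed ones touch, and
   their lengths are unchanged. *)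
pose F k := `]s k, t k[%classic : set R.
have E : lebesgue_measure (\big[setU/set0]_(k < n) F k) =
    (\sum_(k < n) lebesgue_measure (F k))%E.
  apply: measure_semi_additive_ord_I.
  - by move=> k kn; exact: measurable_itv.
  - apply/trivIsetP => i j /= ib jb ij.
    wlog ltij : i j ib jb ij / (i < j)%N.
      move=> H; move: ij; rewrite neq_ltn => /orP[h|h].
        by apply: H => //; rewrite ltn_eqF.
      by rewrite setIC; apply: H => //; rewrite ltn_eqF.
    rewrite -subset0 => x [Fi Fj].
    have : (x : R) \in `]s i, t i[ by exact: Fi.
    have : (x : R) \in `]s j, t j[ by exact: Fj.
    rewrite !in_itv /= => /andP[h2 _] /andP[_ h1].
    have h3 := tsl _ _ ltij jb; by move: (lt_le_trans h1 h3); rewrite ltNge (ltW h2).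
  - by apply: bigsetU_measurable => i _; exact: measurable_itv.
have -> : (\sum_(k < n) (t k - s k))%:E = (\sum_(k < n) lebesgue_measure (F k))%E.
  rewrite -sumEFin; apply: eq_bigr => k _.
  rewrite lebesgue_measure_itv /= lte_fin.
  case: ltP => // h; have := st k (ltn_ord k) => h'.
  have -> : t k = s k by lra.
  by rewrite subrr.
rewrite -E; apply: le_measure; rewrite ?inE.
- by apply: bigsetU_measurable => i _; exact: measurable_itv.
- exact: open_measurable.
rewrite -bigcup_mkord => x [k /= kn]; rewrite /F /= ?in_itv/= => /andP[h1 h2].
by apply: (sU k kn); rewrite /= ?in_itv/= !ltW.
Qed.

(* The exceptional null set is covered by an open set of small measure, on which
   absolute continuity controls the increments; elsewhere the derivative does. *)
Lemma ac_nonincr (R : realType) (f : R -> R) (a b : R) :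
  a <= b -> abs_cont_on f a b ->
  {ae (@lebesgue_measure R), forall t, a < t < b ->
     exists2 v, is_derive t 1 f v & v <= 0} ->
  f b <= f a.
Proof.
move=> ab acf dfle.
apply/ler_addgt0Pr => e e0.
have [dl dl0 hdl] := acf (e / 2) ltac:(lra).
(* The [+ 1] keeps the denominator positive when [a = b]. The slope error is then at most [e / 2] in
   total, the other half being left to the exceptional set. *)
pose e' := (e / 2) / (b - a + 1).
have e'0 : 0 < e' by apply: divr_gt0; lra.
have e'ba : e' * (b - a) <= e / 2.
  rewrite /e' -mulrA ler_piMr//; first lra.
  rewrite mulrC ler_pdivrMr; lra.
pose N1 := ~` [set t | a <= t <= b -> exists2 v, is_derive t 1 f v & v <= 0].
have N1n : (@lebesgue_measure R).-negligible N1 := ae_closed_interval dfle.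
have hN1 t : a <= t <= b -> ~ N1 t -> exists2 v, is_derive t 1 f v & v <= 0.
  by move=> tab /contrapT; apply.
have [U [oU NU Ud]] := null_open_cover N1n dl0.
(* [P x] carries the finite family of intervals inside [U] met so far: the increment of [f] up to
   [x] is charged to the slope [e'] outside them and to absolute continuity on them. *)
pose P x := exists n (s t : nat -> R),
  [/\ forall k, (k < n)%N -> a <= s k /\ s k <= t k /\ t k <= x,
      forall k l, (k < l)%N -> (l < n)%N -> t k <= s l,
      forall k, (k < n)%N -> `[s k, t k] `<=` U &
      f x - f a <= e' * (x - a) + \sum_(k < n) `|f (t k) - f (s k)|].
have : P b.
  apply: (@interval_induction R P a b) => //.
    exists 0%N, (fun=> 0), (fun=> 0); split => //.
    by rewrite big_ord0 !subrr mulr0 addr0.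
  move=> t0 t0ab.
  have [Nt|nNt] := pselect (N1 t0).
    have /nbhs_ballP[d /= d0 hd] : nbhs t0 U by apply: open_nbhs_nbhs; split => //; exact: NU.
    exists d => // x y ax xt ty yb tx yt [n [s [t [h1 h2 h3 h4]]]].
    exists n.+1, (fun k => if (k < n)%N then s k else x), (fun k => if (k < n)%N then t k else y).
    split.
    - move=> k _; case: ifP => kn; last by split => //; lra.
      have [? [? ?]] := h1 _ kn; repeat split => //; lra.
    - move=> k l kl; rewrite ltnS leq_eqVlt => /orP[/eqP [ln]|ln].
        have kn : (k < n)%N by rewrite -ln.
        by rewrite ln ltnn kn; have [? []] := h1 _ kn.
      by rewrite ln (ltn_trans kl ln); exact: h2.
    - move=> k _; case: ifP => kn; first exact: h3.
      move=> z /=; rewrite ?in_itv/= => /andP[z1 z2]; apply: hd; rewrite /ball/=.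
      rewrite ltr_norml; lra.
    - rewrite big_ord_recr /= ltnn.
      under eq_bigr => i _ do rewrite ltn_ord.
      have := ler_norm (f y - f x); move: h4.
      have : e' * (x - a) <= e' * (y - a) by rewrite ler_pM2l//; lra.
      lra.
  have [v dv v0] := hN1 _ t0ab nNt.
  have [d d0 hd] := @is_derive_near_ub _ _ _ _ e' dv ltac:(lra).
  exists d => // x y ax xt ty yb tx yt [n [s [t [h1 h2 h3 h4]]]].
  exists n, s, t; split => //.
    move=> k kn; have [? [? ?]] := h1 _ kn; repeat split => //; lra.
  have := hd x y xt ty tx yt; lra.
move=> [n [s [t [h1 h2 h3 h4]]]].
have /hdl : \sum_(k < n) (t k - s k) < dl.
  rewrite -lte_fin; apply: le_lt_trans Ud; apply: sum_length_le => //.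
  by move=> k /h1[_ []].
move=> /(_ h1 h2); lra.
Qed.

Lemma ae_imply (R : realType) (P Q : R -> Prop) :
  (forall t, P t -> Q t) -> {ae (@lebesgue_measure R), forall t, P t} ->
  {ae (@lebesgue_measure R), forall t, Q t}.
Proof. by move=> PQ; apply: negligibleS => t nQ Pt; apply: nQ; apply: PQ. Qed.

Lemma ac_sub (R : realType) (f : R -> R) (a b a' b' : R) :
  a <= a' -> b' <= b -> abs_cont_on f a b -> abs_cont_on f a' b'.
Proof.
move=> aa bb acf e /acf[d d0 h]; exists d => // N s t h1 h2 h3.
apply: h => // k /h1[? [? ?]]; repeat split => //; lra.
Qed.

Lemma ac_ucont (R : realType) (f : R -> R) (a b : R) :
  abs_cont_on f a b -> forall e, 0 < e -> exists2 d, 0 < d &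
    forall x y, a <= x <= b -> a <= y <= b -> `|x - y| < d -> `|f x - f y| < e.
Proof.
move=> acf e /acf[d d0 h]; exists d => // x y.
wlog xy : x y / x <= y.
  move=> H hx hy hd; have [xy|/ltW yx] := leP x y; first exact: H.
  by rewrite distrC; apply: H => //; rewrite distrC.
move=> /andP[ax xb] /andP[ay yb] hd.
have := h 1%N (fun=> x) (fun=> y); rewrite !big_ord_recl !big_ord0 !addr0 distrC.
move=> H; apply: H.
- by [].
- by move=> k' [|l].
by move: hd; rewrite distrC ger0_norm// subr_ge0.
Qed.

(** The source of the closure properties below: Lipschitz images, products and norms of absolutely
    continuous functions have increments dominated by those of the components. The summands [+ 1] in
    the denominator of [e'] cover [C = 0] and [m = 0]. *)
Lemma ac_dominated (R : realType) (m : nat) (F : 'I_m -> R -> R) (g : R -> R)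
    (C a b : R) :
  (forall i, abs_cont_on (F i) a b) ->
  (forall x y, a <= x -> x <= y -> y <= b ->
     `|g y - g x| <= C * \sum_(i < m) `|F i y - F i x|) ->
  abs_cont_on g a b.
Proof.
move=> acF gle e e0.
pose e' := e / ((`|C| + 1) * (m%:R + 1)).
have e'0 : 0 < e'.
  by rewrite divr_gt0// mulr_gt0// ltr_wpDl.
have /choice[d hd] : forall i, exists d : R, 0 < d /\ forall N (s t : nat -> R),
      (forall k, (k < N)%N -> a <= s k /\ s k <= t k /\ t k <= b) ->
      (forall k l, (k < l)%N -> (l < N)%N -> t k <= s l) ->
      \sum_(k < N) (t k - s k) < d ->
      \sum_(k < N) `|F i (t k) - F i (s k)| < e'.
  by move=> i; have [d d0 h] := acF i e' e'0; exists d.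
pose D := \big[Num.min/1]_(i < m) d i.
have D0 : 0 < D.
  rewrite /D; elim/big_ind: _ => // [x y x0 y0|i _]; first by rewrite lt_min x0.
  by have [] := hd i.
exists D => // N s t h1 h2 h3.
apply: (@le_lt_trans _ _ (`|C| * \sum_(i < m) \sum_(k < N) `|F i (t k) - F i (s k)|)).
  rewrite exchange_big /= mulr_sumr; apply: ler_sum => k _.
  have [? [? ?]] := h1 _ (ltn_ord k).
  apply: (le_trans (gle _ _ _ _ _)) => //.
  by rewrite ler_wpM2r ?ler_norm// sumr_ge0.
apply: (@le_lt_trans _ _ (`|C| * (m%:R * e'))).
  rewrite ler_wpM2l//.
  apply: (@le_trans _ _ (\sum_(i < m) e')).
    apply: ler_sum => i _; have [_ h] := hd i; apply/ltW/h => //.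
    apply: (lt_le_trans h3); exact: bigmin_le_cond.
  by rewrite sumr_const card_ord mulr_natl.
have eE : e = e' * ((`|C| + 1) * (m%:R + 1)).
  by rewrite /e' divfK// gt_eqF// mulr_gt0// ltr_wpDl.
rewrite [ltRHS]eE; move: e'0 (normr_ge0 C) (ler0n R m); move: `|C| m%:R => y z x0 y0 z0; set x := e'; rewrite -subr_gt0.
have -> : x * ((y + 1) * (z + 1)) - y * (z * x) = x * y + x * z + x by ring.
by rewrite ltr_wpDl// addr_ge0// mulr_ge0// ltW.
Qed.

Lemma ac_lipschitz (R : realType) (g : R -> R) (C a b : R) :
  (forall x y, a <= x -> x <= y -> y <= b -> `|g y - g x| <= C * (y - x)) ->
  abs_cont_on g a b.
Proof.
move=> h; apply: (@ac_dominated _ 1 (fun=> id) g C a b).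
  move=> _ e e0; exists e => // N s t h1 _ h3.
  apply: le_lt_trans h3; apply: ler_sum => k _.
  by have [? [? ?]] := h1 _ (ltn_ord k); rewrite ger0_norm// subr_ge0.
move=> x y ax xy yb; rewrite big_ord_recl big_ord0 addr0 (ger0_norm (_ : 0 <= y - x)) ?subr_ge0//.
exact: h.
Qed.

Lemma ac_bounded (R : realType) (f : R -> R) (a b : R) :
  abs_cont_on f a b -> exists2 B, 0 <= B & forall x, a <= x <= b -> `|f x| <= B.
Proof.
move=> acf.
have [ab|ba] := leP a b; last by exists 0 => // x; lra.
have [d d0 hd] := ac_ucont acf ltr01.
pose P y := exists2 B, 0 <= B & forall x, a <= x <= y -> `|f x| <= B.
apply: (@interval_induction R P a b) => //.
  by exists `|f a| => // x h; have -> : x = a by lra.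
move=> t tab; exists (d / 2); first lra.
move=> x y ax xt ty yb dx dy [B B0 hB].
exists (B + 1 + `|f t|); first by have := normr_ge0 (f t); lra.
move=> z /andP[az zy].
have [zx|xz] := leP z x.
  by have := hB z; rewrite az zx => /(_ isT); have := normr_ge0 (f t); lra.
have : `|f z - f t| < 1 by apply: hd; rewrite ?ltr_norml; lra.
have := ler_normD (f z - f t) (f t); rewrite subrK; lra.
Qed.

Lemma ac_ub (R : realType) (f : R -> R) (a b K : R) :
  a <= b -> abs_cont_on f a b ->
  {ae (@lebesgue_measure R), forall t, a < t < b ->
     exists2 v, is_derive t 1 f v & v <= K} ->
  f b - f a <= K * (b - a).
Proof.
move=> ab acf df.
have : f b - K * b <= f a - K * a.
  apply: (@ac_nonincr _ (fun t => f t - K * t)) => //.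
    apply: (@ac_dominated _ 2 (fun i : 'I_2 => if i == ord0 then id else f) _ (`|K| + 1)).
      move=> i; case: ifP => // _; apply: (@ac_lipschitz _ _ 1) => x y ax xy yb.
      by rewrite mul1r ger0_norm// subr_ge0.
    move=> x y ax xy yb; rewrite !big_ord_recl big_ord0 /= addr0.
    have -> : f y - K * y - (f x - K * x) = (f y - f x) - K * (y - x) by ring.
    apply: le_trans (ler_normB _ _) _; rewrite normrM mulrDl mul1r mulrDr.
    have := normr_ge0 (y - x); have : 0 <= `|K| * `|f y - f x| by rewrite mulr_ge0.
    lra.
  move: df; apply: ae_imply => t h tab; have [v dv vK] := h tab.
  have := is_deriveB dv (is_deriveZ K (is_derive_id t 1)).
  rewrite /GRing.scale /= mulr1 => H; eexists; first exact: H.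
  by rewrite subr_le0.
lra.
Qed.

(* The sign of the derivative is only known while [g < M], and [g < M] only while
   [f] stays below its initial value: neither can fail first. *)
Lemma ac_trap (R : realType) (f g : R -> R) (a b M : R) :
  a <= b -> abs_cont_on f a b -> abs_cont_on g a b ->
  {ae (@lebesgue_measure R), forall t, a < t < b -> g t < M ->
     exists2 v, is_derive t 1 f v & v <= 0} ->
  (forall t, a <= t <= b -> f t <= f a -> g t < M) ->
  f b <= f a.
Proof.
move=> ab acf acg dfle fg.
pose P t := forall u, a <= u <= t -> f u <= f a.
suff : P b by apply; rewrite ab lexx.
apply: (@interval_induction R P a b) => //.
  by move=> u h; have -> : u = a by lra.
move=> t tab.
have [fta|fta] := ltP (f a) (f t).
  have [d d0 hd] := ac_ucont acf (ltac:(lra) : 0 < f t - f a).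
  exists d => // x y ax xt ty yb tx yt Px; exfalso.
  have := Px x; rewrite ax lexx => /(_ isT) fx.
  have : `|f x - f t| < f t - f a by apply: hd; rewrite ?ltr_norml; lra.
  rewrite ltr_norml; lra.
have gt := fg t tab fta.
have [d d0 hd] := ac_ucont acg (ltac:(lra) : 0 < M - g t).
exists d => // x y ax xt ty yb tx yt Px u /andP[au uy].
have [ux|xu] := leP u x; first by apply: Px; rewrite au.
apply: (@le_trans _ _ (f x)); last by apply: Px; rewrite ax lexx.
apply: ac_nonincr; first exact: ltW.
  by apply: ac_sub acf; lra.
move: dfle; apply: ae_imply => s h sxu; apply: h; first lra.
have : `|g s - g t| < M - g t by apply: hd; rewrite ?ltr_norml; lra.
rewrite ltr_norml; lra.
Qed.

Lemma ac_mul_expR (R : realType) (u : R -> R) (c a b : R) :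
  abs_cont_on u a b -> abs_cont_on (fun t => expR (c * t) * u t) a b.
Proof.
move=> acu; have [B B0 hB] := ac_bounded acu.
pose K := `|c| * (`|a| + `|b|).
have hE x : a <= x <= b -> expR (c * x) <= expR K.
  move=> h; rewrite ler_expR /K; apply: (le_trans (ler_norm _)).
  rewrite normrM; apply: ler_wpM2l => //; rewrite ler_norml.
  have := ler_norm a; have := ler_norm b; have := ler_norm (- a); have := ler_norm (- b).
  rewrite !normrN; lra.
have hl x y : a <= x -> x <= y -> y <= b ->
    `|expR (c * y) - expR (c * x)| <= expR K * `|c| * `|y - x|.
  move=> ax xy yb.
  have dE (z : R) : is_derive z (1:R) (fun t => expR (c * t)) (c * expR (c * z)).
    rewrite mulrC; apply: (@is_derive1_comp _ expR (fun t => c * t)).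
    have := is_deriveZ c (is_derive_id z 1); by rewrite /GRing.scale/= mulr1.
  have [|z zxy ->] := @MVT_segment R _ _ x y xy (fun z _ => dE z).
    by apply: derivable_within_continuous => z _; apply: ex_derive.
  rewrite !normrM (mulrC `|c|); apply: ler_wpM2r => //; apply: ler_wpM2r => //.
  rewrite ger0_norm ?expR_ge0//; apply: hE.
  move: zxy; rewrite in_itv/=; lra.
apply: (@ac_dominated _ 2 (fun i : 'I_2 => if i == ord0 then id else u) _
   (expR K * `|c| * B + expR K)).
  move=> i; case: ifP => // _; apply: (@ac_lipschitz _ _ 1) => x y ax xy yb.
  by rewrite mul1r ger0_norm// subr_ge0.
move=> x y ax xy yb; rewrite !big_ord_recl big_ord0 /= addr0.
have -> : expR (c * y) * u y - expR (c * x) * u x =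
   (expR (c * y) - expR (c * x)) * u y + expR (c * x) * (u y - u x) by ring.
apply: (le_trans (ler_normD _ _)); rewrite !normrM.
have h1 := hl x y ax xy yb.
have h2 : `|u y| <= B by apply: hB; lra.
have h3 : expR (c * x) <= expR K by apply: hE; lra.
rewrite (ger0_norm (expR_ge0 (c * x))).
apply: (@le_trans _ _ (expR K * `|c| * `|y - x| * B + expR K * `|u y - u x|)).
  apply: lerD; first exact: ler_pM.
  by rewrite ler_wpM2r.
rewrite mulrDl mulrDr (mulrDr (expR K)).
have : 0 <= expR K * `|c| * B * `|u y - u x| by rewrite !mulr_ge0// expR_ge0.
have : 0 <= expR K * `|y - x| by rewrite !mulr_ge0// expR_ge0.
lra.
Qed.

(** Integrating factor: exp(c t) u(t) does not increase. The differential inequality is only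
    available while u < M, hence the recourse to [ac_trap]. No sign is assumed on [u], since the
    Lyapunov function used later has a positive quantity subtracted from it. *)
Lemma ac_gronwall_trap (R : realType) (u : R -> R) (a b c M : R) :
  a <= b -> 0 <= c -> 0 < M -> u a < M -> abs_cont_on u a b ->
  {ae (@lebesgue_measure R), forall t, a < t < b -> u t < M ->
     exists2 v, is_derive t 1 u v & v <= - c * u t} ->
  u b <= expR (- (c * (b - a))) * u a.
Proof.
move=> ab c0 M0 uaM acu du.
pose f t := expR (c * t) * u t.
have : f b <= f a.
  apply: (@ac_trap _ f u a b M) => //.
  - exact: ac_mul_expR.
  - move: du; apply: ae_imply => t h tab uM; have [v dv vle] := h tab uM.
    have dE : is_derive t (1:R) (fun t => expR (c * t)) (c * expR (c * t)).
      rewrite mulrC; apply: (@is_derive1_comp _ expR (fun t => c * t)).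
      have := is_deriveZ c (is_derive_id t 1); by rewrite /GRing.scale/= mulr1.
    have := is_deriveM dE dv; rewrite /GRing.scale/= => H; eexists; first exact: H.
    have := expR_gt0 (c * t) => ? /=; nra.
  - move=> t tab; rewrite /f.
    (* A negative value is below [M] because M > 0. For the others, exp(c a) u(t) <= exp(c t) u(t)
       <= exp(c a) u(a). *)
    have [u0 _|u0] := ltP (u t) 0; first lra.
    have ac : expR (c * a) <= expR (c * t) by rewrite ler_expR ler_wpM2l//; lra.
    have := expR_gt0 (c * a) => h1 h2.
    have : expR (c * a) * u t <= expR (c * a) * u a by apply: le_trans h2; rewrite ler_wpM2r.
    rewrite ler_pM2l//; lra.
rewrite /f => h.
have -> : - (c * (b - a)) = - (c * b) + c * a by ring.
rewrite expRD -mulrA expRN -ler_pdivrMl ?invr_gt0 ?expR_gt0// invrK //.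
Qed.

(** Flow steps are asked only for [a < b]: on a degenerate interval the interior is empty and
    [is_solution] asserts no flow. The finite sequence [tt] of the truncated domain is climbed by
    alternating flows and jumps. *)
Lemma htd_induction (R : realType) (E : set (R * nat)) (Q : R -> nat -> Prop) :
  htd E -> Q 0 0%N ->
  (forall a b j, a < b -> (forall t, a <= t <= b -> E (t, j)) -> Q a j -> Q b j) ->
  (forall t j, E (t, j) -> E (t, j.+1) -> Q t j -> Q t j.+1) ->
  forall t j, E (t, j) -> Q t j.
Proof.
move=> [_ hE] Q0 Qf Qj t j Etj.
have [J [tt [tt0 [ttm EJ]]]] := hE _ _ Etj.
have inE u i : (i < J)%N -> tt i <= u -> u <= tt i.+1 -> E (u, i).
  move=> iJ h1 h2.
  have : (E `&` [set p | p.1 <= t /\ (p.2 <= j)%N]) (u, i) by rewrite EJ.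
  by case.
have flow u i : (i < J)%N -> tt i <= u -> u <= tt i.+1 -> Q (tt i) i -> Q u i.
  move=> iJ; rewrite le_eqVlt => /orP[/eqP <-//|h1] h2; apply: Qf => // v /andP[v1 v2].
  by apply: inE => //; exact: le_trans h2.
have main i : (i < J)%N -> Q (tt i) i.
  elim: i => [|i ih] iJ; first by rewrite tt0.
  have iJ' : (i < J)%N by exact: ltnW.
  apply: Qj.
  - by apply: inE => //; exact: ttm.
  - by apply: inE => //; exact: ttm.
  - by apply: flow => //; [exact: ttm|exact: ih].
have : (E `&` [set p | p.1 <= t /\ (p.2 <= j)%N]) (t, j) by split => //=.
by rewrite EJ => -[/= jJ [h1 h2]]; apply: flow => //; exact: main.
Qed.

(** * Locally C11 functions and a robust Lyapunov theorem *)

Lemma coord_le_norm (R : realType) (m : nat) (s : 'rV[R]_m) (i : 'I_m) :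
  `|s ord0 i| <= `|s|.
Proof.
rewrite [X in _ <= X]mx_normrE.
exact: (le_bigmax _ (fun ij : 'I_1 * 'I_m => `|s ij.1 ij.2|) (ord0, i)).
Qed.

Lemma norm_le_coord (R : realType) (m : nat) (s : 'rV[R]_m) (r : R) :
  0 <= r -> (forall i, `|s ord0 i| <= r) -> `|s| <= r.
Proof.
move=> r0 h; rewrite [X in X <= _]mx_normrE; apply: bigmax_le => // -[i j] _ /=.
by rewrite ord1.
Qed.

Lemma norm_le_sum (R : realType) (m : nat) (s : 'rV[R]_m) :
  `|s| <= \sum_(i < m) `|s ord0 i|.
Proof.
apply: norm_le_coord; first exact: sumr_ge0.
by move=> i; rewrite (bigD1 i)//= lerDl sumr_ge0.
Qed.

(* [df s v] is the differential of [f] at [s] in direction [v]; both are locally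
   Lipschitz, and differentiability is only recorded as a chain rule along curves. *)
Record C11 (R : realType) (m : nat) (f : 'rV[R]_m -> R)
    (df : 'rV[R]_m -> 'rV[R]_m -> R) : Prop := MkC11 {
  C11_lip : forall B : R, exists2 C : R, 0 <= C & forall s s' : 'rV[R]_m, `|s| <= B -> `|s'| <= B ->
    `|f s - f s'| <= C * `|s - s'| ;
  C11_dlip : forall B : R, exists2 C : R, 0 <= C & forall s s' v : 'rV[R]_m, `|s| <= B -> `|s'| <= B ->
    `|df s v - df s' v| <= C * `|s - s'| * `|v| ;
  C11_dbound : forall B : R, exists2 C : R, 0 <= C & forall s v : 'rV[R]_m, `|s| <= B ->
    `|df s v| <= C * `|v| ;
  C11_dlin : forall (c : R) (s v w : 'rV[R]_m), df s (c *: v + w) = c * df s v + df s w ;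
  C11_chain : forall (x : R -> 'rV[R]_m) (t : R) (v : 'rV[R]_m),
    (forall i, is_derive t 1 (fun u : R => x u ord0 i) (v ord0 i)) ->
    is_derive t 1 (fun u : R => f (x u)) (df (x t) v) }.

Lemma C11_dadd (R : realType) (m : nat) (f : 'rV[R]_m -> R) df : C11 f df ->
  forall s v w, df s (v + w) = df s v + df s w.
Proof. by move=> nf s v w; rewrite -[v in LHS]scale1r (C11_dlin nf) mul1r. Qed.

Lemma C11_bound (R : realType) (m : nat) (f : 'rV[R]_m -> R) df : C11 f df ->
  forall B : R, exists2 C : R, 0 <= C & forall s : 'rV[R]_m, `|s| <= B -> `|f s| <= C.
Proof.
move=> nf B; have [C C0 h] := C11_lip nf `|B|.
exists (`|f 0| + C * `|B|); first by rewrite addr_ge0// mulr_ge0.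
move=> s sB; have sB' : `|s| <= `|B| by apply: le_trans sB (ler_norm _).
have := h s 0 sB'; rewrite normr0 subr0 => /(_ (normr_ge0 _)) h1.
have h2 : C * `|s| <= C * `|B| by apply: ler_wpM2l.
have := ler_normD (f s - f 0) (f 0); rewrite subrK; lra.
Qed.

Lemma C11_cst (R : realType) (m : nat) (c : R) :
  @C11 R m (fun=> c) (fun _ _ => 0).
Proof.
split.
- by move=> B; exists 0 => // s s' _ _; rewrite subrr normr0 mul0r.
- by move=> B; exists 0 => // s s' v _ _; rewrite subrr normr0 !mul0r.
- by move=> B; exists 0 => // s v _; rewrite normr0 mul0r.
- by move=> *; rewrite mulr0 addr0.
- by move=> x t v _; exact: is_derive_cst.
Qed.

Lemma C11_coord (R : realType) (m : nat) (i : 'I_m) :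
  @C11 R m (fun s => s ord0 i) (fun _ v => v ord0 i).
Proof.
split.
- move=> B; exists 1 => // s s' _ _; rewrite mul1r.
  by have := coord_le_norm (s - s') i; rewrite !mxE.
- by move=> B; exists 0 => // s s' v _ _; rewrite subrr normr0 !mul0r.
- by move=> B; exists 1 => // s v _; rewrite mul1r coord_le_norm.
- by move=> *; rewrite !mxE.
- by move=> x t v; apply.
Qed.

Lemma C11_add (R : realType) (m : nat) (f g : 'rV[R]_m -> R) df dg :
  C11 f df -> C11 g dg ->
  C11 (fun s => f s + g s) (fun s v => df s v + dg s v).
Proof.
move=> nf ng; split.
- move=> B; have [C C0 h] := C11_lip nf B; have [C' C'0 h'] := C11_lip ng B.
  exists (C + C'); first by rewrite addr_ge0.
  move=> s s' sB s'B; rewrite opprD addrACA mulrDl; apply: le_trans (ler_normD _ _) _.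
  by apply: lerD; [exact: h|exact: h'].
- move=> B; have [C C0 h] := C11_dlip nf B; have [C' C'0 h'] := C11_dlip ng B.
  exists (C + C'); first by rewrite addr_ge0.
  move=> s s' v sB s'B; rewrite opprD addrACA !mulrDl; apply: le_trans (ler_normD _ _) _.
  by apply: lerD; [exact: h|exact: h'].
- move=> B; have [C C0 h] := C11_dbound nf B; have [C' C'0 h'] := C11_dbound ng B.
  exists (C + C'); first by rewrite addr_ge0.
  move=> s v sB; rewrite mulrDl; apply: le_trans (ler_normD _ _) _.
  by apply: lerD; [exact: h|exact: h'].
- by move=> c s v w; rewrite (C11_dlin nf) (C11_dlin ng); ring.
- by move=> x t v h; apply: is_deriveD; [exact: (C11_chain nf)|exact: (C11_chain ng)].
Qed.

Lemma C11_mul (R : realType) (m : nat) (f g : 'rV[R]_m -> R) df dg :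
  C11 f df -> C11 g dg ->
  C11 (fun s => f s * g s) (fun s v => f s * dg s v + g s * df s v).
Proof.
move=> nf ng.
have prodle (x y x' y' X Y b c : R) : `|x| <= b -> `|y'| <= c ->
    `|x - x'| <= X -> `|y - y'| <= Y -> `|x * y - x' * y'| <= b * Y + c * X.
  move=> hx hy h1 h2; have -> : x * y - x' * y' = x * (y - y') + y' * (x - x') by ring.
  by apply: le_trans (ler_normD _ _) _; rewrite !normrM lerD// ler_pM.
split.
- move=> B; have [C C0 h] := C11_lip nf B; have [C' C'0 h'] := C11_lip ng B.
  have [D D0 k] := C11_bound nf B; have [D' D'0 k'] := C11_bound ng B.
  exists (D * C' + D' * C); first by rewrite addr_ge0// mulr_ge0.
  move=> s s' sB s'B.
  apply: le_trans (prodle _ _ _ _ _ _ _ _ (k _ sB) (k' _ s'B) (h _ _ sB s'B) (h' _ _ sB s'B)) _.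
  by rewrite mulrDl !mulrA.
- move=> B; have [C C0 h] := C11_lip nf B; have [C' C'0 h'] := C11_lip ng B.
  have [D D0 k] := C11_bound nf B; have [D' D'0 k'] := C11_bound ng B.
  have [P P0 p] := C11_dlip nf B; have [P' P'0 p'] := C11_dlip ng B.
  have [N N0 n] := C11_dbound nf B; have [N' N'0 n'] := C11_dbound ng B.
  exists (D * P' + N' * C + (D' * P + N * C')).
    by rewrite !addr_ge0// mulr_ge0.
  move=> s s' v sB s'B; rewrite opprD addrACA; apply: le_trans (ler_normD _ _) _.
  have h1 := prodle _ _ _ _ _ _ _ _ (k _ sB) (n' _ v s'B) (h _ _ sB s'B) (p' _ _ v sB s'B).
  have h2 := prodle _ _ _ _ _ _ _ _ (k' _ sB) (n _ v s'B) (h' _ _ sB s'B) (p _ _ v sB s'B).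
  apply: le_trans (lerD h1 h2) _; rewrite le_eqVlt; apply/orP; left; apply/eqP; ring.
- move=> B; have [D D0 k] := C11_bound nf B; have [D' D'0 k'] := C11_bound ng B.
  have [N N0 n] := C11_dbound nf B; have [N' N'0 n'] := C11_dbound ng B.
  exists (D * N' + D' * N); first by rewrite addr_ge0// mulr_ge0.
  move=> s v sB; apply: le_trans (ler_normD _ _) _; rewrite !normrM mulrDl -!mulrA.
  by apply: lerD; apply: ler_pM; rewrite ?k ?k' ?n ?n'.
- by move=> c s v w; rewrite (C11_dlin nf) (C11_dlin ng); ring.
- move=> x t v h.
  exact: is_deriveM (C11_chain nf h) (C11_chain ng h).
Qed.

Lemma C11_ext (R : realType) (m : nat) (f g : 'rV[R]_m -> R) df dg :
  f =1 g -> df =2 dg -> C11 f df -> C11 g dg.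
Proof.
move=> fg dfg; have -> : g = f by apply: funext => s; rewrite fg.
by have -> : dg = df by apply: funext => s; apply: funext => v; rewrite dfg.
Qed.

Lemma C11_scale (R : realType) (m : nat) (c : R) (f : 'rV[R]_m -> R) df :
  C11 f df -> C11 (fun s => c * f s) (fun s v => c * df s v).
Proof.
move=> nf; apply: C11_ext (C11_mul (C11_cst m c) nf) => //.
by move=> s v; rewrite mulr0 addr0.
Qed.

Lemma C11_sum (R : realType) (m n : nat) (f : 'I_n -> 'rV[R]_m -> R) df :
  (forall i, C11 (f i) (df i)) ->
  C11 (fun s => \sum_(i < n) f i s) (fun s v => \sum_(i < n) df i s v).
Proof.
elim: n f df => [|n ih] f df nf.
  by apply: C11_ext (C11_cst m 0) => [s|s v]; rewrite big_ord0.
apply: C11_ext (C11_add (nf ord0) (ih _ _ (fun i => nf (lift ord0 i)))).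
  by move=> s; rewrite big_ord_recl.
by move=> s v; rewrite big_ord_recl.
Qed.

Lemma interior_segment (R : realType) (E : set (R * nat)) (j : nat) (a b t : R) :
  (forall u, a <= u <= b -> E (u, j)) -> a < t < b -> (Ij E j)° t.
Proof.
move=> hab tab; rewrite /interior /=.
have : nbhs t `]a, b[%classic by apply: open_nbhs_nbhs; split; [exact: interval_open|rewrite /= in_itv].
by apply: filterS => u; rewrite /= in_itv/= => /andP[u1 u2]; apply: hab; rewrite !ltW.
Qed.

Lemma norm_le_sumB (R : realType) (m : nat) (y1 y2 : 'rV[R]_m) :
  `|y1 - y2| <= 1 * \sum_(i < m) `|y1 ord0 i - y2 ord0 i|.
Proof.
by rewrite mul1r; apply: le_trans (norm_le_sum _) _; apply: ler_sum => i _; rewrite !mxE.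
Qed.

Lemma ac_dist (R : realType) (m : nat) (x : R -> 'rV[R]_m) (a b : R) :
  (forall i, abs_cont_on (fun t => x t ord0 i) a b) ->
  forall y, abs_cont_on (fun t => `|x t - y|) a b.
Proof.
move=> xac y; apply: (@ac_dominated _ m (fun i t => x t ord0 i) _ 1) => // t u at_ tu ub.
apply: le_trans (norm_le_sumB _ _); apply: le_trans (ler_dist_dist _ _) _.
by rewrite opprB addrA subrK.
Qed.

Lemma C11_ac (R : realType) (m : nat) (U : 'rV[R]_m -> R) dU (x : R -> 'rV[R]_m) (a b : R) :
  C11 U dU -> (forall i, abs_cont_on (fun t => x t ord0 i) a b) ->
  abs_cont_on (fun t => U (x t)) a b.
Proof.
move=> nU xac.
have /choice[Bx hBx] : forall i, exists b0 : R, 0 <= b0 /\ forall t, a <= t <= b -> `|x t ord0 i| <= b0.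
  by move=> i; have [b0 ? ?] := ac_bounded (xac i); exists b0.
have xb t : a <= t <= b -> `|x t| <= \sum_(i < m) Bx i.
  move=> tab; apply: le_trans (norm_le_sum _) _; apply: ler_sum => i _.
  by have [_] := hBx i; apply.
have [L L0 hL] := C11_lip nU (\sum_(i < m) Bx i).
apply: (@ac_dominated _ m (fun i t => x t ord0 i) _ L) => // t t' at_ tt' tb.
apply: le_trans (hL _ _ _ _) _; [apply: xb; lra|apply: xb; lra|].
by apply: ler_wpM2l => //; have := norm_le_sumB (x t') (x t); rewrite mul1r.
Qed.

(** * Strict Lyapunov decrease under small perturbations *)

Section RobustLyapunov.
Context {R : realType} {m : nat}.
Local Notation V := 'rV[R]_m.
Variables (C D : set V) (F G : V -> V) (U : V -> R) (dU : V -> V -> R).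
Variables (c g M rho r0 B CF : R).

(** Under a perturbation only [s + e t] is known to lie in [C], so the state itself is located in a
    neighbourhood of [C], measured in the max norm. *)
Definition nearC (r : R) (s : V) := exists2 y, C y & `|s - y| <= r.

Hypotheses (nU : C11 U dU) (c0 : 0 <= c) (g0 : 0 <= g) (g1 : g <= 1) (M0 : 0 < M).
Hypotheses (rho0 : 0 < rho) (r00 : 0 < r0) (DC : D `<=` C) (DG : forall s, D s -> C (G s)) (CF0 : 0 <= CF).
Hypothesis sublevel : forall s, nearC r0 s -> U s < M -> `|s| <= B.
Hypothesis F_bound : forall s, C s -> `|s| <= B + 1 -> `|F s| <= CF.
Hypothesis flow_decr : forall s, C s -> `|s| <= B + 1 ->
  dU s (F s) <= - c * U s - rho.
Hypothesis jump_decr : forall s, D s -> `|s| <= B + 1 ->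
  `|G s| <= B + 1 /\ U (G s) <= g * U s - rho.

(** The closure in the initial condition costs a second [es] on top of the size of [e 0]. *)
Lemma solution_init_near es e E x : 0 < es -> `|e 0| <= es ->
  is_solution (perturb (HSys (fun=> C) (fun=> F) (fun=> D) (fun=> G)) e) E x ->
  nearC (2 * es) (x 0 0%N).
Proof.
move=> es0 e0 [_ [_ [x0 _]]].
case: x0 => /= [cl|Dx]; last first.
  exists (x 0 0%N + e 0); first exact: DC.
  by rewrite opprD addrA subrr sub0r normrN; lra.
have [y [Cy]] := cl _ (nbhsx_ballx _ _ es0).
rewrite -ball_normE /= => xy; exists (y + e 0) => //.
rewrite opprD addrA; apply: le_trans (ler_normB _ _) _; lra.
Qed.

(** The flow constraint is asserted at interior times only, so at the right end of an interval the
    bound comes from continuity, again at the price of a second [es]. After a jump the state is a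
    point of [C] plus [e t]. *)
Lemma solution_near es e E x : 0 < es -> (forall t, 0 <= t -> `|e t| <= es) ->
  is_solution (perturb (HSys (fun=> C) (fun=> F) (fun=> D) (fun=> G)) e) E x ->
  forall t j, E (t, j) -> nearC (2 * es) (x t j).
Proof.
move=> es0 eb xsol.
have [hE [E00 [x0 [xflow xjump]]]] := xsol.
have near2 t s : 0 <= t -> C (s + e t) -> nearC es s.
  by move=> t0 Cs; exists (s + e t) => //; rewrite opprD addrA subrr sub0r normrN eb.
have E0 t j : E (t, j) -> 0 <= t by case: hE => h _ /h.
apply: (htd_induction hE).
- by apply: (@solution_init_near es e E x) => //; exact: eb.
- move=> a b j ab hab _.
  have a0 : 0 <= a by apply: (E0 a j); apply: hab; rewrite lexx ltW.
  have [|xC [xac xder]] := xflow j.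
    by exists ((a + b) / 2); apply: (interior_segment hab); move: ab; lra.
  have {}xac i : abs_cont_on (fun t => x t j ord0 i) a b.
    by apply: xac; apply: hab; rewrite lexx ltW.
  have acg := ac_dist xac (x b j).
  have [d d0 hd] := ac_ucont acg es0.
  (* An interior time so close to [b] that the solution moves by less than [es] between the two. *)
  pose t := Num.max ((a + b) / 2) (b - d / 2).
  have tE : a < t < b by rewrite /t lt_max gt_max; move: ab d0; lra.
  have td : b - d / 2 <= t by rewrite /t le_max lexx orbT.
  have := hd t b; rewrite subrr normr0 subr0 normr_id => h.
  have {}h : `|x t j - x b j| < es by apply: h; rewrite ?ltr_norml; move: tE td d0 ab; lra.
  have t0 : 0 <= t by move: tE a0; lra.
  have [y Cy xy] := near2 t (x t j) t0 (xC _ (interior_segment hab tE)).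
  exists y => //; have -> : x b j - y = (x t j - y) - (x t j - x b j) by rewrite opprB [RHS]addrC addrA subrK.
  by apply: le_trans (ler_normB _ _) _; move: xy h; lra.
- move=> t j Etj EtSj _.
  have [Dxi xS] := xjump t j Etj EtSj; rewrite xS /=.
  exists (G (x t j + e t)); first exact: DG.
  by rewrite addrAC subrr add0r; have := eb _ (E0 _ _ Etj); lra.
Qed.

(** The decrease hypotheses apply at [xi = x + e], a point of [C] or [D], whereas [U] is evaluated
    at [x]. Local Lipschitz constants transfer them, and the cost, proportional to [es], is absorbed
    by the margin [rho]. The bound U < M maintains itself because the decay factor is at most 1.
    Everything then stays in the ball of radius [B + 2]: [B] for the state, one unit for reading
    [e], one for adding it after a jump. *)
Lemma robust_lyapunov : exists2 es, 0 < es & forall ebar, ebar <= es ->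
  forall e : R -> V, (forall t, 0 <= t -> `|e t| <= ebar) ->
  forall E x, is_solution (perturb (HSys (fun=> C) (fun=> F) (fun=> D) (fun=> G)) e) E x ->
  U (x 0 0%N) < M ->
  forall t j, E (t, j) -> nearC r0 (x t j) /\
    U (x t j) <= g ^+ j * expR (- (c * t)) * U (x 0 0%N).
Proof.
have [Lp Lp0 hLp] := C11_lip nU (B + 2).
have [Dl Dl0 hDl] := C11_dlip nU (B + 2).
have [Db Db0 hDb] := C11_dbound nU (B + 2).
(* Along flows, [Dl * CF] pays for moving the base point of [dU], [Db] for the additive [e], and
   [c * Lp] for replacing U(xi) by U(x). A jump uses [Lp] twice. *)
pose K := Dl * CF + Db + (c + 3) * Lp.
have K0 : 0 <= K by rewrite /K !addr_ge0// !mulr_ge0// addr_ge0.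
pose es := Num.min 1 (Num.min (r0 / 2) (rho / (K + 1))).
have es0 : 0 < es by rewrite !lt_min ltr01 !divr_gt0// ltr_wpDl.
exists es => // ebar0 ebares e eb0 E x xsol UM.
have [hE [E00 [x0 [xflow xjump]]]] := xsol.
set U0 := U (x 0 0%N) in UM *.
have [es1 [esr esrho]] : es <= 1 /\ es <= r0 / 2 /\ K * es <= rho.
  split; first by rewrite /es ge_min lexx.
  split; first by rewrite /es !ge_min lexx orbT.
  have : es <= rho / (K + 1) by rewrite /es !ge_min lexx !orbT.
  rewrite ler_pdivlMr ?ltr_wpDl// => h; nra.
have eb t : 0 <= t -> `|e t| <= es by move=> t0; apply: le_trans (eb0 t t0) ebares.
clear ebar0 ebares eb0.
pose th t j := g ^+ j * expR (- (c * t)).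
have th0 t j : 0 <= th t j by rewrite mulr_ge0 ?exprn_ge0 ?expR_ge0.
have th1 t j : 0 <= t -> th t j <= 1.
  move=> t0; rewrite -[leRHS]mulr1; apply: ler_pM => //; rewrite ?exprn_ge0 ?expR_ge0 ?exprn_ile1//.
  by rewrite -expR0 ler_expR oppr_le0 mulr_ge0.
have thM t j u : 0 <= t -> u <= th t j * U0 -> u < M.
  move=> t0; have := th0 t j; have := th1 t j t0 => h1 h2 h3.
  (* A negative initial value increases towards 0 under the factor [th], so it needs its own case,
     settled by 0 < M. *)
  apply: le_lt_trans h3 _; have [U0neg|U0pos] := ltP U0 0.
    by apply: le_lt_trans M0; rewrite mulr_ge0_le0// ltW.
  by apply: le_lt_trans UM; rewrite ler_piMl.
have nearr0 s : nearC (2 * es) s -> nearC r0 s.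
  by move=> [y Cy sy]; exists y => //; lra.
have near2 t s : 0 <= t -> C (s + e t) -> nearC es s.
  by move=> t0 Cs; exists (s + e t) => //; rewrite opprD addrA subrr sub0r normrN eb.
have nearle s : nearC es s -> nearC (2 * es) s.
  by move=> [y Cy sy]; exists y => //; lra.
have nearE t j (Etj : E (t, j)) : nearC (2 * es) (x t j).
  exact: solution_near es0 eb xsol _ _ Etj.
suff main : forall t j, E (t, j) -> U (x t j) <= th t j * U0.
  by move=> t j Etj; split; [apply: nearr0; exact: nearE|exact: main].
have E0 t j : E (t, j) -> 0 <= t by case: hE => h _ /h.
apply: (htd_induction hE).
- by rewrite /th mulr0 oppr0 expR0 expr0 !mul1r.
- move=> a b j ab hab Ua.
  have a0 : 0 <= a by apply: (E0 a j); apply: hab; rewrite lexx ltW.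
  have inI t : a < t < b -> (Ij E j)° t := interior_segment hab (t := t).
  have [|xC [xac xder]] := xflow j.
    by exists ((a + b) / 2); apply: inI; lra.
  have {}xac i : abs_cont_on (fun t => x t j ord0 i) a b.
    by apply: xac; apply: hab; rewrite lexx ltW.
  pose u t := U (x t j).
  have acu : abs_cont_on u a b := C11_ac nU xac.
  have := @ac_gronwall_trap R u a b c M (ltW ab) c0 M0 (thM _ _ _ a0 Ua) acu.
  have dth : expR (- (c * (b - a))) * (th a j * U0) = th b j * U0.
    rewrite /th; have -> : - (c * b) = - (c * (b - a)) + - (c * a) by ring.
    by rewrite expRD; ring.
  move=> H; rewrite -dth; apply: le_trans (H _) _; last by rewrite ler_wpM2l ?expR_ge0.
  move: xder; apply: ae_imply => t hder tab uM.
  have Itj : Ij E j t by apply: hab; lra.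
  have t0 : 0 <= t by lra.
  set xi := x t j + e t.
  have Cxi : C xi by exact: xC (inI _ tab).
  have nx : nearC es (x t j) by exact: near2 Cxi.
  have xB : `|x t j| <= B by apply: sublevel => //; apply: nearr0; exact: nearle.
  have ext : `|e t| <= es by exact: eb.
  have xiB : `|xi| <= B + 1 by apply: le_trans (ler_normD _ _) _; lra.
  exists (dU (x t j) (F xi + e t)).
    by apply: (C11_chain nU) => i; have := hder Itj i.
  rewrite (C11_dadd nU).
  have b1 : `|x t j| <= B + 2 by lra.
  have b2 : `|xi| <= B + 2 by lra.
  have := hDl (x t j) xi (F xi) b1 b2.
  have -> : x t j - xi = - e t by rewrite /xi opprD addrA subrr sub0r.
  rewrite normrN ler_norml => /andP[_ h1].
  have h2 : Dl * `|e t| * `|F xi| <= Dl * es * CF.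
    by apply: ler_pM; rewrite ?mulr_ge0// ?ler_wpM2l// F_bound.
  have h3 : dU (x t j) (e t) <= Db * es.
    apply: le_trans (ler_norm _) _; apply: le_trans (hDb _ _ b1) _; exact: ler_wpM2l.
  have h4 := flow_decr Cxi xiB.
  have := hLp (x t j) xi b1 b2.
  have -> : x t j - xi = - e t by rewrite /xi opprD addrA subrr sub0r.
  rewrite normrN ler_norml => /andP[_ h5].
  have h6 : Lp * `|e t| <= Lp * es by apply: ler_wpM2l.
  have h7 : c * (u t - U xi) <= c * (Lp * es) by apply: ler_wpM2l => //; rewrite /u; lra.
  have h8 : Dl * es * CF + Db * es + c * (Lp * es) <= K * es.
    have : 0 <= Lp * es by rewrite mulr_ge0// ltW.
    rewrite /K; lra.
  lra.
- move=> t j Etj EtSj Ux; have nx := nearE _ _ Etj.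
  have t0 := E0 _ _ Etj.
  have [Dxi xS] := xjump t j Etj EtSj.
  move: Dxi xS => /=; set xi := x t j + e t => Dxi xS.
  have xM := thM _ _ _ t0 Ux.
  have xB : `|x t j| <= B by apply: sublevel => //; exact: nearr0.
  have ext : `|e t| <= es by exact: eb.
  have xiB : `|xi| <= B + 1 by apply: le_trans (ler_normD _ _) _; lra.
  have [GB UG] := jump_decr Dxi xiB.
  rewrite xS.
  have GeB : `|G xi + e t| <= B + 2 by apply: le_trans (ler_normD _ _) _; lra.
  have b1 : `|x t j| <= B + 2 by lra.
  have b2 : `|xi| <= B + 2 by lra.
  have b3 : `|G xi| <= B + 2 by lra.
  have := hLp _ _ GeB b3; rewrite addrAC subrr add0r ler_norml => /andP[_ h1].
  have := hLp xi (x t j) b2 b1; rewrite /xi addrAC subrr add0r -/xi ler_norml => /andP[_ h2].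
  have h6 : Lp * `|e t| <= Lp * es by apply: ler_wpM2l.
  have h7 : g * (U xi - U (x t j)) <= Lp * es.
    have [h|h] := ltP (U xi - U (x t j)) 0; first by apply: (@le_trans _ _ 0); [exact: mulr_ge0_le0 (ltW h)|rewrite mulr_ge0// ltW].
    by apply: le_trans (ler_piMl h g1) _; lra.
  have h8 : 2 * (Lp * es) <= K * es.
    rewrite mulrA ler_wpM2r ?(ltW es0)// /K.
    have : 0 <= Dl * CF by rewrite mulr_ge0.
    have : 0 <= c * Lp by rewrite mulr_ge0.
    lra.
  have h9 : th t j.+1 = g * th t j by rewrite /th exprS mulrA.
  rewrite h9 -mulrA.
  have h10 : g * U (x t j) <= g * (th t j * U0) by apply: ler_wpM2l.
  lra.
Qed.

End RobustLyapunov.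

(** * Strongly convex functions with Lipschitz gradient *)

Lemma enorm_sqr (R : realType) (n : nat) (v : 'rV[R]_n) :
  enorm v ^+ 2 = \sum_(i < n) v ord0 i ^+ 2.
Proof. by rewrite sqr_sqrtr// sumr_ge0// => i _; rewrite sqr_ge0. Qed.

Lemma enorm_ge0 (R : realType) (n : nat) (v : 'rV[R]_n) : 0 <= enorm v.
Proof. exact: sqrtr_ge0. Qed.

Lemma coord_le_enorm (R : realType) (n : nat) (v : 'rV[R]_n) i : `|v ord0 i| <= enorm v.
Proof.
rewrite -(ler_pXn2r (_ : 0 < 2)%N) ?nnegrE ?enorm_ge0// enorm_sqr real_normK ?num_real//.
by rewrite (bigD1 i)//= lerDl sumr_ge0// => j _; rewrite sqr_ge0.
Qed.

Lemma norm_le_enorm (R : realType) (n : nat) (v : 'rV[R]_n) : `|v| <= enorm v.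
Proof. by apply: norm_le_coord; [exact: enorm_ge0|exact: coord_le_enorm]. Qed.

Lemma enorm_le_norm (R : realType) (n : nat) (v : 'rV[R]_n) : enorm v <= n%:R * `|v|.
Proof.
rewrite -(ler_pXn2r (_ : 0 < 2)%N) ?nnegrE ?enorm_ge0 ?mulr_ge0// enorm_sqr exprMn.
apply: (@le_trans _ _ (\sum_(i < n) `|v| ^+ 2)).
  apply: ler_sum => i _; rewrite -[leLHS]real_normK ?num_real//.
  by rewrite ler_pXn2r ?nnegrE// coord_le_norm.
rewrite sumr_const card_ord -[leLHS]mulr_natl ler_wpM2r ?exprn_ge0// -natrX ler_nat.
by rewrite -mulnn; case: (n) => // k; rewrite leq_pmulr.
Qed.

Section StronglyConvex.
Context {R : realType} {n : nat}.
Local Notation V := 'rV[R]_n.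
Variables (phi : V -> R) (g : V -> V) (theta L : R) (zs : V).
Hypotheses (grad : is_gradient phi g) (theta0 : 0 < theta) (L0 : 0 < L).
Hypothesis g_lip : forall x y, enorm (g x - g y) <= L * enorm (x - y).
Hypothesis g_mono : forall x y, dotv (g x - g y) (x - y) >= theta * enorm (x - y) ^+ 2.
Hypothesis zs_min : forall z, phi zs <= phi z.

(** One factor n L is the Lipschitz constant of a gradient coordinate in the max norm; the other n
    counts the coordinate steps in [phi_quad]. *)
Definition quadC : R := n%:R ^+ 2 * L.

Lemma quadC_ge0 : 0 <= quadC.
Proof. by rewrite mulr_ge0 ?exprn_ge0// ltW. Qed.

Lemma grad_lip x y i : `|g x ord0 i - g y ord0 i| <= n%:R * L * `|x - y|.
Proof.
have := coord_le_enorm (g x - g y) i; rewrite !mxE => /le_trans; apply.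
apply: le_trans (g_lip x y) _; rewrite (mulrC _ L) -mulrA.
by apply: ler_wpM2l; [exact: ltW|exact: enorm_le_norm].
Qed.

Lemma phi_line (w : V) i (t : R) :
  is_derive t 1 (fun u : R => phi (w + u *: delta_mx 0 i)) (g (w + t *: delta_mx 0 i) ord0 i).
Proof.
have := grad (w + t *: delta_mx 0 i) i => -[h1 h2].
have E : (fun h : R => h^-1 *: (phi (h *: delta_mx 0 i + (w + t *: delta_mx 0 i)) -
      phi (w + t *: delta_mx 0 i))) =
   (fun h : R => h^-1 *: (phi (w + (h *: (1:R) + t) *: delta_mx 0 i) - phi (w + t *: delta_mx 0 i))).
  by apply: funext => h; rewrite [h *: (1:R)]mulr1 scalerDl addrCA.
split; first by move: h1; rewrite /derivable E.
by rewrite -h2 /derive E.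
Qed.

(** Since only partial derivatives are given, [phi] is followed along the staircase [w] that
    switches one coordinate at a time from [x] to [y]. The mean value theorem on each step evaluates
    the gradient at a point within |y - x| of [x]. *)
Lemma phi_quad x y :
  `|phi y - phi x - \sum_(i < n) g x ord0 i * (y - x) ord0 i| <= quadC * `|y - x| ^+ 2.
Proof.
pose w (k : nat) : V := \row_j (if (j < k)%N then y ord0 j else x ord0 j).
have step (k : 'I_n) : `|phi (w k.+1) - phi (w k) - g x ord0 k * (y - x) ord0 k| <=
    n%:R * L * `|y - x| ^+ 2.
  pose d := (y - x) ord0 k.
  have wE : w k.+1 = w k + d *: delta_mx 0 k.
    apply/rowP => j; rewrite !mxE /d !mxE eqxx /= ltnS leq_eqVlt.
    have [jk|jk] := eqVneq j k; first by rewrite jk eqxx ltnn /= mulr1 addrC subrK.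
    by rewrite -val_eqE /= in jk; rewrite (negbTE jk) /= mulr0 addr0.
  pose f (u : R) := phi (w k + (u * d) *: delta_mx 0 k).
  have df (u : R) : is_derive u 1 f (g (w k + (u * d) *: delta_mx 0 k) ord0 k * d).
    apply: (@is_derive1_comp _ (fun v => phi (w k + v *: delta_mx 0 k)) (fun u => u * d)).
      exact: phi_line.
    have := is_deriveZ d (is_derive_id u 1); rewrite /GRing.scale/= mulr1.
    by rewrite (_ : (d \*: id) = (fun u => u * d))//; apply: funext => v; rewrite /= mulrC.
  have [|u u01] := @MVT_segment R f _ 0 1 ler01 (fun u _ => df u).
    by apply: derivable_within_continuous => u _; apply: ex_derive.
  rewrite /f mul1r mul0r scale0r addr0 -wE subr0 mulr1 => ->.
  rewrite -/d -mulrBl normrM.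
  have dle : `|d| <= `|y - x| by exact: coord_le_norm.
  rewrite expr2 mulrA; apply: ler_pM => //.
  apply: le_trans (grad_lip _ _ _) _; apply: ler_wpM2l; first by rewrite mulr_ge0// ltW.
  apply: norm_le_coord => // j; rewrite !mxE eqxx /=.
  have [jk|jk] := eqVneq j k.
    rewrite jk ltnn mulr1 addrC addKr normrM; apply: le_trans dle.
    rewrite ler_piMl// ger0_norm; move: u01; rewrite in_itv/= => /andP[]; lra.
  rewrite mulr0 addr0; case: ifP => _; last by rewrite subrr normr0.
  by have := coord_le_norm (y - x) j; rewrite !mxE.
have w0 : w 0%N = x by apply/rowP => j; rewrite mxE.
have wn : w n = y by apply/rowP => j; rewrite mxE ltn_ord.
have tel : phi y - phi x = \sum_(i < n) (phi (w i.+1) - phi (w i)).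
  rewrite -w0 -{1}wn -(big_mkord xpredT (fun i => phi (w i.+1) - phi (w i))).
  by rewrite (telescope_sumr (fun i => phi (w i))).
rewrite tel -sumrB; apply: le_trans (ler_norm_sum _ _ _) _.
apply: le_trans (ler_sum _ (fun i _ => step i)) _.
by rewrite sumr_const card_ord /quadC expr2 -[leLHS]mulr_natl -!mulrA.
Qed.

(** The quadratic remainder of [phi_quad] takes the place of Frechet differentiability: the
    difference quotient of [phi] along [y] differs from [S h] by at most [B h], which is O(|h|). *)
Lemma phi_chain (y : R -> V) (t : R) (v : V) :
  (forall i, is_derive t 1 (fun u : R => y u ord0 i) (v ord0 i)) ->
  is_derive t 1 (fun u : R => phi (y u)) (\sum_(i < n) g (y t) ord0 i * v ord0 i).
Proof.
move=> dy.
pose D (i : 'I_n) (h : R) := h^-1 * (y (h + t) ord0 i - y t ord0 i).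
have cD i : D i h @[h --> (0:R)^'] --> v ord0 i.
  have [/cvg_ex[l hl] dE] := dy i.
  have lE : l = v ord0 i by rewrite -dE /derive; apply/esym/cvg_lim.
  rewrite -lE; apply: cvg_trans hl; apply: near_eq_cvg; near=> h.
  by rewrite /D /= [h *: (1:R)]mulr1.
have cn : `|h| @[h --> (0:R)^'] --> (0:R).
  have cid : h @[h --> (0:R)^'] --> (0:R) by apply: cvg_within_filter; exact: cvg_id.
  by have := cvg_norm cid; rewrite normr0; apply.
pose S (h : R) := \sum_(i < n) g (y t) ord0 i * D i h.
have cS : S h @[h --> (0:R)^'] --> \sum_(i < n) g (y t) ord0 i * v ord0 i.
  apply: cvg_big => [|i _]; first exact: add_continuous.
  by apply: cvgM => //; exact: cvg_cst.
pose B (h : R) := quadC * (`|h| * (\sum_(i < n) `|D i h|) ^+ 2).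
have cB : B h @[h --> (0:R)^'] --> (0 : R).
  have cs : (\sum_(i < n) `|D i h|) @[h --> (0:R)^'] --> \sum_(i < n) `|v ord0 i|.
    by apply: cvg_big => [|i _]; [exact: add_continuous|exact: cvg_norm].
  have := cvgM (cvg_cst quadC) (cvgM cn (cvgM cs cs)).
  by rewrite mul0r mulr0; apply.
have key : \forall h \near (0:R)^', `|h^-1 * (phi (y (h + t)) - phi (y t)) - S h| <= B h.
  near=> h.
  have h0 : h != 0 by near: h; exact: nbhs_dnbhs_neq.
  have := phi_quad (y t) (y (h + t)) => H.
  have -> : h^-1 * (phi (y (h + t)) - phi (y t)) - S h =
     h^-1 * (phi (y (h + t)) - phi (y t) - \sum_(i < n) g (y t) ord0 i * (y (h + t) - y t) ord0 i).
    rewrite [RHS]mulrBr; congr (_ - _); rewrite mulr_sumr /S; apply: eq_bigr => i _.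
    by rewrite /D !mxE mulrCA.
  rewrite normrM; apply: le_trans (ler_wpM2l (normr_ge0 _) H) _.
  rewrite /B mulrCA; apply: ler_wpM2l; first exact: quadC_ge0.
  have : `|y (h + t) - y t| <= `|h| * \sum_(i < n) `|D i h|.
    apply: le_trans (norm_le_sum _) _; rewrite mulr_sumr; apply: ler_sum => i _.
    by rewrite /D -normrM mulVKf// !mxE.
  move=> H2; rewrite normfV ler_pdivrMl ?normr_gt0//.
  rewrite mulrA -expr2 -exprMn ler_pXn2r ?nnegrE// mulr_ge0// sumr_ge0//.
have cphi : h^-1 * (phi (y (h + t)) - phi (y t)) @[h --> (0:R)^'] -->
    \sum_(i < n) g (y t) ord0 i * v ord0 i.
  have cE : (h^-1 * (phi (y (h + t)) - phi (y t)) - S h) @[h --> (0:R)^'] --> (0 : R).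
    apply/norm_cvg0P; apply: (@squeeze_cvgr R (0:R)^' _ R (fun=> 0) B) => //; last exact: cvg_cst.
    by near=> h; rewrite normr_ge0 /=; near: h.
  have H : (h^-1 * (phi (y (h + t)) - phi (y t)) - S h + S h) @[h --> (0:R)^'] -->
    0 + \sum_(i < n) g (y t) ord0 i * v ord0 i by apply: cvgD.
  by rewrite add0r in H; under eq_cvg => h do rewrite -[_ * _](subrK (S h)).
have E : (fun h : R => h^-1 *: (phi (y (h *: (1 : R) + t)) - phi (y t))) =
   (fun h => h^-1 * (phi (y (h + t)) - phi (y t))).
  by apply: funext => h; rewrite [h *: (1:R)]mulr1.
split.
  by rewrite /derivable E; apply/cvg_ex; exists (\sum_(i < n) g (y t) ord0 i * v ord0 i).
by rewrite /derive E; apply: cvg_lim.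
Unshelve. all: by end_near.
Qed.

(** Along the segment, [phi] minus its linear part and minus theta / 2 times the squared distance
    has a non-negative derivative, by strong monotonicity of the gradient; the mean value theorem
    compares the two ends. *)
Lemma phi_convex x y : phi x + \sum_(i < n) g x ord0 i * (y - x) ord0 i +
  theta / 2 * \sum_(i < n) (y - x) ord0 i ^+ 2 <= phi y.
Proof.
set d := y - x; set S := \sum_(i < n) g x ord0 i * d ord0 i; set Q := \sum_(i < n) d ord0 i ^+ 2.
pose f (s : R) := phi (x + s *: d).
have df (s : R) : is_derive s 1 f (\sum_(i < n) g (x + s *: d) ord0 i * d ord0 i).
  apply: (@phi_chain (fun s => x + s *: d)) => i.
  have := is_deriveD (is_derive_cst (x ord0 i) s 1) (is_deriveZ (d ord0 i) (is_derive_id s 1)).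
  rewrite add0r /GRing.scale/= mulr1.
  rewrite (_ : cst _ + _ = (fun u : R => (x + u *: d) ord0 i))//.
  by apply: funext => u; rewrite !fctE/= !mxE /= /GRing.scale/= mulrC.
pose h (s : R) := f s - (S * s + theta / 2 * Q * s ^+ 2).
have dh (s : R) : is_derive s 1 h (\sum_(i < n) g (x + s *: d) ord0 i * d ord0 i - (S + theta * Q * s)).
  apply: is_deriveB => //.
  have h1 := is_deriveZ S (is_derive_id s 1).
  have h2 := is_deriveZ (theta / 2 * Q) (is_deriveM (is_derive_id s 1) (is_derive_id s 1)).
  have := is_deriveD h1 h2; rewrite /GRing.scale /= !mulr1.
  rewrite (_ : theta / 2 * Q * (s + s) = theta * Q * s); last by field.
  by rewrite (_ : (_ \*: id + _ \*: _) = (fun u : R => S * u + theta / 2 * Q * u ^+ 2)).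
have [|s s01] := @MVT R h _ 0 1 ltr01 (fun u _ => dh u).
  by apply: derivable_within_continuous => u _; apply: ex_derive.
move: s01; rewrite in_itv/= => /andP[s0 s1].
have xd : x + d = y by rewrite /d addrC subrK.
rewrite subr0 mulr1 /h /f scale0r scale1r addr0 xd expr1n !mulr1 expr0n /= !mulr0 addr0 subr0.
have := g_mono (x + s *: d) x; rewrite enorm_sqr /dotv.
have -> : x + s *: d - x = s *: d by rewrite addrC addKr.
have -> : \sum_(i < n) (s *: d) ord0 i ^+ 2 = s ^+ 2 * Q.
  by rewrite mulr_sumr; apply: eq_bigr => i _; rewrite mxE exprMn.
have -> : \sum_i (g (x + s *: d) - g x) ord0 i * (s *: d) ord0 i =
   s * (\sum_(i < n) g (x + s *: d) ord0 i * d ord0 i - S).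
  by rewrite -sumrB mulr_sumr; apply: eq_bigr => i _; rewrite !mxE; ring.
set T := \sum_(i < n) _.
rewrite (_ : theta * (s ^+ 2 * Q) = s * (theta * Q * s)); last by ring.
rewrite ler_pM2l// => H; lra.
Qed.

(** Otherwise a gradient step in one coordinate, with step size 1 / (quadC + 1), would lower [phi]
    below its minimum, because the quadratic error is smaller than the linear gain. *)
Lemma grad_min : g zs = 0.
Proof.
apply/rowP => i; rewrite [RHS]mxE; apply/eqP/negPn/negP => gi.
pose G := g zs ord0 i.
pose s := (quadC + 1)^-1.
have q0 := quadC_ge0.
have s0 : 0 < s by rewrite invr_gt0 ltr_wpDl.
have sq : s * quadC < 1 by rewrite /s mulrC ltr_pdivrMr ?ltr_wpDl// mul1r ltrDl.
have := phi_quad zs (zs + (- (s * G)) *: delta_mx 0 i).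
rewrite (_ : zs + - (s * G) *: delta_mx 0 i - zs = - (s * G) *: delta_mx 0 i); last by rewrite addrC addKr.
have -> : \sum_(i0 < n) g zs ord0 i0 * ((- (s * G)) *: delta_mx 0 i : V) ord0 i0 = - (s * G ^+ 2).
  rewrite (bigD1 i)//= big1 ?addr0; last first.
    by move=> j /negbTE ji; rewrite !mxE ji andbF !mulr0.
  by rewrite !mxE !eqxx mulr1 -/G; ring.
have : `|(- (s * G)) *: delta_mx 0 i : V| <= s * `|G|.
  apply: norm_le_coord; first by rewrite mulr_ge0// ltW.
  move=> j; rewrite !mxE /=; case: (j == i); rewrite ?mulr1 ?mulr0 ?normr0 ?normrN ?normrM ?(gtr0_norm s0)//.
  by rewrite mulr_ge0// ltW.
set N := `|_ : V|; move=> NG.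
have N2 : N ^+ 2 <= s ^+ 2 * G ^+ 2.
  by rewrite -[G ^+ 2]real_normK ?num_real// -exprMn; apply: lerXn2r => //; rewrite nnegrE ?mulr_ge0 ?normr_ge0 ?(ltW s0).
have G2 : 0 < G ^+ 2 by rewrite exprn_even_gt0.
rewrite ler_norml => /andP[_].
have := zs_min (zs + (- (s * G)) *: delta_mx 0 i).
set P := phi _.
move=> h1 h2.
have h3 : quadC * N ^+ 2 <= quadC * (s ^+ 2 * G ^+ 2) by apply: ler_wpM2l.
have h4 : quadC * (s ^+ 2 * G ^+ 2) < s * G ^+ 2.
  have -> : quadC * (s ^+ 2 * G ^+ 2) = (s * quadC) * (s * G ^+ 2) by ring.
  by rewrite gtr_pMl// mulr_gt0.
lra.
Qed.

Lemma phi_lb x : theta / 2 * \sum_(i < n) (x - zs) ord0 i ^+ 2 <= phi x - phi zs.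
Proof.
have := phi_convex zs x; rewrite grad_min big1 ?addr0; last by move=> i _; rewrite mxE mul0r.
lra.
Qed.

(** Strong convexity read from [x] towards the minimizer: the form that meets the term g . (p - zs)
    left by the flow. *)
Lemma phi_gap x : phi x - phi zs <=
  \sum_(i < n) g x ord0 i * (x - zs) ord0 i - theta / 2 * \sum_(i < n) (x - zs) ord0 i ^+ 2.
Proof.
have := phi_convex x zs.
have -> : \sum_(i < n) g x ord0 i * (zs - x) ord0 i = - \sum_(i < n) g x ord0 i * (x - zs) ord0 i.
  by rewrite -sumrN; apply: eq_bigr => i _; rewrite !mxE; ring.
have -> : \sum_(i < n) (zs - x) ord0 i ^+ 2 = \sum_(i < n) (x - zs) ord0 i ^+ 2.
  by apply: eq_bigr => i _; rewrite !mxE; ring.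
lra.
Qed.

Lemma phi_ub x : phi x - phi zs <= quadC * `|x - zs| ^+ 2.
Proof.
have := phi_quad zs x; rewrite grad_min big1 ?subr0; last by move=> i _; rewrite mxE mul0r.
by apply: le_trans; exact: ler_norm.
Qed.

Lemma grad_ub x i : `|g x ord0 i| <= n%:R * L * `|x - zs|.
Proof. by have := grad_lip x zs i; rewrite grad_min [(0 : V) _ _]mxE subr0. Qed.

Lemma phi_lip B : exists2 K, 0 <= K & forall x y : V, `|x| <= B -> `|y| <= B ->
  `|phi x - phi y| <= K * `|x - y|.
Proof.
have nd0 : 0 <= n%:R * L * (`|B| + `|zs|) by rewrite !mulr_ge0 ?addr_ge0// ltW.
have Q0 := quadC_ge0.
exists (n%:R * (n%:R * L * (`|B| + `|zs|)) + quadC * (2 * `|B|)).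
  by rewrite addr_ge0// mulr_ge0// mulr_ge0.
move=> x y xB yB; have := phi_quad y x; set T := \sum_(i < n) _ => h.
have TB : `|T| <= n%:R * (n%:R * L * (`|B| + `|zs|)) * `|x - y|.
  apply: le_trans (ler_norm_sum _ _ _) _.
  apply: (@le_trans _ _ (\sum_(i < n) n%:R * L * (`|B| + `|zs|) * `|x - y|)).
    apply: ler_sum => i _; rewrite normrM; apply: ler_pM => //; last exact: coord_le_norm.
    apply: le_trans (grad_ub y i) _; apply: ler_wpM2l; first by rewrite mulr_ge0// ltW.
    apply: le_trans (ler_normB _ _) _; rewrite lerD2r; exact: le_trans yB (ler_norm _).
  by rewrite sumr_const card_ord -[leLHS]mulr_natl mulrA.
rewrite -[phi x - phi y](subrK T); apply: le_trans (ler_normD _ _) _.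
rewrite mulrDl addrC; apply: lerD => //.
apply: le_trans h _; rewrite -(mulrA quadC); apply: ler_wpM2l => //; rewrite expr2.
apply: ler_wpM2r => //; apply: le_trans (ler_normB _ _) _.
have := ler_norm B; lra.
Qed.

End StronglyConvex.

(** * Coordinates of the hybrid system *)

Lemma st_norm (R : realType) (n : nat) (s : 'rV[R]_(4 * n).+1) q : `|st s q| <= `|s|.
Proof. exact: coord_le_norm. Qed.

Lemma st_rowE (R : realType) (n : nat) (f : 'I_(4 * n).+1 -> R) q :
  st (\row_j f j) q = f (inord q).
Proof. by rewrite /st mxE. Qed.

Lemma stD (R : realType) (n : nat) (s v : 'rV[R]_(4 * n).+1) q : st (s + v) q = st s q + st v q.
Proof. by rewrite /st mxE. Qed.

Lemma stB (R : realType) (n : nat) (s v : 'rV[R]_(4 * n).+1) q : st (s - v) q = st s q - st v q.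
Proof. by rewrite /st !mxE. Qed.

Lemma C11_st (R : realType) (n : nat) q :
  @C11 R (4 * n).+1 (fun s => st s q) (fun _ v => st v q).
Proof. exact: C11_coord. Qed.

Lemma x1_of_lip (R : realType) (n : nat) (s s' : 'rV[R]_(4 * n).+1) :
  `|x1_of s - x1_of s'| <= `|s - s'|.
Proof. by apply: norm_le_coord => // i; rewrite !mxE -stB st_norm. Qed.

Lemma x1_of_norm (R : realType) (n : nat) (s : 'rV[R]_(4 * n).+1) : `|x1_of s| <= `|s|.
Proof. by apply: norm_le_coord => // i; rewrite !mxE st_norm. Qed.

Lemma ltn_x1 (n : nat) (i : 'I_n) : (i < 2 * n)%N.
Proof. by have := ltn_ord i; lia. Qed.

Lemma ltn_sub_x2 (n i : nat) : (n <= i)%N -> (i < 2 * n)%N -> (i - n < n)%N.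
Proof. lia. Qed.

Lemma ltn_half_mu (n i : nat) : (2 * n <= i)%N -> (i < 4 * n)%N -> ((i - 2 * n)./2 < n)%N.
Proof. by move=> h1 h2; rewrite ltn_half_double; lia. Qed.

Section Coordinates.
Context {R : realType} {n : nat}.
Local Notation V := 'rV[R]_n.
Local Notation S := 'rV[R]_(4 * n).+1.
Variables (phi : V -> R) (kappa : nat -> rat) (k Tmin : R).

(** Accessors for the two blocks of x and for the i-th circle: [cc] is the component of mu that
    enters the dither, [sc] the orthogonal one. *)
Definition pc (s : S) (i : nat) := st s i.
Definition qc (s : S) (i : nat) := st s (n + i).
Definition cc (s : S) (i : nat) := st s (2 * n + 2 * i).
Definition sc (s : S) (i : nat) := st s (2 * n + 2 * i + 1).

Definition om (i : nat) : R := 2 * pi * ratr (kappa i).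

Definition fastF (s : S) : S := \row_j
  let q := nat_of_ord j in
  if (q < 2 * n)%N then 0 else if (q < 4 * n)%N then Rmu kappa s (q - 2 * n) else 0.

(* The averaging corrector [Wf] below ignores the x2 block: evaluating it at
   [maskq s] bounds it without a bound on x2. *)
Definition maskq (s : S) : S := \row_j
  if (n <= nat_of_ord j < 2 * n)%N then 0 else s ord0 j.

(* As 0^-1 = 0, [flow_map] at [eps = 0] is the part of the field without the fast rotation. *)
Lemma flow_map_split a eps (s : S) :
  flow_map kappa k phi a eps s = eps^-1 *: fastF s + flow_map kappa k phi a 0 s.
Proof.
apply/rowP => j; rewrite !mxE /= invr0 mul0r.
case: ifP => h1; first by rewrite (ltn_trans h1) ?mulr0 ?add0r//; lia.
case: ifP => h2; first by rewrite mulr0 add0r.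
by case: ifP => h3; rewrite ?addr0// mulr0 add0r.
Qed.

Lemma fastF_slow (s : S) q : (q < 2 * n)%N || (q == 4 * n)%N -> st (fastF s) q = 0.
Proof.
move=> /orP[h|/eqP ->]; rewrite /fastF st_rowE /= inordK //; last 2 first.
- by lia.
- by rewrite ltnn; case: ifP => // h; exfalso; lia.
by rewrite h.
Qed.

Lemma fastF_cc (s : S) (i : nat) : (i < n)%N -> cc (fastF s) i = om i * sc s i.
Proof.
move=> h; rewrite /cc /fastF st_rowE /= inordK; last lia.
rewrite ifF; last lia. rewrite ifT; last lia.
rewrite (_ : 2 * n + 2 * i - 2 * n = i.*2)%N; last lia.
rewrite /Rmu odd_double doubleK /om /sc; congr (_ * st s _); lia.
Qed.

Lemma fastF_sc (s : S) (i : nat) : (i < n)%N -> sc (fastF s) i = - om i * cc s i.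
Proof.
move=> h; rewrite /sc /fastF st_rowE /= inordK; last lia.
rewrite ifF; last lia. rewrite ifT; last lia.
rewrite (_ : 2 * n + 2 * i + 1 - 2 * n = i.*2.+1)%N; last lia.
rewrite /Rmu /= odd_double /= uphalf_double /om /cc; congr (_ * st s _); lia.
Qed.

Lemma st_maskq s q : (q <= 4 * n)%N -> ~~ (n <= q < 2 * n)%N -> st (maskq s) q = st s q.
Proof. by move=> qn /negbTE h; rewrite /maskq st_rowE inordK ?h. Qed.

Lemma torus_cc (s : S) i : on_torus s -> (i < n)%N -> `|cc s i| <= 1.
Proof.
move=> ts ni; rewrite -(ler_pXn2r (_ : 0 < 2)%N) ?nnegrE// expr1n real_normK ?num_real//.
by rewrite -(ts i ni) /cc lerDl sqr_ge0.
Qed.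

Lemma torus_sc (s : S) i : on_torus s -> (i < n)%N -> `|sc s i| <= 1.
Proof.
move=> ts ni; rewrite -(ler_pXn2r (_ : 0 < 2)%N) ?nnegrE// expr1n real_normK ?num_real//.
by rewrite -(ts i ni) /sc lerDr sqr_ge0.
Qed.

Lemma flow_pc a eps (s : S) i : (i < n)%N ->
  pc (flow_map kappa k phi a eps s) i = 2 / tau_of s * (qc s i - pc s i).
Proof. by move=> ni; rewrite /pc st_rowE /= inordK ?ni//; lia. Qed.

Lemma flow_qc a eps (s : S) i : (i < n)%N ->
  qc (flow_map kappa k phi a eps s) i =
  - (4 / a) * k * tau_of s * phi (z_of a s) * cc s i.
Proof.
move=> ni; rewrite /qc st_rowE /= inordK; last lia.
rewrite ifF; last lia. rewrite ifT; last lia.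
by rewrite /cc addKn.
Qed.

Lemma flow_tau a eps (s : S) : tau_of (flow_map kappa k phi a eps s) = 1 / 2.
Proof.
rewrite /tau_of st_rowE /= inordK; last lia.
rewrite ifF; last lia. rewrite ifF; last lia. by rewrite ifF; last lia.
Qed.

Lemma torus_st (s : S) q : on_torus s -> (2 * n <= q)%N -> (q < 4 * n)%N -> `|st s q| <= 1.
Proof.
move=> ts h1 h2; pose i := (q - 2 * n)./2.
have ni : (i < n)%N by exact: ltn_half_mu.
have := odd_double_half (q - 2 * n); rewrite -/i => h.
have := torus_sc ts ni; have := torus_cc ts ni; rewrite /cc /sc.
case: (odd _) h => /= h.
  by have -> : (2 * n + 2 * i + 1 = q)%N by lia.
by have -> : (2 * n + 2 * i = q)%N by lia.
Qed.

Lemma jump_pc (s : S) i : (i < n)%N -> pc (jump_map Tmin s) i = pc s i.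
Proof. by move=> ni; rewrite /pc st_rowE /= inordK ?ni//; lia. Qed.

Lemma jump_x1 (s : S) : x1_of (jump_map Tmin s) = x1_of s.
Proof. by apply/rowP => i; rewrite !mxE; exact: jump_pc. Qed.

Lemma jump_qc (s : S) i : (i < n)%N -> qc (jump_map Tmin s) i = pc s i.
Proof.
move=> ni; rewrite /qc /pc st_rowE /= inordK; last lia.
rewrite ifF; last lia. rewrite ifT; last lia. by rewrite addKn.
Qed.

Lemma jump_mu (s : S) q : (2 * n <= q)%N -> (q < 4 * n)%N ->
  st (jump_map Tmin s) q = st s q.
Proof.
move=> h1 h2; rewrite st_rowE /= inordK; last lia.
rewrite ifF; last lia. rewrite ifF; last lia. by rewrite h2.
Qed.

Lemma jump_torus (s : S) : on_torus s -> on_torus (jump_map Tmin s).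
Proof. by move=> ts i ni; rewrite !jump_mu//; [exact: ts| lia..]. Qed.

Lemma jump_tau (s : S) : tau_of (jump_map Tmin s) = Tmin.
Proof.
rewrite /tau_of st_rowE /= inordK; last lia.
rewrite ifF; last lia. rewrite ifF; last lia. by rewrite ltnn.
Qed.

Lemma flow_cc a eps (s : S) (i : nat) : (i < n)%N ->
  cc (flow_map kappa k phi a eps s) i = eps^-1 * (om i * sc s i).
Proof.
move=> ni; rewrite -fastF_cc// flow_map_split /cc stD [X in _ + X]st_rowE /= inordK; last lia.
rewrite ifF; last lia. rewrite ifF; last lia. rewrite ifT; last lia.
by rewrite invr0 mul0r addr0 /st mxE.
Qed.

Lemma flow_sc a eps (s : S) (i : nat) : (i < n)%N ->
  sc (flow_map kappa k phi a eps s) i = eps^-1 * (- om i * cc s i).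
Proof.
move=> ni; rewrite -fastF_sc// flow_map_split /sc stD [X in _ + X]st_rowE /= inordK; last lia.
rewrite ifF; last lia. rewrite ifF; last lia. rewrite ifT; last lia.
by rewrite invr0 mul0r addr0 /st mxE.
Qed.

Lemma cc_maskq (s : S) (j : 'I_n) : cc (maskq s) j = cc s j.
Proof. by have := ltn_ord j => h; apply: st_maskq; lia. Qed.

Lemma sc_maskq (s : S) (j : 'I_n) : sc (maskq s) j = sc s j.
Proof. by have := ltn_ord j => h; apply: st_maskq; lia. Qed.

Lemma x1_maskq (s : S) : x1_of (maskq s) = x1_of s.
Proof. by apply/rowP => j; rewrite !mxE; have := ltn_ord j => h; apply: st_maskq; lia. Qed.

Lemma tau_maskq (s : S) : tau_of (maskq s) = tau_of s.
Proof. by apply: st_maskq; lia. Qed.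

End Coordinates.

(** * Averaging and the Lyapunov function *)

Lemma small_mul (R : realType) (K t : R) : 0 <= K -> 0 < t ->
  exists2 es, 0 < es & forall e, 0 < e < es -> e * K <= t.
Proof.
move=> K0 t0; exists (t / (K + 1)); first by rewrite divr_gt0// ltr_wpDl.
move=> e /andP[e0]; rewrite ltr_pdivlMr ?ltr_wpDl//; nra.
Qed.

Lemma sqr_le_abs (R : realType) (x X : R) : x ^+ 2 <= X -> `|x| <= X + 1.
Proof.
move=> h; rewrite -real_normK ?num_real// in h.
have := normr_ge0 x; nra.
Qed.

Section Lyapunov.
Context {R : realType} {n : nat}.
Local Notation V := 'rV[R]_n.
Local Notation S := 'rV[R]_(4 * n).+1.
Variables (phi : V -> R) (g : V -> V) (theta L : R) (zs : V).
Hypotheses (grad : is_gradient phi g) (theta0 : 0 < theta) (L0 : 0 < L).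
Hypothesis g_lip : forall x y, enorm (g x - g y) <= L * enorm (x - y).
Hypothesis g_mono : forall x y, dotv (g x - g y) (x - y) >= theta * enorm (x - y) ^+ 2.
Hypothesis zs_min : forall z, phi zs <= phi z.
Variables (kappa : nat -> rat) (k Tmin Tmax : R).
Hypothesis kappa0 : forall i, (i < n)%N -> 0 < kappa i.
Hypothesis kappa_inj : forall i j, (i < n)%N -> (j < n)%N -> kappa i = kappa j -> i = j.
Hypotheses (k0 : 0 < k) (Tmin0 : 0 < Tmin) (Tlt : Tmin < Tmax).

Local Notation om := (@om R kappa).
Local Notation fastF := (fastF kappa).
Local Notation C := (@flow_set R n Tmin Tmax).
Local Notation D := (@jump_set R n Tmax).
Local Notation QC := (@quadC R n L).

(** The shift [w] is there for the difference quotients, which need [phi] both at x1 and at x1 + a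
    e_j. *)
Lemma C11_phi (w : V) : C11 (fun s : S => phi (x1_of s + w))
  (fun s v => \sum_(i < n) g (x1_of s + w) ord0 i * pc v i).
Proof.
have nd0 : 0 <= n%:R * L by rewrite mulr_ge0// ltW.
have gB (B : R) (s : S) i : `|s| <= B -> `|g (x1_of s + w) ord0 i| <= n%:R * L * (`|B| + `|w| + `|zs|).
  move=> sB; apply: le_trans (grad_ub grad L0 g_lip zs_min _ _) _.
  apply: ler_wpM2l => //; apply: le_trans (ler_normB _ _) _; rewrite lerD2r.
  apply: le_trans (ler_normD _ _) _; rewrite lerD2r.
  by apply: le_trans (x1_of_norm s) _; apply: le_trans sB (ler_norm _).
split.
- move=> B; have [K K0 hK] := phi_lip grad L0 g_lip zs_min (B + `|w|); exists K => // s s' sB s'B.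
  have xw (u : S) : `|u| <= B -> `|x1_of u + w| <= B + `|w|.
    move=> uB; apply: le_trans (ler_normD _ _) _; rewrite lerD2r; exact: le_trans (x1_of_norm _) uB.
  apply: le_trans (hK _ _ (xw _ sB) (xw _ s'B)) _; apply: ler_wpM2l => //.
  by rewrite opprD addrACA subrr addr0 x1_of_lip.
- move=> B; exists (n%:R * (n%:R * L)); first by rewrite mulr_ge0.
  move=> s s' v _ _; rewrite -sumrB; apply: le_trans (ler_norm_sum _ _ _) _.
  apply: (@le_trans _ _ (\sum_(i < n) n%:R * L * `|s - s'| * `|v|)).
    apply: ler_sum => i _; rewrite -mulrBl normrM; apply: ler_pM => //; last exact: st_norm.
    apply: le_trans (grad_lip L0 g_lip _ _ _) _; apply: ler_wpM2l => //.
    by rewrite opprD addrACA subrr addr0 x1_of_lip.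
  by rewrite sumr_const card_ord -[leLHS]mulr_natl !mulrA.
- move=> B; exists (n%:R * (n%:R * L * (`|B| + `|w| + `|zs|))).
    by rewrite !mulr_ge0// ?(ltW L0)// !addr_ge0.
  move=> s v sB; apply: le_trans (ler_norm_sum _ _ _) _.
  apply: (@le_trans _ _ (\sum_(i < n) n%:R * L * (`|B| + `|w| + `|zs|) * `|v|)).
    by apply: ler_sum => i _; rewrite normrM; apply: ler_pM => //; [exact: gB|exact: st_norm].
  by rewrite sumr_const card_ord -[leLHS]mulr_natl !mulrA.
- move=> c s v v'; rewrite mulr_sumr -big_split; apply: eq_bigr => i _ /=.
  by rewrite /pc /st !mxE; ring.
- move=> x t v dx.
  apply: is_derive_eq.
    apply: (@phi_chain _ _ _ _ _ grad L0 g_lip (fun u => x1_of (x u) + w) t (\row_i pc v i)) => i.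
    have := is_deriveD (dx (inord i)) (is_derive_cst (w ord0 i) t 1); rewrite addr0 mxE.
    rewrite (_ : (_ + cst _) = (fun u : R => (x1_of (x u) + w) ord0 i))//.
    by apply: funext => u; rewrite !mxE.
  by apply: eq_bigr => i _; rewrite mxE.
Qed.

Lemma om_gt0 i : (i < n)%N -> 0 < om i.
Proof.
by move=> ni; apply: mulr_gt0; [rewrite mulr_gt0// pi_gt0|rewrite ltr0q kappa0].
Qed.

(** These are the denominators of the off-diagonal antiderivatives. The factor om j + om i is
    positive, so distinct frequencies are enough. *)
Lemma om_sqr_neq i j : (i < n)%N -> (j < n)%N -> i != j -> om j ^+ 2 - om i ^+ 2 != 0.
Proof.
move=> ni nj; apply: contra => /eqP; rewrite subr_sqr => /eqP; rewrite mulf_eq0 => /orP[].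
  rewrite subr_eq0 => /eqP /mulfI H; apply/eqP/kappa_inj => //.
  apply: (fmorph_inj (@ratr R)); apply/esym/H.
  by rewrite mulf_neq0// gt_eqF// pi_gt0.
by rewrite gt_eqF// addr_gt0// om_gt0.
Qed.

(* Difference quotients instead of partial derivatives keep the corrector [Wf] of class
   C11 although the gradient of [phi] is merely Lipschitz. *)
Definition diffq (a : R) (j : 'I_n) (s : S) : R :=
  a^-1 * (phi (x1_of s + a *: delta_mx 0 j) - phi (x1_of s)).

Lemma C11_diffq a j : exists dG, C11 (diffq a j) dG /\ forall s, dG s (fastF s) = 0.
Proof.
have h1 := C11_phi (a *: delta_mx 0 j).
have h2 := C11_scale (-1) (C11_phi 0).
eexists; split.
  apply: C11_ext (C11_scale a^-1 (C11_add h1 h2)) => // s.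
  by rewrite addr0 mulN1r.
move=> s /=; have h (i : 'I_n) : pc (fastF s) i = 0.
  by apply: fastF_slow; rewrite ltn_x1.
by rewrite !big1 ?mulr0 ?addr0 ?mulr0// => i _; rewrite h mulr0.
Qed.

(* Antiderivative of cos_i cos_j - delta_ij / 2 along the rotation; it exists because
   the frequencies are distinct. *)
Definition Pf (i j : 'I_n) (s : S) : R :=
  if i == j then - (2 * om i)^-1 * (cc s i * sc s i)
  else (om j ^+ 2 - om i ^+ 2)^-1 * (om i * (sc s i * cc s j) + - om j * (cc s i * sc s j)).

Lemma C11_Pf i j : exists dP, C11 (Pf i j) dP /\ forall s, on_torus s ->
  dP s (fastF s) = cc s i * cc s j - (if i == j then 2^-1 else 0).
Proof.
rewrite /Pf; have [<-{j}|ij] := eqVneq i j.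
  eexists; split.
    exact: (C11_scale _ (C11_mul (C11_st R n _) (C11_st R n _))).
  move=> s ts /=; rewrite -/(cc (fastF s) i) -/(sc (fastF s) i) -/(cc s i) -/(sc s i).
  rewrite fastF_cc// fastF_sc//; have := ts i (ltn_ord i); rewrite -/(cc s i) -/(sc s i) => h.
  have o0 : om i != 0 by rewrite gt_eqF// om_gt0.
  (* The diagonal case is where the circle equation enters: the derivative is (cos^2 - sin^2) / 2,
     which equals cos^2 - 1/2 on the torus. *)
  have -> : sc s i * (om i * sc s i) = om i * (1 - cc s i ^+ 2) by rewrite -h; ring.
  by field.
have oij := om_sqr_neq (ltn_ord i) (ltn_ord j) ij.
eexists; split.
  exact: (C11_scale _ (C11_add
     (C11_scale _ (C11_mul (C11_st R n _) (C11_st R n _)))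
     (C11_scale _ (C11_mul (C11_st R n _) (C11_st R n _))))).
move=> s ts /=; rewrite -/(cc (fastF s) i) -/(sc (fastF s) i) -/(cc s i) -/(sc s i).
rewrite -/(cc (fastF s) j) -/(sc (fastF s) j) -/(cc s j) -/(sc s j).
rewrite !fastF_cc// !fastF_sc//; field.
by rewrite oij.
Qed.

(** Antiderivative along the rotation of the zero-mean part of (phi(x1) + a sum_j diffq_j cos_j)
    cos_i, the first-order model of phi(z) cos_i. The mean a diffq_i / 2 comes from the diagonal of
    [Pf]. *)
Definition Yf (a : R) (i : 'I_n) (s : S) : R :=
  - (om i)^-1 * (phi (x1_of s) * sc s i) + a * \sum_(j < n) diffq a j s * Pf i j s.

Lemma C11_Yf a i : exists dY, C11 (Yf a i) dY /\ forall s, on_torus s ->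
  dY s (fastF s) = phi (x1_of s) * cc s i + a * \sum_(j < n) diffq a j s * (cc s i * cc s j)
    - a / 2 * diffq a i s.
Proof.
have /choice[dG hG] : forall j, exists dG, C11 (diffq a j) dG /\ forall s, dG s (fastF s) = 0.
  by move=> j; exact: C11_diffq.
have /choice[dP hP] := C11_Pf i.
have nphi : C11 (fun s : S => phi (x1_of s)) (fun s v => \sum_(i < n) g (x1_of s + 0) ord0 i * pc v i).
  by apply: C11_ext (C11_phi 0) => // s; rewrite addr0.
have h1 := C11_scale (- (om i)^-1) (C11_mul nphi (C11_st R n (2 * n + 2 * i + 1))).
have h2 := C11_scale a (C11_sum (fun j => C11_mul (hG j).1 (hP j).1)).
eexists; split; first exact: C11_add h1 h2.
move=> s ts /=; rewrite -/(sc (fastF s) i) fastF_sc//.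
rewrite big1 ?mulr0 ?addr0; last first.
  by move=> j _; rewrite /pc fastF_slow ?mulr0// ltn_x1.
have o0 : om i != 0 by rewrite gt_eqF// om_gt0.
rewrite -addrA; congr (_ + _); first by field.
have -> : \sum_(j < n) (diffq a j s * dP j s (fastF s) + Pf i j s * dG j s (fastF s)) =
  \sum_(j < n) diffq a j s * (cc s i * cc s j) - 2^-1 * diffq a i s.
  rewrite (bigD1 i)//= [in RHS](bigD1 i)//= (hG i).2 (hP i).2// eqxx mulr0 addr0.
  rewrite [X in _ + X = _](_ : _ = \sum_(i0 < n | i0 != i) diffq a i0 s * (cc s i * cc s i0)); first by ring.
  by apply: eq_bigr => j ji; rewrite (hG j).2 (hP j).2// eq_sym (negbTE ji) mulr0 addr0 subr0.
by field.
Qed.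

(** The factor is the gain of the x2 dynamics with the opposite sign, so that eps W cancels the
    oscillation of q and leaves minus the mean, that is - (4 k tau / a) (a / 2) diffq_i = - 2 k tau
    diffq_i. *)
Definition Wf (a : R) (i : 'I_n) (s : S) : R := 4 * k / a * (tau_of s * Yf a i s).

Lemma C11_Wf a i : exists dW, C11 (Wf a i) dW /\ forall s, on_torus s ->
  dW s (fastF s) = 4 * k / a * tau_of s *
   (phi (x1_of s) * cc s i + a * \sum_(j < n) diffq a j s * (cc s i * cc s j)
    - a / 2 * diffq a i s).
Proof.
have [dY [nY hY]] := C11_Yf a i.
eexists; split; first exact: C11_scale (C11_mul (C11_st R n (4 * n)) nY).
move=> s ts /=; rewrite hY// fastF_slow ?eqxx ?orbT// mulr0 addr0 -/(tau_of s); ring.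
Qed.

Lemma Wf_maskq a i s : Wf a i (maskq s) = Wf a i s.
Proof.
rewrite /Wf /Yf /Pf /diffq tau_maskq x1_maskq sc_maskq.
do 2 congr (_ * _); congr (_ + _ * _); apply: eq_bigr => j _; by rewrite !sc_maskq !cc_maskq.
Qed.

(** * The Lyapunov function and its decay, with residual terms *)

Lemma Tmax_gt0 : 0 < Tmax. Proof. exact: lt_trans Tlt. Qed.

(* [y] stands for x2 or for the corrected variable x2 + eps W. *)
Definition Vq (s : S) (y : 'I_n -> R) : R :=
  \sum_(i < n) (1 / 4 * (pc s i - y i) ^+ 2 + 1 / 4 * (y i - zs ord0 i) ^+ 2)
  + k * tau_of s ^+ 2 * (phi (x1_of s) - phi zs).
Definition Vf (s : S) : R := Vq s (fun i => qc s i).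

(** The first entry is the least dissipation rate of |p - y|^2. The second compares the dissipation
    of |p - zs|^2 due to strong convexity with the bound V <= |p - y|^2 + (1/2 + k Tmax^2 QC) |p -
    zs|^2. *)
Definition rateV : R :=
  Num.min Tmax^-1 (k * Tmin * theta / 2 / (1 / 2 + k * Tmax ^+ 2 * QC)).

Definition gam : R := (k * Tmax ^+ 2)^-1 * ((2 * theta)^-1 + k * Tmin ^+ 2).

Lemma rateV_gt0 : 0 < rateV.
Proof.
have Tmax0 := Tmax_gt0; have QC0 := @quadC_ge0 R n L L0.
have Tm0 := Tmin0; have Tlt' := Tlt.
rewrite lt_min invr_gt0 Tmax0 /= divr_gt0//; first by rewrite !mulr_gt0// invr_gt0.
by rewrite ltr_pwDl// !mulr_ge0// ?exprn_ge0 ?ltW.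
Qed.

Lemma gam_ge0 : 0 <= gam.
Proof.
apply: mulr_ge0; first by rewrite invr_ge0 mulr_ge0 ?sqr_ge0// ltW.
apply: addr_ge0; first by rewrite invr_ge0 mulr_ge0// ltW.
by rewrite mulr_ge0 ?sqr_ge0// ltW.
Qed.

Lemma gam_le1 : Tmax ^+ 2 - Tmin ^+ 2 >= 1 / (2 * theta * k) -> gam <= 1.
Proof.
have Tmax0 := Tmax_gt0.
move=> Tgap; have kT : 0 < k * Tmax ^+ 2 by rewrite mulr_gt0// exprn_gt0.
rewrite /gam mulrC ler_pdivrMr// mul1r.
have : (2 * theta)^-1 = k * (1 / (2 * theta * k)).
  by field; rewrite !gt_eqF.
move=> ->; rewrite -mulrDr ler_wpM2l ?(ltW k0)//.
by move: Tgap; rewrite lerBrDr.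
Qed.

(** Pure algebra on coordinates: [r'] and [r] are the errors in the velocities of p and y with
    respect to the averaged system, [De] is the optimality gap, and the two hypotheses on it are
    strong convexity and the quadratic upper bound. The products of G with y cancel exactly, up to
    [r] and [r']. *)
Lemma Vq_decr (p y z G r r' : 'I_n -> R) (tau De : R) :
  Tmin <= tau -> tau <= Tmax ->
  De <= \sum_(i < n) G i * (p i - z i) - theta / 2 * \sum_(i < n) (p i - z i) ^+ 2 ->
  De <= QC * \sum_(i < n) (p i - z i) ^+ 2 ->
  \sum_(i < n) (1 / 2 * (p i - y i) * (2 / tau * (y i - p i) + r' i - (- 2 * k * tau * G i + r i))
     + 1 / 2 * (y i - z i) * (- 2 * k * tau * G i + r i)) + k * tau * De
   + k * tau ^+ 2 * \sum_(i < n) G i * (2 / tau * (y i - p i) + r' i) <=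
  - rateV * (\sum_(i < n) (1 / 4 * (p i - y i) ^+ 2 + 1 / 4 * (y i - z i) ^+ 2) + k * tau ^+ 2 * De)
  + \sum_(i < n) (1 / 2 * (p i - y i) * (r' i - r i) + 1 / 2 * (y i - z i) * r i
      + k * tau ^+ 2 * (G i * r' i)).
Proof.
have Tmax0 := Tmax_gt0; have QC0 := @quadC_ge0 R n L L0.
have Tm0 := Tmin0; have Tlt' := Tlt.
move=> t1 t2 h1 h2.
have t0 : 0 < tau by lra.
have tn : tau != 0 by rewrite gt_eqF.
set A := \sum_(i < n) (p i - y i) ^+ 2.
set Z := \sum_(i < n) (p i - z i) ^+ 2 in h1 h2.
set Y := \sum_(i < n) (y i - z i) ^+ 2.
set GP := \sum_(i < n) G i * (p i - z i) in h1.
set Er := \sum_(i < n) (1 / 2 * (p i - y i) * (r' i - r i) + _ + _).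
have -> : \sum_(i < n) (1 / 2 * (p i - y i) * (2 / tau * (y i - p i) + r' i - (- 2 * k * tau * G i + r i))
     + 1 / 2 * (y i - z i) * (- 2 * k * tau * G i + r i)) + k * tau * De
   + k * tau ^+ 2 * \sum_(i < n) G i * (2 / tau * (y i - p i) + r' i) =
   - tau^-1 * A - k * tau * GP + k * tau * De + Er.
  rewrite addrAC [RHS]addrAC; congr (_ + _).
  rewrite mulr_sumr -big_split /= /A /GP /Er !mulr_sumr -sumrB -big_split /=.
  by apply: eq_bigr => i _; field.
rewrite lerD2r.
have -> : \sum_(i < n) (1 / 4 * (p i - y i) ^+ 2 + 1 / 4 * (y i - z i) ^+ 2) = 1 / 4 * A + 1 / 4 * Y.
  by rewrite big_split /= -!mulr_sumr.
have YA : Y <= 2 * A + 2 * Z.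
  rewrite /Y /A /Z !mulr_sumr -big_split /=; apply: ler_sum => i _.
  have : 0 <= ((p i - y i) + (p i - z i)) ^+ 2 by exact: sqr_ge0.
  nra.
have A0 : 0 <= A by apply: sumr_ge0 => i _; exact: sqr_ge0.
have Z0 : 0 <= Z by apply: sumr_ge0 => i _; exact: sqr_ge0.
have c0 := rateV_gt0.
have cA : rateV * A <= tau^-1 * A.
  apply: ler_wpM2r => //; apply: (@le_trans _ _ Tmax^-1); first by rewrite ge_min lexx.
  by rewrite lef_pV2// posrE.
have kq : 0 <= k * Tmax ^+ 2 * QC by rewrite !mulr_ge0// ?exprn_ge0 ?ltW.
have cZ : rateV * ((1 / 2 + k * Tmax ^+ 2 * QC) * Z) <= k * Tmin * theta / 2 * Z.
  rewrite mulrA; apply: ler_wpM2r => //; rewrite -ler_pdivlMr; first by rewrite ge_min lexx orbT.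
  by rewrite ltr_pwDl.
have h3 : k * tau * De <= k * tau * (GP - theta / 2 * Z).
  by apply: ler_wpM2l => //; rewrite mulr_ge0 ?ltW.
have h4 : k * Tmin * theta / 2 * Z <= k * tau * (theta / 2 * Z).
  have -> : k * Tmin * theta / 2 * Z = k * (Tmin * (theta / 2 * Z)) by ring.
  rewrite -(mulrA k tau); apply: ler_wpM2l; first exact: ltW.
  by apply: ler_wpM2r => //; rewrite mulr_ge0// divr_ge0 ?ltW.
have h5 : k * tau ^+ 2 * De <= k * Tmax ^+ 2 * QC * Z.
  apply: (@le_trans _ _ (k * tau ^+ 2 * (QC * Z))).
    by apply: ler_wpM2l => //; rewrite mulr_ge0 ?exprn_ge0 ?ltW.
  rewrite -(mulrA _ QC Z); apply: ler_wpM2r; first by rewrite mulr_ge0.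
  apply: ler_wpM2l; first exact: ltW.
  by apply: lerXn2r => //; rewrite nnegrE ltW.
have h6 : rateV * (1 / 4 * A + 1 / 4 * Y + k * tau ^+ 2 * De) <=
   rateV * (A + (1 / 2 + k * Tmax ^+ 2 * QC) * Z).
  by apply: ler_wpM2l; [exact: ltW|rewrite mulrDl; lra].
rewrite mulrDr in h6.
rewrite mulNr; lra.
Qed.

Lemma C11_Vq (y : 'I_n -> S -> R) dy : (forall i, C11 (y i) (dy i)) ->
  exists dV, C11 (fun s => Vq s (fun i => y i s)) dV /\ forall s v,
   dV s v = \sum_(i < n) (1 / 2 * (pc s i - y i s) * (pc v i - dy i s v)
     + 1 / 2 * (y i s - zs ord0 i) * dy i s v)
     + 2 * k * tau_of s * tau_of v * (phi (x1_of s) - phi zs)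
     + k * tau_of s ^+ 2 * \sum_(i < n) g (x1_of s) ord0 i * pc v i.
Proof.
move=> ny.
have np (i : 'I_n) : C11 (fun s : S => pc s i) (fun _ v => pc v i) := C11_st R n i.
have nt : C11 (fun s : S => tau_of s) (fun _ v => tau_of v) := C11_st R n (4 * n).
have n1 i := C11_add (np i) (C11_scale (-1) (ny i)).
have n2 i := C11_add (ny i) (C11_cst (4 * n).+1 (- zs ord0 i)).
have n3 i := C11_add (C11_scale (1 / 4) (C11_mul (n1 i) (n1 i))) (C11_scale (1 / 4) (C11_mul (n2 i) (n2 i))).
have n4 := C11_add (C11_phi 0) (C11_cst (4 * n).+1 (- phi zs)).
have n5 := C11_scale k (C11_mul (C11_mul nt nt) n4).
have n6 := C11_add (C11_sum n3) n5.
eexists; split.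
  apply: C11_ext n6 => // s; rewrite /Vq addr0; congr (_ + _); last by rewrite mulrA expr2.
  by apply: eq_bigr => i _; rewrite mulN1r !expr2.
move=> s v /=; rewrite -[in RHS]addrA; congr (_ + _).
  by apply: eq_bigr => i _; rewrite mulN1r; field.
rewrite !addr0; ring.
Qed.

Lemma diffq_err a (j : 'I_n) (s : S) : 0 < a ->
  `|diffq a j s - g (x1_of s) ord0 j| <= QC * a.
Proof.
have QC0 := @quadC_ge0 R n L L0.
move=> a0; have := phi_quad grad L0 g_lip (x1_of s) (x1_of s + a *: delta_mx 0 j).
rewrite (_ : x1_of s + a *: delta_mx 0 j - x1_of s = a *: delta_mx 0 j); last by rewrite addrC addKr.
rewrite (bigD1 j)//= big1 ?addr0; last first.
  by move=> i /negbTE ij; rewrite !mxE ij andbF !mulr0.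
rewrite !mxE !eqxx mulr1 => H.
have -> : diffq a j s - g (x1_of s) ord0 j =
  a^-1 * (phi (x1_of s + a *: delta_mx 0 j) - phi (x1_of s) - g (x1_of s) ord0 j * a).
  by rewrite /diffq; field; rewrite gt_eqF.
rewrite normrM gtr0_norm ?invr_gt0// ler_pdivrMl//; apply: le_trans H _.
rewrite [leRHS]mulrCA; apply: ler_wpM2l => //; rewrite -expr2.
apply: lerXn2r; rewrite ?nnegrE ?(ltW a0)//.
apply: norm_le_coord; first exact: ltW.
move=> i; rewrite !mxE normrM (gtr0_norm a0) ler_piMr ?(ltW a0)//.
by rewrite /=; case: (i == j); rewrite ?normr0 ?normr1.
Qed.

(** Two errors of order a^2: the Taylor remainder at x1 and, n times, the replacement of a partial
    derivative by its difference quotient, an O(a) error multiplied by a. *)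
Lemma avg_err a (s : S) : 0 < a -> on_torus s ->
  `|phi (z_of a s) - phi (x1_of s) - a * \sum_(j < n) diffq a j s * cc s j| <=
  (1 + n%:R) * QC * a ^+ 2.
Proof.
have QC0 := @quadC_ge0 R n L L0.
move=> a0 ts; have := phi_quad grad L0 g_lip (x1_of s) (z_of a s).
have zE : z_of a s - x1_of s = a *: mut_of s by rewrite /z_of addrC addKr.
rewrite zE.
have zn : `|a *: mut_of s : V| <= a.
  apply: norm_le_coord; first exact: ltW.
  move=> i; rewrite !mxE normrM (gtr0_norm a0) ler_piMr ?(ltW a0)//; exact: torus_cc.
have -> : \sum_(i < n) g (x1_of s) ord0 i * (a *: mut_of s : V) ord0 i =
   a * \sum_(i < n) g (x1_of s) ord0 i * cc s i.
  by rewrite mulr_sumr; apply: eq_bigr => i _; rewrite !mxE mulrCA.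
set T := \sum_(i < n) _; set T' := \sum_(i < n) _ => H.
have TT : `|T' - T| <= n%:R * (QC * a).
  rewrite /T /T' -sumrB; apply: le_trans (ler_norm_sum _ _ _) _.
  apply: (@le_trans _ _ (\sum_(i < n) QC * a)); last by rewrite sumr_const card_ord -[leLHS]mulr_natl.
  apply: ler_sum => i _; rewrite -mulrBl normrM -[leRHS]mulr1; apply: ler_pM => //.
    exact: diffq_err.
  exact: torus_cc.
have -> : phi (z_of a s) - phi (x1_of s) - a * T' =
  (phi (z_of a s) - phi (x1_of s) - a * T) - a * (T' - T) by ring.
apply: le_trans (ler_normB _ _) _; rewrite -mulrA mulrDl mul1r; apply: lerD.
  apply: le_trans H _; apply: ler_wpM2l => //; apply: lerXn2r; rewrite ?nnegrE ?(ltW a0)//.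
rewrite normrM (gtr0_norm a0); apply: le_trans (ler_wpM2l (ltW a0) TT) _.
by rewrite le_eqVlt; apply/orP; left; apply/eqP; ring.
Qed.

Lemma phi_bound (z : V) : `|phi z| <= `|phi zs| + QC * `|z - zs| ^+ 2.
Proof.
have QC0 := @quadC_ge0 R n L L0.
have := phi_ub grad L0 g_lip zs_min z; have := zs_min z => h1 h2.
rewrite -[phi z](subrK (phi zs)) addrC; apply: le_trans (ler_normD _ _) _.
by rewrite lerD2l ger0_norm// subr_ge0.
Qed.

Lemma flow_bound a eps B : exists2 CF, 0 <= CF & forall s, C s -> `|s| <= B ->
  `|flow_map kappa k phi a eps s| <= CF.
Proof.
have Tmax0 := Tmax_gt0; have QC0 := @quadC_ge0 R n L L0.
have Tm0 := Tmin0; have Tlt' := Tlt.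
pose K1 := 2 / Tmin * (2 * `|B|).
pose K2 := `|4 / a| * k * Tmax * (`|phi zs| + QC * (`|B| + `|a| + `|zs|) ^+ 2).
pose K3 := `|eps^-1| * ((\sum_(i < n) `|om i|) * `|B|).
have K10 : 0 <= K1 by rewrite !mulr_ge0// invr_ge0 ltW.
have K20 : 0 <= K2.
  rewrite /K2 mulr_ge0// ?addr_ge0// ?mulr_ge0 ?exprn_ge0 ?addr_ge0// ltW//.
have K30 : 0 <= K3 by rewrite !mulr_ge0// sumr_ge0.
exists (K1 + K2 + K3 + 1); first by rewrite !addr_ge0.
move=> s [/andP[t1 t2] ts] sB.
have t0 : 0 < tau_of s by lra.
have stB q : `|st s q| <= `|B|.
  by apply: le_trans (st_norm _ _) _; apply: le_trans sB (ler_norm _).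
apply: norm_le_coord; first by rewrite !addr_ge0.
move=> i; rewrite mxE /=; case: ifP => i1.
  apply: (@le_trans _ _ K1); last by lra.
  rewrite normrM /K1; apply: ler_pM => //.
    rewrite ger0_norm; last by rewrite divr_ge0// ltW.
    by apply: ler_wpM2l => //; rewrite lef_pV2// posrE.
  apply: le_trans (ler_normB _ _) _.
  have := stB (n + i)%N; have := stB i; lra.
case: ifP => i2.
  apply: (@le_trans _ _ K2); last by lra.
  rewrite !normrM normrN /K2 (gtr0_norm k0) (gtr0_norm t0) -[leRHS]mulr1.
  have ni : (i - n < n)%N by apply: ltn_sub_x2 => //; rewrite leqNgt i1.
  apply: ler_pM; rewrite ?mulr_ge0 ?(ltW k0) ?(ltW t0)//; last exact: torus_cc.
  apply: ler_pM; rewrite ?mulr_ge0 ?(ltW k0) ?(ltW t0)//.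
    by apply: ler_wpM2l => //; rewrite mulr_ge0// ltW.
  apply: le_trans (phi_bound _) _; rewrite lerD2l; apply: ler_wpM2l => //.
  apply: lerXn2r; rewrite ?nnegrE// ?addr_ge0//.
  apply: le_trans (ler_normB _ _) _; rewrite lerD2r.
  apply: le_trans (ler_normD _ _) _; apply: lerD.
    by apply: le_trans (x1_of_norm s) _; apply: le_trans sB (ler_norm _).
  apply: norm_le_coord => // j; rewrite !mxE normrM ler_piMr//; exact: torus_cc.
case: ifP => i3.
  apply: (@le_trans _ _ K3); last by lra.
  rewrite normrM; apply: ler_wpM2l => //.
  have ni : ((i - 2 * n)./2 < n)%N by apply: ltn_half_mu => //; rewrite leqNgt i2.
  rewrite /Rmu -/(om _).
  have omB : `|om (i - 2 * n)./2 : R| <= \sum_(j < n) `|om j|.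
    by rewrite (bigD1 (Ordinal ni))//= lerDl sumr_ge0.
  by case: ifP => _; rewrite normrM ?normrN; apply: ler_pM.
rewrite ger0_norm; lra.
Qed.

(** The [4 * (1 + n%:R)] collects [avg_err] under the gain 4 / a, and the [2] collects [diffq_err];
    both are counted per unit of a. *)
Definition resC : R := k * Tmax * QC * (4 * (1 + n%:R) + 2).

(** Velocity of the corrected variable q + eps W against the averaged drift. The fast part of eps dW
    is known exactly and cancels the oscillation; the slow part contributes eps [C2], where [C2] may
    depend on a. *)
Lemma resid_bound a i dW : 0 < a ->
  C11 (Wf a i) dW ->
  (forall s, on_torus s -> dW s (fastF s) = 4 * k / a * tau_of s *
   (phi (x1_of s) * cc s i + a * \sum_(j < n) diffq a j s * (cc s i * cc s j)
    - a / 2 * diffq a i s)) ->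
  forall B, exists2 C2, 0 <= C2 & forall eps s, 0 < eps -> C s -> `|s| <= B ->
  `|qc (flow_map kappa k phi a eps s) i + eps * dW s (flow_map kappa k phi a eps s)
    + 2 * k * tau_of s * g (x1_of s) ord0 i| <= resC * a + eps * C2.
Proof.
have Tmax0 := Tmax_gt0; have QC0 := @quadC_ge0 R n L L0.
have Tm0 := Tmin0; have Tlt' := Tlt.
move=> a0 nW hW B.
(* At [eps = 0] this bounds the slow part of the field, so that [C2] does not depend on eps. *)
have [CF CF0 hF] := flow_bound a 0 B.
have [Cd Cd0 hd] := C11_dbound nW B.
exists (Cd * CF); first by rewrite mulr_ge0.
move=> eps s e0 Cs sB.
have [/andP[t1 t2] ts] := Cs.
have t0 : 0 < tau_of s by lra.
rewrite flow_qc// flow_map_split (C11_dlin nW) mulrDr mulrA mulfV ?gt_eqF// mul1r hW//.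
set E := phi (z_of a s) - phi (x1_of s) - a * \sum_(j < n) diffq a j s * cc s j.
have -> : \sum_(j < n) diffq a j s * (cc s i * cc s j) = cc s i * \sum_(j < n) diffq a j s * cc s j.
  by rewrite mulr_sumr; apply: eq_bigr => j _; rewrite mulrCA.
have perm (x y u v : R) : x + (y + u) + v = x + y + v + u by ring.
rewrite perm; apply: le_trans (ler_normD _ _) _; apply: lerD; last first.
  rewrite normrM (gtr0_norm e0); apply: ler_wpM2l; first exact: ltW.
  apply: le_trans (hd _ _ sB) _; apply: ler_wpM2l => //; exact: hF.
(* The terms in phi(x1), of size 1 / a, cancel here. What remains is 4 / a times an O(a^2) error,
   plus the error of a difference quotient. *)
have -> : - (4 / a) * k * tau_of s * phi (z_of a s) * cc s i + 4 * k / a * tau_of s *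
   (phi (x1_of s) * cc s i + a * (cc s i * \sum_(j < n) diffq a j s * cc s j) - a / 2 * diffq a i s) +
   2 * k * tau_of s * g (x1_of s) ord0 i =
   - (k * tau_of s) * (4 / a * (cc s i * E) + 2 * (diffq a i s - g (x1_of s) ord0 i)).
  by rewrite /E; field; rewrite gt_eqF.
rewrite normrM normrN (ger0_norm (_ : 0 <= k * tau_of s)); last by rewrite mulr_ge0// ltW.
have -> : resC * a = k * Tmax * (4 / a * ((1 + n%:R) * QC * a ^+ 2) + 2 * (QC * a)).
  by rewrite /resC; field; rewrite gt_eqF.
apply: ler_pM => //.
- by rewrite mulr_ge0// ltW.
- by apply: ler_wpM2l => //; exact: ltW.
apply: le_trans (ler_normD _ _) _; apply: lerD.
  have a4 : 0 <= 4 / a by rewrite divr_ge0// ltW.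
  rewrite normrM (ger0_norm a4); apply: ler_wpM2l => //.
  rewrite normrM -[leRHS]mul1r; apply: ler_pM => //; [exact: torus_cc|exact: avg_err].
rewrite normrM ger0_norm//; apply: ler_wpM2l => //; exact: diffq_err.
Qed.

Lemma Vq_perturb (s : S) (y : 'I_n -> R) B d : `|s| <= B -> d <= 1 ->
  (forall i, `|y i - qc s i| <= d) ->
  `|Vq s y - Vf s| <= d * (n%:R * (2 * B + 1 + `|zs|)).
Proof.
move=> sB d1 yq.
rewrite /Vf /Vq opprD addrACA subrr addr0 -sumrB; apply: le_trans (ler_norm_sum _ _ _) _.
rewrite mulrCA; apply: (@le_trans _ _ (\sum_(i < n) d * (2 * B + 1 + `|zs|))); last first.
  by rewrite sumr_const card_ord -[leLHS]mulr_natl.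
apply: ler_sum => i _.
have -> : 1 / 4 * (pc s i - y i) ^+ 2 + 1 / 4 * (y i - zs ord0 i) ^+ 2 -
  (1 / 4 * (pc s i - qc s i) ^+ 2 + 1 / 4 * (qc s i - zs ord0 i) ^+ 2) =
  (y i - qc s i) * (1 / 2 * ((y i - qc s i) + 2 * qc s i - pc s i - zs ord0 i)) by field.
rewrite normrM; apply: ler_pM => //.
have := yq i; have := st_norm s (n + i); have := st_norm s i; have := coord_le_norm zs i.
rewrite /qc /pc !ler_norml => /andP[h1 h2] /andP[h3 h4] /andP[h5 h6] /andP[h7 h8].
by apply/andP; split; lra.
Qed.

Lemma near_tau r s : nearC C r s -> Tmin - r <= tau_of s <= Tmax + r.
Proof.
move=> [y [/andP[h1 h2] _] sy].
have := st_norm (s - y) (4 * n); rewrite stB -/(tau_of s) -/(tau_of y) => /le_trans/(_ sy).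
rewrite ler_norml => /andP[h3 h4]; lra.
Qed.

Lemma near_mu r s q : nearC C r s -> (2 * n <= q)%N -> (q < 4 * n)%N -> `|st s q| <= 1 + r.
Proof.
move=> [y [_ ty] sy] h1 h2.
have := st_norm (s - y) q; rewrite stB => /le_trans/(_ sy).
have := torus_st ty h1 h2.
rewrite !ler_norml => /andP[? ?] /andP[? ?]; lra.
Qed.

Lemma gap_ge0 (x : V) : 0 <= phi x - phi zs. Proof. by rewrite subr_ge0. Qed.

Lemma Vq_sum_ge0 (s : S) (y : 'I_n -> R) :
  0 <= \sum_(i < n) (1 / 4 * (pc s i - y i) ^+ 2 + 1 / 4 * (y i - zs ord0 i) ^+ 2).
Proof. by apply: sumr_ge0 => i _; rewrite addr_ge0// mulr_ge0// sqr_ge0. Qed.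

Lemma Vq_gap (s : S) y : k * tau_of s ^+ 2 * (phi (x1_of s) - phi zs) <= Vq s y.
Proof. by rewrite /Vq lerDr Vq_sum_ge0. Qed.

Lemma Vq_coord (s : S) y i : Tmin / 2 <= tau_of s ->
  k * (Tmin / 2) ^+ 2 * (theta / 2) * (x1_of s - zs) ord0 i ^+ 2 <= Vq s y.
Proof.
have T0' := Tmin0; move=> ts; apply: le_trans (Vq_gap s y).
apply: (@le_trans _ _ (k * tau_of s ^+ 2 * (theta / 2 * \sum_(i < n) (x1_of s - zs) ord0 i ^+ 2))); last first.
  apply: ler_wpM2l; first by rewrite mulr_ge0 ?sqr_ge0// ltW.
  exact: phi_lb grad L0 g_lip g_mono zs_min (x1_of s).
rewrite -(mulrA (k * (Tmin / 2) ^+ 2)); apply: ler_pM.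
- by rewrite mulr_ge0 ?sqr_ge0// ltW.
- by rewrite mulr_ge0 ?sqr_ge0// divr_ge0// ltW.
- apply: ler_wpM2l; first exact: ltW.
  by apply: lerXn2r; rewrite ?nnegrE; lra.
apply: ler_wpM2l; first by rewrite divr_ge0// ltW.
by rewrite [leRHS](bigD1 i)//= lerDl sumr_ge0// => j _; rewrite sqr_ge0.
Qed.

(** Breaks a circularity: V controls the corrected variable, but W must be bounded before that
    variable is known to be close to x2. Strong convexity bounds x1 whatever [y] is, and nearness to
    the flow set bounds mu and tau, which is all that W sees. *)
Lemma maskq_bound M : exists2 B, 0 <= B & forall r (s : S) y, r <= 1 -> r <= Tmin / 2 ->
  nearC C r s -> Vq s y <= M -> `|maskq s| <= B.
Proof.
have T0' := Tmin0; have Tl' := Tlt.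
pose A := k * (Tmin / 2) ^+ 2 * (theta / 2).
have A0 : 0 < A by rewrite !mulr_gt0// ?exprn_gt0 ?divr_gt0.
pose Bp := `|M / A| + 1 + `|zs|.
have Bp0 : 0 <= Bp by rewrite !addr_ge0.
exists (Bp + 2 + (Tmax + 1)); first by rewrite !addr_ge0//; lra.
move=> r s y r1 rT ns VM; have T := near_tau ns.
apply: norm_le_coord; first by rewrite !addr_ge0//; lra.
move=> j; rewrite mxE; case: ifP => jn; first by rewrite normr0 !addr_ge0//; lra.
rewrite -{1}(inord_val j) -/(st s j).
have [j1|j1] := ltnP j n.
  apply: (@le_trans _ _ Bp); last by lra.
  have xz : `|(x1_of s - zs) ord0 (Ordinal j1)| <= `|M / A| + 1.
    apply: le_trans (_ : M / A + 1 <= _); last by rewrite lerD2r ler_norm.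
    apply: sqr_le_abs; rewrite ler_pdivlMr// mulrC; apply: le_trans VM.
    by apply: Vq_coord; lra.
  have := coord_le_norm zs (Ordinal j1); move: xz; rewrite /Bp !mxE /= !ler_norml.
  by move=> /andP[? ?] /andP[? ?]; lra.
have j2 : (2 * n <= j)%N by move: jn; rewrite j1 /= ltnNge => /negbFE.
have [j3|j3] := ltnP j (4 * n).
  have h := near_mu ns j2 j3; lra.
have -> : (j : nat) = (4 * n)%N by apply/eqP; rewrite eqn_leq j3 -ltnS ltn_ord.
rewrite -/(tau_of s) ger0_norm; lra.
Qed.

(** Once [y] is within 1 of x2, the term |y - zs|^2 / 4 of V bounds the remaining block. *)
Lemma s_bound M : exists2 B, 0 <= B & forall r (s : S) y, r <= 1 -> r <= Tmin / 2 ->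
  nearC C r s -> Vq s y <= M -> (forall i, `|y i - qc s i| <= 1) -> `|s| <= B.
Proof.
have k0' := k0; have [Bm Bm0 hm] := maskq_bound M.
pose By := `|4 * M| + 1 + `|zs| + 1.
have By0 : 0 <= By by rewrite !addr_ge0.
exists (Bm + By); first exact: addr_ge0.
move=> r s y r1 rT ns VM yq.
apply: norm_le_coord => [|j]; first exact: addr_ge0.
have [/andP[j1 j2]|jn] := boolP (n <= j < 2 * n)%N; last first.
  apply: (@le_trans _ _ Bm); last by rewrite lerDl.
  apply: le_trans (hm r s y r1 rT ns VM); have := coord_le_norm (maskq s) j.
  by rewrite mxE (negbTE jn).
rewrite -{1}(inord_val j) -/(st s j).
apply: (@le_trans _ _ By); last by rewrite lerDr.
have ji : (j - n < n)%N by exact: ltn_sub_x2.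
have := yq (Ordinal ji); rewrite /qc /= (_ : n + (j - n) = j)%N; last by rewrite subnKC.
have : `|y (Ordinal ji) - zs ord0 (Ordinal ji)| <= 4 * M + 1.
  apply: sqr_le_abs.
  have h1 : 0 <= k * tau_of s ^+ 2 * (phi (x1_of s) - phi zs).
    by apply: mulr_ge0; [rewrite mulr_ge0 ?sqr_ge0 ?(ltW k0)|exact: gap_ge0].
  have : 1 / 4 * (y (Ordinal ji) - zs ord0 (Ordinal ji)) ^+ 2 <= Vq s y.
    apply: (@le_trans _ _ (\sum_(i < n) (1 / 4 * (pc s i - y i) ^+ 2 + 1 / 4 * (y i - zs ord0 i) ^+ 2))).
      rewrite [leRHS](bigD1 (Ordinal ji))//= addrAC lerDr; apply: addr_ge0; first by rewrite mulr_ge0// sqr_ge0.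
      by apply: sumr_ge0 => i _; rewrite addr_ge0// mulr_ge0// sqr_ge0.
    by rewrite /Vq lerDl.
  lra.
have := coord_le_norm zs (Ordinal ji); have := ler_norm (4 * M); rewrite /By.
rewrite !ler_norml => ? /andP[? ?] /andP[? ?] /andP[? ?]; lra.
Qed.

Lemma W_bound M a : exists2 Cw, 0 <= Cw & forall r (s : S) y i, r <= 1 -> r <= Tmin / 2 ->
  nearC C r s -> Vq s y <= M -> `|Wf a i s| <= Cw.
Proof.
have [B B0 hB] := maskq_bound M.
have /choice[Cw hCw] : forall i, exists Cw : R, 0 <= Cw /\
    forall s : S, `|s| <= B -> `|Wf a i s| <= Cw.
  move=> i; have [dW [nW _]] := C11_Wf a i.
  by have [K K0 hK] := C11_bound nW B; exists K.
exists (\sum_(i < n) Cw i); first by apply: sumr_ge0 => i _; have [] := hCw i.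
move=> r s y i r1 rT ns VM.
apply: (@le_trans _ _ (Cw i)); last first.
  by rewrite (bigD1 i)//= lerDl sumr_ge0// => j _; have [] := hCw j.
by rewrite -Wf_maskq; have [_] := hCw i; apply; exact: hB ns VM.
Qed.

Lemma jump_norm (s : S) B : Tmin <= B -> `|s| <= B -> `|jump_map Tmin s| <= B.
Proof.
have T0' := Tmin0.
move=> TB sB; apply: norm_le_coord; first by lra.
have h q : `|st s q| <= B by apply: le_trans (st_norm _ _) _.
move=> i; rewrite mxE /=; do 3 (case: ifP => // _).
by rewrite gtr0_norm.
Qed.

Lemma jump_C (s : S) : D s -> C (jump_map Tmin s).
Proof.
move=> [_ ts]; split; first by rewrite jump_tau lexx ltW.
exact: jump_torus.
Qed.

Lemma D_sub_C : D `<=` C.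
Proof. by move=> s [h ts]; split => //; rewrite h lexx ltW. Qed.

(** After a jump p = q, so V reduces to |p - zs|^2 / 4 + k Tmin^2 (phi p - phi zs), and the first
    term is at most (phi p - phi zs) / (2 theta). Before it, tau = Tmax and V is at least k Tmax^2
    (phi p - phi zs) whatever [y] is; the quotient is [gam]. *)
Lemma Vf_jump (s : S) y : D s -> Vf (jump_map Tmin s) <= gam * Vq s y.
Proof.
have k0' := k0; have th0' := theta0; have T0' := Tmin0; have Tm0' : 0 < Tmax by exact: lt_trans Tlt.
move=> [ts _]; apply: (@le_trans _ _ (gam * (k * tau_of s ^+ 2 * (phi (x1_of s) - phi zs)))); last first.
  by apply: ler_wpM2l; [exact: gam_ge0|exact: Vq_gap].
rewrite /Vf /Vq jump_tau jump_x1 ts /gam.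
have -> : (k * Tmax ^+ 2)^-1 * ((2 * theta)^-1 + k * Tmin ^+ 2) * (k * Tmax ^+ 2 * (phi (x1_of s) - phi zs)) =
  (2 * theta)^-1 * (phi (x1_of s) - phi zs) + k * Tmin ^+ 2 * (phi (x1_of s) - phi zs).
  by field; rewrite !gt_eqF.
rewrite lerD2r.
have -> : \sum_(i < n) (1 / 4 * (pc (jump_map Tmin s) i - qc (jump_map Tmin s) i) ^+ 2 +
     1 / 4 * (qc (jump_map Tmin s) i - zs ord0 i) ^+ 2) =
   1 / 4 * \sum_(i < n) (x1_of s - zs) ord0 i ^+ 2.
  rewrite mulr_sumr; apply: eq_bigr => i _; rewrite jump_pc// jump_qc// subrr expr0n mulr0 add0r.
  by rewrite !mxE.
have := phi_lb grad L0 g_lip g_mono zs_min (x1_of s).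
set Q := \sum_(i < n) _; set De := phi _ - _ => h.
have -> : 1 / 4 * Q = (2 * theta)^-1 * (theta / 2 * Q) by field; rewrite gt_eqF.
by apply: ler_wpM2l => //; rewrite invr_ge0 mulr_ge0// ltW.
Qed.

(** Controls the error sum of [Vq_decr]. The constant [K] sees only the ball of radius [B], so it is
    fixed before the residual size [d] is made small through a and eps. *)
Lemma err_bound B : 0 <= B -> exists2 K, 0 <= K & forall (s : S) (y r r' : 'I_n -> R) d,
  0 <= d -> C s -> `|s| <= B -> (forall i, `|y i - qc s i| <= 1) ->
  (forall i, `|r i| <= d) -> (forall i, `|r' i| <= d) ->
  \sum_(i < n) (1 / 2 * (pc s i - y i) * (r' i - r i) + 1 / 2 * (y i - zs ord0 i) * r i
     + k * tau_of s ^+ 2 * (g (x1_of s) ord0 i * r' i)) <= K * d.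
Proof.
have k0' := k0; have T0' := Tmin0; have Tl' := Tlt; have L0' := L0; move=> B0.
have GB0 : 0 <= n%:R * L * (B + `|zs|) by rewrite !mulr_ge0// ?addr_ge0// ltW.
have kT0 : 0 <= k * Tmax ^+ 2 by rewrite mulr_ge0 ?sqr_ge0// ltW.
exists (n%:R * ((2 * B + 1) + (B + 1 + `|zs|) + k * Tmax ^+ 2 * (n%:R * L * (B + `|zs|)))).
  by rewrite mulr_ge0// !addr_ge0// mulr_ge0.
move=> s y r r' d d0 [/andP[t1 t2] _] sB yq rd rd'.
rewrite -mulrA.
apply: (@le_trans _ _ (\sum_(i < n) ((2 * B + 1 + (B + 1 + `|zs|) + k * Tmax ^+ 2 * (n%:R * L * (B + `|zs|))) * d))); last first.
  by rewrite sumr_const card_ord -[leLHS]mulr_natl.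
apply: ler_sum => i _.
have hp : `|pc s i| <= B by apply: le_trans (st_norm _ _) sB.
have hq : `|qc s i| <= B by apply: le_trans (st_norm _ _) sB.
have hz := coord_le_norm zs i.
have py : `|pc s i - y i| <= 2 * B + 1.
  have -> : pc s i - y i = (pc s i - qc s i) - (y i - qc s i) by ring.
  apply: le_trans (ler_normB _ _) _; have := yq i; have := ler_normB (pc s i) (qc s i); lra.
have yz : `|y i - zs ord0 i| <= B + 1 + `|zs|.
  have -> : y i - zs ord0 i = (y i - qc s i) + qc s i - zs ord0 i by ring.
  apply: le_trans (ler_normB _ _) _; have := yq i; have := ler_normD (y i - qc s i) (qc s i); lra.
have hg : `|g (x1_of s) ord0 i| <= n%:R * L * (B + `|zs|).
  apply: le_trans (grad_ub grad L0 g_lip zs_min _ _) _.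
  apply: ler_wpM2l; first by rewrite mulr_ge0// ltW.
  apply: le_trans (ler_normB _ _) _; rewrite lerD2r; exact: le_trans (x1_of_norm s) sB.
have kt : k * tau_of s ^+ 2 <= k * Tmax ^+ 2.
  apply: ler_wpM2l; first exact: ltW.
  by apply: lerXn2r => //; rewrite nnegrE; lra.
have h1 : (pc s i - y i) * (r' i - r i) <= (2 * B + 1) * (d + d).
  apply: le_trans (ler_norm _) _; rewrite normrM; apply: ler_pM => //.
  by apply: le_trans (ler_normB _ _) _; apply: lerD.
have h2 : (y i - zs ord0 i) * r i <= (B + 1 + `|zs|) * d.
  by apply: le_trans (ler_norm _) _; rewrite normrM; apply: ler_pM.
have h3 : k * tau_of s ^+ 2 * (g (x1_of s) ord0 i * r' i) <= k * Tmax ^+ 2 * (n%:R * L * (B + `|zs|) * d).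
  apply: le_trans (ler_norm _) _; rewrite normrM (ger0_norm (_ : 0 <= k * tau_of s ^+ 2)).
    apply: ler_pM => //; first by rewrite mulr_ge0 ?sqr_ge0// ltW.
    by rewrite normrM; apply: ler_pM.
  by rewrite mulr_ge0 ?sqr_ge0// ltW.
have h4 : 0 <= (B + 1 + `|zs|) * d by rewrite mulr_ge0// !addr_ge0.
rewrite !mulrDl -!mulrA; rewrite -!mulrA in h3; rewrite !mulrDl in h1 h2 h4.
move: h1 h2 h3 h4; rewrite !mulrDl.
lra.
Qed.

(** [Vq_decr] at y = q + eps W, with [d] bounding all residuals and [K] chosen before a and eps. *)
Lemma Vt_decr B : 0 <= B -> exists2 K, 0 <= K &
  forall (a eps d : R) (dW : 'I_n -> S -> S -> R) (dV : S -> S -> R),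
  (forall s v, dV s v =
     \sum_(i < n) (1 / 2 * (pc s i - (qc s i + eps * Wf a i s)) * (pc v i - (qc v i + eps * dW i s v))
     + 1 / 2 * (qc s i + eps * Wf a i s - zs ord0 i) * (qc v i + eps * dW i s v))
     + 2 * k * tau_of s * tau_of v * (phi (x1_of s) - phi zs)
     + k * tau_of s ^+ 2 * \sum_(i < n) g (x1_of s) ord0 i * pc v i) ->
  forall s, C s -> `|s| <= B -> 0 <= d ->
  (forall i, `|eps * Wf a i s| <= 1) -> (forall i, 2 / Tmin * `|eps * Wf a i s| <= d) ->
  (forall i : 'I_n, `|qc (flow_map kappa k phi a eps s) i + eps * dW i s (flow_map kappa k phi a eps s)
    + 2 * k * tau_of s * g (x1_of s) ord0 i| <= d) ->
  dV s (flow_map kappa k phi a eps s) <= - rateV * Vq s (fun i => qc s i + eps * Wf a i s) + K * d.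
Proof.
have k0' := k0; have T0' := Tmin0; have Tl' := Tlt; have L0' := L0; move=> B0.
have [K K0 hK] := err_bound B0.
exists K => // a eps d dW dV dVE s Cs sB d0 W1 Wd res.
have [/andP[t1 t2] ts] := Cs.
have t0 : 0 < tau_of s by lra.
set v := flow_map kappa k phi a eps s.
pose y (i : 'I_n) := qc s i + eps * Wf a i s.
pose G (i : 'I_n) := g (x1_of s) ord0 i.
pose r (i : 'I_n) := qc v i + eps * dW i s v + 2 * k * tau_of s * G i.
(* The velocity of p contains q and not y; the difference is - eps W, weighted by 2 / tau. *)
pose r' (i : 'I_n) := - (2 / tau_of s * (eps * Wf a i s)).
have pv (i : 'I_n) : pc v i = 2 / tau_of s * (y i - pc s i) + r' i.
  by rewrite /v flow_pc// /y /r'; ring.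
have qv (i : 'I_n) : qc v i + eps * dW i s v = - 2 * k * tau_of s * G i + r i.
  by rewrite /r; ring.
have r'd i : `|r' i| <= d.
  apply: le_trans (Wd i); rewrite /r' normrN normrM; apply: ler_wpM2r => //.
  rewrite ger0_norm; last by rewrite divr_ge0// ltW.
  by apply: ler_wpM2l => //; rewrite lef_pV2// posrE.
have gap := phi_gap zs grad L0 g_lip g_mono (x1_of s).
have ub := phi_ub grad L0 g_lip zs_min (x1_of s).
have xzE (i : 'I_n) : (x1_of s - zs) ord0 i = pc s i - zs ord0 i by rewrite !mxE.
have De1 : phi (x1_of s) - phi zs <= \sum_(i < n) G i * (pc s i - zs ord0 i) -
    theta / 2 * \sum_(i < n) (pc s i - zs ord0 i) ^+ 2.
  apply: le_trans gap _; rewrite le_eqVlt; apply/orP; left; apply/eqP.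
  by congr (_ - _ * _); apply: eq_bigr => i _; rewrite xzE.
have De2 : phi (x1_of s) - phi zs <= QC * \sum_(i < n) (pc s i - zs ord0 i) ^+ 2.
  apply: le_trans ub _; apply: ler_wpM2l; first exact: quadC_ge0.
  have := norm_le_enorm (x1_of s - zs) => h.
  apply: (@le_trans _ _ (enorm (x1_of s - zs) ^+ 2)).
    by apply: lerXn2r => //; rewrite ?nnegrE ?enorm_ge0 ?normr_ge0.
  by rewrite enorm_sqr le_eqVlt; apply/orP; left; apply/eqP; apply: eq_bigr => i _; rewrite xzE.
have := Vq_decr y r r' t1 t2 De1 De2.
have Er := hK s y r r' d d0 Cs sB _ res r'd.
rewrite dVE -/v.
have -> : \sum_(i < n) (1 / 2 * (pc s i - (qc s i + eps * Wf a i s)) * (pc v i - (qc v i + eps * dW i s v))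
     + 1 / 2 * (qc s i + eps * Wf a i s - zs ord0 i) * (qc v i + eps * dW i s v)) =
  \sum_(i < n) (1 / 2 * (pc s i - y i) * (2 / tau_of s * (y i - pc s i) + r' i - (- 2 * k * tau_of s * G i + r i))
     + 1 / 2 * (y i - zs ord0 i) * (- 2 * k * tau_of s * G i + r i)).
  by apply: eq_bigr => i _; rewrite qv pv.
have -> : \sum_(i < n) g (x1_of s) ord0 i * pc v i =
  \sum_(i < n) G i * (2 / tau_of s * (y i - pc s i) + r' i).
  by apply: eq_bigr => i _; rewrite pv.
have -> : 2 * k * tau_of s * tau_of v * (phi (x1_of s) - phi zs) = k * tau_of s * (phi (x1_of s) - phi zs).
  by rewrite /v flow_tau; field.
move=> h; apply: le_trans h _; rewrite /Vq lerD2l.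
by apply: Er => i; rewrite /y addrC addKr.
Qed.

End Lyapunov.

(** * Practical decay of V for the perturbed system *)

Section CoreEstimate.
Context {R : realType} {n : nat}.
Local Notation V := 'rV[R]_n.
Local Notation S := 'rV[R]_(4 * n).+1.

(** The two decay factors serve different ends: exp(- c t) gives exponential stability, gm^j the
    suboptimality estimate. [B] is quantified before a, so that thresholds on a chosen later may
    depend on it. *)
Lemma core_estimate (phi : V -> R) (g : V -> V) (theta L : R) (zs : V)
    (kappa : nat -> rat) (k Tmin Tmax : R) (M0 nu r0 : R) :
  let C := @flow_set R n Tmin Tmax in
  let V_f := Vf phi zs k in
  let c := @rateV R n theta L k Tmin Tmax in
  let gm := gam theta k Tmin Tmax in
  is_gradient phi g -> 0 < theta -> 0 < L ->
  (forall x y, enorm (g x - g y) <= L * enorm (x - y)) ->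
  (forall x y, dotv (g x - g y) (x - y) >= theta * enorm (x - y) ^+ 2) ->
  (forall z, phi zs <= phi z) ->
  (forall i, (i < n)%N -> 0 < kappa i) ->
  (forall i j, (i < n)%N -> (j < n)%N -> kappa i = kappa j -> i = j) ->
  0 < k -> 0 < Tmin -> Tmin < Tmax ->
  gm <= 1 -> 0 < M0 -> 0 < nu -> 0 < r0 ->
  exists B, exists2 as_, 0 < as_ & forall a, 0 < a < as_ ->
  exists2 es, 0 < es & forall eps, 0 < eps < es ->
  exists2 eb, 0 < eb & forall ebar, ebar <= eb ->
  forall e : R -> S, (forall t, 0 <= t -> `|e t| <= ebar) ->
  forall E x, is_solution (perturb (H_ae kappa k Tmin Tmax phi a eps) e) E x ->
  V_f (x 0 0%N) < M0 -> forall t j, E (t, j) ->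
  [/\ nearC C r0 (x t j), `|x t j| <= B &
      V_f (x t j) <= gm ^+ j * expR (- (c * t)) * V_f (x 0 0%N) + nu].
Proof.
move=> C V_f c gm grad theta0 L0 g_lip g_mono zs_min kappa0 kappa_inj k0 Tmin0 Tlt gm1 M00 nu0 r00.
pose D := @jump_set R n Tmax; pose V_q := Vq phi zs k; pose W := Wf phi kappa k.
have Tm0' : 0 < Tmax by exact: lt_trans Tlt.
have hK0 B (B0 : 0 <= B) := @Vt_decr R n phi g theta L zs grad theta0 L0 g_lip g_mono zs_min kappa k Tmin Tmax k0 Tmin0 Tlt B B0.
rewrite -/c -/V_q -/W -/C in hK0.
have hjump s y := @Vf_jump R n phi g theta L zs grad theta0 L0 g_lip g_mono zs_min k Tmin Tmax k0 Tmin0 Tlt s y.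
rewrite -/gm -/V_f -/V_q -/D in hjump.
have c0 : 0 < c := rateV_gt0 theta0 L0 k0 Tmin0 Tlt.
have gm0 : 0 <= gm by exact: gam_ge0.
clearbody c gm.
(* The bound Tmin / 2 keeps tau positive near the flow set, and 1 / c keeps the subtracted function
   of tau non-negative for tau up to Tmax + r1. *)
pose r1 := Num.min (Num.min r0 1) (Num.min (Tmin / 2) c^-1).
have r10 : 0 < r1 by rewrite !lt_min r00 ltr01 divr_gt0//= invr_gt0.
have r1r0 : r1 <= r0 by rewrite /r1 !ge_min lexx.
have r11 : r1 <= 1 by rewrite /r1 !ge_min lexx orbT.
have r1T : r1 <= Tmin / 2 by rewrite /r1 !ge_min lexx !orbT.
have r1c : r1 <= c^-1 by rewrite /r1 !ge_min lexx !orbT.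
(* Solutions are trapped in U < M0 + 1, where the corrected V is below M0 + 1 + nu / 4. *)
pose M := M0 + 1 + nu.
have [B' B'0 hB'] := s_bound grad theta0 L0 g_lip g_mono zs_min k0 Tmin0 Tlt M.
pose B := B' + Tmin.
have B0 : 0 <= B by rewrite addr_ge0// ltW.
have hB r (s : S) y : r <= 1 -> r <= Tmin / 2 -> nearC C r s -> V_q s y <= M ->
    (forall i, `|y i - qc s i| <= 1) -> `|s| <= B.
  by move=> h1 h2 h3 h4 h5; apply: le_trans (hB' r s y h1 h2 h3 h4 h5) _; rewrite lerDl ltW.
have TB : Tmin <= B + 1 by rewrite /B; lra.
have B10 : 0 <= B + 1 by rewrite addr_ge0.
have [K K0 hK] := hK0 _ B10.
(* The subtracted term b = b0 (1 + c (Tmax - tau)) satisfies b' >= - c b / 2 along flows and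
   increases at jumps, which leaves a margin [rho] for all the perturbations. *)
pose b0 := nu / 4 / (1 + c * Tmax).
have cT : 0 < c * Tmax by rewrite mulr_gt0.
have b00 : 0 < b0 by rewrite divr_gt0 ?divr_gt0//; lra.
have b0E : b0 * (1 + c * Tmax) = nu / 4 by rewrite /b0 divfK// gt_eqF//; lra.
have cb0 : 0 < c * b0 by rewrite mulr_gt0.
(* Along flows the subtracted term yields at least c b0 through - c U and costs c b0 / 2 through
   tau' = 1/2. Of the remaining c b0 / 2, one half pays the residuals [K * dd] and the other half is
   kept for [rho]. *)
pose tgt := c * b0 / 4.
have tgt0 : 0 < tgt by rewrite divr_gt0.
pose dd := tgt / (K + 1).
have dd0 : 0 < dd by rewrite divr_gt0// ltr_wpDl.
have Kdd : K * dd <= tgt.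
  rewrite /dd mulrCA ler_piMr// ?(ltW tgt0)// ler_pdivrMr ?ltr_wpDl// mul1r lerDl//.
exists B.
have rc0 : 0 <= @resC R n L k Tmax.
  rewrite /resC; apply: mulr_ge0; last by rewrite addr_ge0// mulr_ge0// addr_ge0.
  apply: mulr_ge0; last exact: quadC_ge0.
  by rewrite mulr_ge0// ltW.
have lerDl1 (z : R) : z <= z + 1 by rewrite lerDl.
have [as_ as0 has] := small_mul rc0 (ltac:(lra) : 0 < dd / 2).
exists as_ => // a aas; have a0 : 0 < a by case/andP: aas.
have aC : @resC R n L k Tmax * a <= dd / 2 by rewrite mulrC has.
have /choice[dW hdW] := C11_Wf grad L0 g_lip zs_min k kappa0 kappa_inj a.
have /choice[C2 hC2] : forall i : 'I_n, exists C2 : R, 0 <= C2 /\ forall eps s, 0 < eps -> C s -> `|s| <= B + 1 ->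
  `|qc (flow_map kappa k phi a eps s) i + eps * dW i s (flow_map kappa k phi a eps s)
    + 2 * k * tau_of s * g (x1_of s) ord0 i| <= @resC R n L k Tmax * a + eps * C2.
  move=> i; have [nW hW] := hdW i.
  by have [C2 C20 h] := resid_bound grad L0 g_lip zs_min k0 Tmin0 Tlt a0 nW hW (B + 1); exists C2.
(* [Cw1] bounds W on a sublevel set, before the state is known to lie in the ball; [Cw2] bounds it
   on the ball. [Cw] dominates both. *)
have [Cw1 Cw10 hCw1] := W_bound grad theta0 L0 g_lip g_mono zs_min kappa0 kappa_inj k0 Tmin0 Tlt M a.
have /choice[Cw2 hCw2] : forall i : 'I_n, exists Cw : R, 0 <= Cw /\ forall s : S, `|s| <= B + 1 -> `|W a i s| <= Cw.
  by move=> i; have [Cw ? ?] := C11_bound (hdW i).1 (B + 1); exists Cw.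
pose C2s := \sum_(i < n) C2 i.
pose Cw := Cw1 + \sum_(i < n) Cw2 i.
pose K6 := n%:R * (2 * (B + 1) + 1 + `|zs|).
have C2s0 : 0 <= C2s by apply: sumr_ge0 => i _; have [] := hC2 i.
have C2le i : C2 i <= C2s.
  by rewrite /C2s (bigD1 i)//= lerDl sumr_ge0// => j _; have [] := hC2 j.
have Sw0 : 0 <= \sum_(i < n) Cw2 i by apply: sumr_ge0 => i _; have [] := hCw2 i.
have Cw0 : 0 <= Cw by rewrite /Cw addr_ge0.
have Cw2le i : Cw2 i <= Cw.
  apply: (@le_trans _ _ (\sum_(i < n) Cw2 i)); last by rewrite lerDr.
  by rewrite (bigD1 i)//= lerDl sumr_ge0// => j _; have [] := hCw2 j.
have K60 : 0 <= K6 by rewrite mulr_ge0// !addr_ge0// mulr_ge0.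
have T20 : 0 <= 2 / Tmin by rewrite divr_ge0// ltW.
(* The subtracted term grows by twice [gap] at a jump: one half covers the passage from V to its
   corrected version after the jump, the other covers [rho]. *)
pose gap := b0 * c * (Tmax - Tmin) / 2.
have gap0 : 0 < gap.
  by rewrite divr_gt0 ?ltr0n// mulr_gt0 ?subr_gt0// mulr_gt0.
pose tt := Num.min (Num.min (dd / 2) 1) (Num.min (nu / 4) gap).
have tt0 : 0 < tt.
  by rewrite /tt !lt_min; apply/andP; split; apply/andP; split => //; move: dd0 nu0; clear; lra.
have tt1 : tt <= dd / 2 by rewrite /tt !ge_min lexx.
have tt2 : tt <= 1 by rewrite /tt !ge_min lexx !orbT.
have tt3 : tt <= nu / 4 by rewrite /tt !ge_min lexx !orbT.
have tt4 : tt <= gap by rewrite /tt !ge_min lexx !orbT.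
have CC0 : 0 <= C2s + Cw * (1 + 2 / Tmin + K6).
  by rewrite addr_ge0// mulr_ge0// !addr_ge0.
have [es es0 hes] := small_mul CC0 tt0.
exists es => // eps eeps; have eps0 : 0 < eps by case/andP: eeps.
have epsC : eps * C2s + (eps * Cw + 2 / Tmin * (eps * Cw) + eps * Cw * K6) <= tt.
  have -> : eps * C2s + (eps * Cw + 2 / Tmin * (eps * Cw) + eps * Cw * K6) =
    eps * (C2s + Cw * (1 + 2 / Tmin + K6)) by ring.
  exact: hes.
have eC20 : 0 <= eps * C2s by rewrite mulr_ge0// ltW.
have eCw0 : 0 <= eps * Cw by rewrite mulr_ge0// ltW.
have eCwT : 0 <= 2 / Tmin * (eps * Cw) by rewrite mulr_ge0.
have eCwK : 0 <= eps * Cw * K6 by rewrite mulr_ge0.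
have eps1 : eps * C2s <= dd / 2 by move: epsC eC20 eCw0 eCwT eCwK tt1 tt2 dd0; clear; lra.
have eps2 : eps * Cw <= 1 by move: epsC eC20 eCw0 eCwT eCwK tt1 tt2 dd0; clear; lra.
have eps3 : 2 / Tmin * (eps * Cw) <= dd by move: epsC eC20 eCw0 eCwT eCwK tt1 tt2 dd0; clear; lra.
have eps4 : eps * Cw * K6 <= tt by move: epsC eC20 eCw0 eCwT eCwK tt1 tt2 dd0; clear; lra.
have epsW s i : `|s| <= B + 1 -> `|eps * W a i s| <= eps * Cw.
  move=> sB; rewrite normrM (gtr0_norm eps0); apply: ler_wpM2l; first exact: ltW.
  by apply: le_trans (Cw2le i); have [_] := hCw2 i; apply.
pose y (i : 'I_n) (s : S) := qc s i + eps * W a i s.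
have ny (i : 'I_n) : C11 (y i) (fun s v => qc v i + eps * dW i s v).
  exact: C11_add (C11_st R n (n + i)) (C11_scale eps (hdW i).1).
have [dV [nV dVE]] := C11_Vq grad L0 g_lip zs_min k ny.
pose Vt s := V_q s (fun i => y i s).
have VtV s : `|s| <= B + 1 -> `|Vt s - V_f s| <= tt.
  move=> sB; apply: le_trans eps4; apply: Vq_perturb => // i.
  by rewrite /y addrC addKr; exact: epsW.
pose U s := Vt s + (- (b0 * (1 + c * Tmax)) + b0 * c * tau_of s).
have nU : C11 U (fun s v => dV s v + (0 + b0 * c * tau_of v)).
  apply: C11_add => //; apply: C11_add; first exact: C11_cst.
  exact: C11_scale (C11_st R n (4 * n)).
have UE s : U s = Vt s - b0 * (1 + c * (Tmax - tau_of s)) by rewrite /U; ring.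
have bge0 s : nearC C r1 s -> 0 <= b0 * (1 + c * (Tmax - tau_of s)).
  move=> ns; apply: mulr_ge0; first exact: ltW.
  have T := near_tau ns.
  have : c * (Tmax - tau_of s) >= c * (- c^-1).
    by apply: ler_wpM2l; [exact: ltW|move: T r1c; clear; lra].
  by rewrite mulrN mulfV ?gt_eqF//; clear; lra.
have ble s : nearC C r1 s -> b0 * (1 + c * (Tmax - tau_of s)) <= nu / 4.
  move=> ns; have T := near_tau ns; rewrite -b0E; apply: ler_wpM2l; first exact: ltW.
  by rewrite lerD2l; apply: ler_wpM2l; [exact: ltW|move: T r1T Tmin0; clear; lra].
have sublevel s : nearC C r1 s -> U s < M0 + 1 -> `|s| <= B.
  move=> ns; rewrite UE => Us; have := ble s ns => bs.
  have VM : Vt s <= M by rewrite /M; move: Us bs nu0; clear; lra.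
  apply: (hB r1 s (fun i => y i s) r11 r1T ns VM) => i.
  rewrite /y addrC addKr normrM (gtr0_norm eps0); apply: le_trans eps2.
  apply: ler_wpM2l; first exact: ltW.
  apply: le_trans (hCw1 r1 s (fun i => y i s) i r11 r1T ns VM) _.
  by rewrite /Cw lerDl.
pose rho := Num.min tgt gap.
have rho0 : 0 < rho by rewrite lt_min tgt0.
have rho1 : rho <= tgt by rewrite /rho ge_min lexx.
have rho2 : rho <= gap by rewrite /rho ge_min lexx orbT.
have [CF CF0 hF] := flow_bound grad L0 g_lip zs_min kappa k0 Tmin0 Tlt a eps (B + 1).
have flow s : C s -> `|s| <= B + 1 ->
    dV s (flow_map kappa k phi a eps s) + (0 + b0 * c * tau_of (flow_map kappa k phi a eps s)) <= - c * U s - rho.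
  move=> Cs sB; rewrite flow_tau add0r.
  have := hK a eps dd dW dV dVE s Cs sB (ltW dd0).
  have [/andP[t1 t2] _] := Cs.
  move=> h; have {}h : dV s (flow_map kappa k phi a eps s) <= - c * Vt s + K * dd.
    apply: h => i.
    - exact: le_trans (epsW s i sB) eps2.
    - by apply: le_trans eps3; apply: ler_wpM2l => //; exact: epsW.
    - have [_ h2] := hC2 i; apply: le_trans (h2 eps s eps0 Cs sB) _.
      have : eps * C2 i <= eps * C2s by apply: ler_wpM2l => //; exact: ltW.
      by move: eps1 aC; clear; lra.
  have h2 : 0 <= c * b0 * (c * (Tmax - tau_of s)).
    by rewrite mulr_ge0 ?(ltW cb0)// mulr_ge0 ?(ltW c0)// subr_ge0.
  have -> : - c * U s - rho = - c * Vt s + c * b0 + c * b0 * (c * (Tmax - tau_of s)) - rho by rewrite UE; ring.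
  have -> : b0 * c * (1 / 2) = c * b0 / 2 by field.
  by move: h h2 rho1 Kdd cb0; rewrite /tgt; clear; lra.
have jump s : D s -> `|s| <= B + 1 ->
    `|jump_map Tmin s| <= B + 1 /\ U (jump_map Tmin s) <= gm * U s - rho.
  move=> Ds sB; have jB : `|jump_map Tmin s| <= B + 1 by exact: jump_norm.
  split => //.
  have ts : tau_of s = Tmax by case: Ds.
  have h1 := hjump s (fun i => y i s) Ds.
  have := VtV _ jB; rewrite ler_norml => /andP[_ h2].
  rewrite !UE jump_tau ts subrr mulr0 addr0 mulr1 (mulrBr gm).
  have h3 : gm * b0 <= b0 by rewrite ler_piMl// ltW.
  have -> : b0 * (1 + c * (Tmax - Tmin)) = b0 + 2 * gap by rewrite /gap; field.
  by move: h1 h2 h3 tt4 rho2; rewrite -/(Vt s); clear; lra.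
have [eb eb0 heb] := robust_lyapunov nU (ltW c0) gm0 gm1 (addr_gt0 M00 ltr01) rho0 r10 (@D_sub_C _ _ _ _ Tlt) (@jump_C _ _ _ _ Tlt) CF0
   sublevel hF flow jump.
exists (Num.min eb (r1 / 2)); first by rewrite lt_min eb0 divr_gt0.
move=> ebar; rewrite le_min => /andP[ebb ebr] e he E x xs V0 t j Etj.
have n0 : nearC C r1 (x 0 0%N).
  have := solution_init_near (D_sub_C Tlt) (divr_gt0 r10 (ltr0Sn _ 1)) (le_trans (he 0 (lexx _)) ebr) xs.
  by rewrite (_ : 2 * (r1 / 2) = r1)//; field.
have x0B : `|x 0 0%N| <= B.
  apply: (hB r1 _ (fun i => qc (x 0 0%N) i) r11 r1T n0).
    by apply: le_trans (ltW V0) _; rewrite /M; move: nu0; clear; lra.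
  by move=> i; rewrite subrr normr0.
have := VtV (x 0 0%N) (le_trans x0B (lerDl1 _)); rewrite ler_norml => /andP[_ h0].
have U0 : U (x 0 0%N) <= V_f (x 0 0%N) + tt by rewrite UE; move: h0 (bge0 _ n0); clear; lra.
have UM : U (x 0 0%N) < M0 + 1 by move: U0 V0 tt2; clear; lra.
have [nx Ux] := heb ebar ebb e he E x xs UM t j Etj.
have t0 : 0 <= t by case: xs => [[h _] _]; exact: (h (t, j)).
have th0 : 0 <= gm ^+ j * expR (- (c * t)) by rewrite mulr_ge0 ?exprn_ge0 ?expR_ge0.
have th1 : gm ^+ j * expR (- (c * t)) <= 1.
  rewrite -[leRHS]mulr1; apply: ler_pM; rewrite ?exprn_ge0 ?expR_ge0 ?exprn_ile1//.
  by rewrite -expR0 ler_expR oppr_le0 mulr_ge0// ltW.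
set th := gm ^+ j * _ in th0 th1 Ux *.
have Ux' : U (x t j) <= th * V_f (x 0 0%N) + tt.
  apply: le_trans Ux _; apply: (@le_trans _ _ (th * (V_f (x 0 0%N) + tt))); first exact: ler_wpM2l.
  by rewrite mulrDr lerD2l ler_piMl// ltW.
have V00 : 0 <= V_f (x 0 0%N).
  apply: le_trans (Vq_gap phi zs k _ _); apply: mulr_ge0; first by rewrite mulr_ge0 ?sqr_ge0// ltW.
  by rewrite subr_ge0.
have xB : `|x t j| <= B.
  apply: sublevel => //; apply: le_lt_trans Ux' _.
  have : th * V_f (x 0 0%N) <= V_f (x 0 0%N) by rewrite ler_piMl.
  by move: V0 tt2; clear; lra.
split => //.
  by have [z Cz xz] := nx; exists z => //; exact: le_trans r1r0.
have := VtV (x t j) (le_trans xB (lerDl1 _)); rewrite ler_norml => /andP[h1 _].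
by rewrite UE in Ux'; move: h1 Ux' (ble _ nx) tt3 nu0; clear; lra.
Qed.

End CoreEstimate.

(** * Distance estimates and stability *)

Lemma norm_sqr_le (R : realType) (n : nat) (v : 'rV[R]_n) (X : R) :
  0 <= X -> (forall i, v ord0 i ^+ 2 <= X) -> `|v| ^+ 2 <= X.
Proof.
move=> X0 h; rewrite -[leRHS]sqr_sqrtr//; apply: lerXn2r; rewrite ?nnegrE ?sqrtr_ge0//.
apply: norm_le_coord; first exact: sqrtr_ge0.
by move=> i; rewrite -sqrtr_sqr ler_sqrt.
Qed.

(** At distance r <= 1 from the flow set the circle equation is violated by at most 6 r and the
    timer bounds by at most r; r is arbitrary. *)
Lemma flow_set_closed (R : realType) (n : nat) (Tmin Tmax : R) (s : 'rV[R]_(4 * n).+1) :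
  (forall r, 0 < r -> nearC (@flow_set R n Tmin Tmax) r s) -> flow_set Tmin Tmax s.
Proof.
move=> h; split.
  apply/andP; split; apply/ler_addgt0Pr => r r0; have := near_tau (h r r0); lra.
move=> i ni; apply/eqP; rewrite -subr_eq0 -normr_le0; apply/ler_addgt0Pr => e e0.
rewrite add0r; pose r := Num.min 1 (e / 6).
have r0 : 0 < r by rewrite lt_min ltr01 divr_gt0.
have r1 : r <= 1 by rewrite /r ge_min lexx.
have re : 6 * r <= e.
  have : r <= e / 6 by rewrite /r ge_min lexx orbT.
  clear; lra.
have [y [_ ty] sy] := h r r0.
have := st_norm (s - y) (2 * n + 2 * i); rewrite stB => /le_trans/(_ sy).
have := st_norm (s - y) (2 * n + 2 * i + 1); rewrite stB => /le_trans/(_ sy).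
have := torus_cc ty ni; have := torus_sc ty ni; have := ty i ni; rewrite /cc /sc.
move: (st s (2 * n + 2 * i)) (st s (2 * n + 2 * i + 1)) (st y (2 * n + 2 * i)) (st y (2 * n + 2 * i + 1)) => c s' cy sy'.
rewrite !ler_norml => h1 /andP[h2 h3] /andP[h4 h5] /andP[h6 h7] /andP[h8 h9].
have -> : c ^+ 2 + s' ^+ 2 - 1 = (c - cy) * (c - cy + 2 * cy) + (s' - sy') * (s' - sy' + 2 * sy').
  by rewrite -[X in _ - X]h1; ring.
have b (d u : R) : - r <= d -> d <= r -> -1 <= u -> u <= 1 -> `|d * (d + 2 * u)| <= 3 * r.
  move=> d1 d2 u1 u2; rewrite normrM mulrC; apply: ler_pM => //; rewrite ler_norml; lra.
rewrite -ler_norml; apply: le_trans (ler_normD _ _) _.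
apply: le_trans (lerD (b _ _ h8 h9 h4 h5) (b _ _ h6 h7 h2 h3)) _.
move: re; clear; lra.
Qed.

Section Distances.
Context {R : realType} {n : nat}.
Local Notation V := 'rV[R]_n.
Local Notation S := 'rV[R]_(4 * n).+1.

Lemma x2_of_qc (s : S) (i : 'I_n) : x2_of s ord0 i = qc s i.
Proof. by rewrite mxE. Qed.

(* The timer grows at rate at most 1 and drops by at least (Tmax - Tmin) / 2 at jumps. *)
Lemma dwell (kappa : nat -> rat) (k Tmin Tmax : R) (phi : V -> R) (a eps : R) (e : R -> S) (eb : R) E x :
  Tmin < Tmax -> (forall t, 0 <= t -> `|e t| <= eb) -> eb <= 1 / 2 -> eb <= (Tmax - Tmin) / 4 ->
  is_solution (perturb (H_ae kappa k Tmin Tmax phi a eps) e) E x ->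
  forall t j, E (t, j) ->
  tau_of (x t j) + (Tmax - Tmin) / 2 * j%:R <= t + Tmax + 1.
Proof.
move=> Tlt he e1 e2 xs.
have [hE [E00 [x0 [xflow xjump]]]] := xs.
have E0 t j : E (t, j) -> 0 <= t by case: hE => h _ /h.
have etau t : 0 <= t -> - eb <= tau_of (e t) <= eb.
  by move=> t0; rewrite -ler_norml; apply: le_trans (st_norm _ _) (he t t0).
apply: (htd_induction hE).
- have h0 : `|e 0| <= 1 / 2 by apply: le_trans (he 0 (lexx _)) e1.
  have n0 := solution_init_near (@D_sub_C _ _ _ _ Tlt) (divr_gt0 ltr01 (ltr0Sn _ 1)) h0 xs.
  by have := near_tau n0; rewrite mulr0; clear; lra.
- move=> u v j uv huv IH.
  have u0 : 0 <= u by apply: (E0 u j); apply: huv; rewrite lexx ltW.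
  have [|xC [xac xder]] := xflow j.
    by exists ((u + v) / 2); apply: (interior_segment huv); move: uv; clear; lra.
  have act : abs_cont_on (fun t => tau_of (x t j)) u v.
    by apply: xac; apply: huv; rewrite lexx ltW.
  have : tau_of (x v j) - tau_of (x u j) <= 1 * (v - u).
    apply: (@ac_ub _ (fun t => tau_of (x t j))) => //; first exact: ltW.
    move: xder; apply: ae_imply => t h tuv.
    have t0 : 0 <= t by move: tuv u0; clear; lra.
    have Ijt : Ij E j t by apply: huv; move: tuv; clear; lra.
    eexists; first exact: (h Ijt (inord (4 * n))).
    rewrite mxE -/(st (flow_map kappa k phi a eps (x t j + e t)) (4 * n)) -/(tau_of _) flow_tau.
    by move: (etau t t0) e1; rewrite /tau_of /st; clear; lra.
  by move: IH; clear; lra.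
- move=> t j Etj EtSj IH; have t0 := E0 _ _ Etj.
  have [[h1 _] ->] := xjump t j Etj EtSj.
  have -> : tau_of (jump_map Tmin (x t j + e t) + e t) = Tmin + tau_of (e t).
    by rewrite {1}/tau_of stD -/(tau_of _) jump_tau.
  move: h1; rewrite {1}/tau_of stD -/(tau_of _) -/(tau_of (e t)) => h1.
  by rewrite -[j.+1%:R]natr1 mulrDr; move: IH h1 (etau t t0) e2; clear; lra.
Qed.

Variables (phi : V -> R) (g : V -> V) (theta L : R) (zs : V).
Hypotheses (grad : is_gradient phi g) (theta0 : 0 < theta) (L0 : 0 < L).
Hypothesis g_lip : forall x y, enorm (g x - g y) <= L * enorm (x - y).
Hypothesis g_mono : forall x y, dotv (g x - g y) (x - y) >= theta * enorm (x - y) ^+ 2.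
Hypothesis zs_min : forall z, phi zs <= phi z.
Variables (k Tmin Tmax : R).
Hypotheses (k0 : 0 < k) (Tmin0 : 0 < Tmin) (Tlt : Tmin < Tmax).
Local Notation C := (@flow_set R n Tmin Tmax).
Local Notation A := (@Aset R n zs Tmin Tmax).
Local Notation V_f := (Vf phi zs k).
Local Notation QC := (@quadC R n L).

Lemma V_upper : exists2 K, 0 <= K & forall (s : S) r, 0 <= tau_of s -> tau_of s <= Tmax + 1 ->
  `|x1_of s - zs| <= r -> `|x2_of s - zs| <= r -> V_f s <= K * r ^+ 2.
Proof.
have k0' := k0; have T0' := Tmin0; have Tl' := Tlt.
have qc0 : 0 <= QC by exact: quadC_ge0.
have kT0 : 0 <= k * (Tmax + 1) ^+ 2 by rewrite mulr_ge0 ?sqr_ge0// ltW.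
exists (n%:R * (5 / 4) + k * (Tmax + 1) ^+ 2 * QC); first by rewrite addr_ge0// mulr_ge0.
move=> s r t0 t1 h1 h2.
have r0 : 0 <= r by apply: le_trans h1.
rewrite /Vf /Vq mulrDl; apply: lerD.
  rewrite -mulrA; apply: (@le_trans _ _ (\sum_(i < n) 5 / 4 * r ^+ 2)); last first.
    by rewrite sumr_const card_ord -[leLHS]mulr_natl.
  apply: ler_sum => i _.
  have := le_trans (coord_le_norm _ i) h1; have := le_trans (coord_le_norm _ i) h2.
  rewrite !mxE -/(qc s i) -/(pc s i) !ler_norml => /andP[a1 a2] /andP[a3 a4].
  have b1 : (qc s i - zs ord0 i) ^+ 2 <= r ^+ 2.
    by rewrite -ler_sqrt ?sqr_ge0// !sqrtr_sqr ler_norml (ger0_norm r0) a1.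
  have b2 : (pc s i - qc s i) ^+ 2 <= (2 * r) ^+ 2.
    rewrite -ler_sqrt ?sqr_ge0// !sqrtr_sqr ler_norml (ger0_norm (_ : 0 <= 2 * r)) ?mulr_ge0//; lra.
  rewrite exprMn in b2; lra.
have ub := phi_ub grad L0 g_lip zs_min (x1_of s).
apply: (@le_trans _ _ (k * (Tmax + 1) ^+ 2 * (QC * `|x1_of s - zs| ^+ 2))).
  apply: ler_pM => //.
  - by rewrite mulr_ge0 ?sqr_ge0// ltW.
  - by rewrite subr_ge0.
  apply: ler_wpM2l; first exact: ltW.
  apply: lerXn2r => //; rewrite nnegrE; lra.
rewrite mulrA; apply: ler_wpM2l; first by rewrite mulr_ge0.
by apply: lerXn2r; rewrite ?nnegrE.
Qed.

Lemma V_lower : exists2 K, 0 < K & forall (s : S), Tmin / 2 <= tau_of s ->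
  `|x1_of s - zs| ^+ 2 <= K * V_f s /\ `|x2_of s - zs| ^+ 2 <= K * V_f s.
Proof.
have k0' := k0; have T0' := Tmin0; have th0 := theta0.
pose c := k * (Tmin / 2) ^+ 2 * (theta / 2).
have c0 : 0 < c by rewrite !mulr_gt0// ?exprn_gt0 ?divr_gt0.
exists (4 + c^-1); first by rewrite addr_gt0// invr_gt0.
move=> s ts.
have gap : 0 <= k * tau_of s ^+ 2 * (phi (x1_of s) - phi zs).
  by apply: mulr_ge0; [rewrite mulr_ge0 ?sqr_ge0// ltW|rewrite subr_ge0].
have V1 := Vq_gap phi zs k s (fun i => qc s i); rewrite -/(Vf _ _ _ _) in V1.
have V0 : 0 <= V_f s := le_trans gap V1.
have ci0 : 0 <= c^-1 * V_f s by rewrite mulr_ge0// invr_ge0 ltW.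
split; (apply: norm_sqr_le; first by rewrite mulr_ge0// addr_ge0// invr_ge0 ltW) => i.
  rewrite mulrDl; apply: (@le_trans _ _ (c^-1 * V_f s)); last by rewrite lerDr mulr_ge0.
  rewrite ler_pdivlMl//; exact: (Vq_coord grad theta0 L0 g_lip g_mono zs_min k0 Tmin0 (fun i => qc s i) i ts).
rewrite mulrDl; apply: (@le_trans _ _ (4 * V_f s)); last by rewrite lerDl.
rewrite -ler_pdivrMl//; apply: (@le_trans _ _ (\sum_(i < n) (1 / 4 * (pc s i - qc s i) ^+ 2 + 1 / 4 * (qc s i - zs ord0 i) ^+ 2))).
  rewrite [leRHS](bigD1 i)//= !mxE -/(qc s i) addrAC.
  have a0 : 0 <= \sum_(j < n | j != i) (1 / 4 * (pc s j - qc s j) ^+ 2 + 1 / 4 * (qc s j - zs ord0 j) ^+ 2).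
    by apply: sumr_ge0 => j _; rewrite addr_ge0// mulr_ge0// sqr_ge0.
  have a1 : 0 <= (pc s i - qc s i) ^+ 2 by exact: sqr_ge0.
  by move: a0 a1; lra.
by rewrite /Vf /Vq lerDl.
Qed.

(** Keeps mu and tau and moves both blocks of x to the minimizer. [insub] only recovers an index of
    type ['I_n]; its default is never reached. *)
Definition project (s : S) : S := \row_j
  if (nat_of_ord j < n)%N then odflt 0 (omap (fun i => zs ord0 i) (insub (nat_of_ord j)))
  else if (nat_of_ord j < 2 * n)%N then odflt 0 (omap (fun i => zs ord0 i) (insub (nat_of_ord j - n)%N))
  else s ord0 j.

Lemma project_A (s : S) : C s -> A (project s).
Proof.
move=> [ts os]; split.
  apply/rowP => i; rewrite mxE st_rowE inordK; last by have := ltn_ord i; clear; lia.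
  by rewrite ltn_ord valK.
split.
  apply/rowP => i; rewrite mxE st_rowE inordK; last by have := ltn_ord i; clear; lia.
  rewrite ifF; last by clear; lia.
  rewrite ifT; last by have := ltn_ord i; clear; lia.
  by rewrite addKn valK.
have h q : (2 * n <= q)%N -> (q <= 4 * n)%N -> st (project s) q = st s q.
  move=> h1 h2; rewrite st_rowE inordK//.
  rewrite ifF; last by move: h1; clear; lia.
  by rewrite ifF; last by move: h1; clear; lia.
split; first by rewrite /tau_of h//; clear; lia.
move=> i ni; rewrite !h; first exact: os.
all: move: ni; clear; lia.
Qed.

(** The witness [y] makes the set of distances non-empty, so that [inf] is a genuine infimum and not
    a default value. *)
Lemma dist_lower (s y : S) : A y ->
  `|x1_of s - zs| <= dist_set A s /\ `|x2_of s - zs| <= dist_set A s.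
Proof.
move=> Ay; split; (apply: lb_le_inf; first by exists (enorm (s - y)), y) => _ [w [w1 [w2 _]] <-].
  rewrite -w1; apply: norm_le_coord; first exact: enorm_ge0.
  by move=> i; rewrite !mxE -stB; exact: coord_le_enorm.
rewrite -w2; apply: norm_le_coord; first exact: enorm_ge0.
by move=> i; rewrite !mxE -stB; exact: coord_le_enorm.
Qed.

Lemma dist_upper (s : S) r : nearC C r s ->
  dist_set A s <= (4 * n).+1%:R * (`|x1_of s - zs| + `|x2_of s - zs| + r).
Proof.
move=> [y Cy sy].
have r0 : 0 <= r by apply: le_trans sy.
apply: (@le_trans _ _ (enorm (s - project y))).
  apply: ge_inf; first by exists 0 => _ [w _ <-]; exact: enorm_ge0.
  by exists (project y) => //; exact: project_A.
apply: le_trans (enorm_le_norm _) _; apply: ler_wpM2l => //.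
apply: norm_le_coord; first by rewrite !addr_ge0.
move=> j; rewrite /project !mxE.
have a1 := normr_ge0 (x1_of s - zs); have a2 := normr_ge0 (x2_of s - zs).
case: ifP => j1.
  rewrite insubT /=; have := coord_le_norm (x1_of s - zs) (Ordinal j1).
  by rewrite !mxE /st /= inord_val; move: r0 a1 a2; lra.
case: ifP => j2.
  have j3 : (j - n < n)%N by apply: ltn_sub_x2 => //; rewrite leqNgt j1.
  rewrite insubT /=; have := coord_le_norm (x2_of s - zs) (Ordinal j3).
  rewrite !mxE /st /= subnKC ?inord_val; last by rewrite leqNgt j1.
  by move: r0 a1 a2; lra.
have := le_trans (coord_le_norm (s - y) j) sy; rewrite !mxE.
by move: r0 a1 a2; lra.
Qed.

End Distances.

Lemma compact_norm_bound (R : realType) (W : normedModType R) (K : set W) :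
  compact K -> exists2 B : R, 0 <= B & forall w, K w -> `|w| <= B.
Proof.
move=> /compact_bounded[M [Mr hM]]; exists (`|M| + 1); first by rewrite addr_ge0.
move=> w Kw; apply: (hM (`|M| + 1)) => //; have := ler_norm M; lra.
Qed.

Lemma sqr_le_add (R : realType) (x y z : R) : 0 <= x -> 0 <= y -> 0 <= z ->
  x ^+ 2 <= y ^+ 2 + z ^+ 2 -> x <= y + z.
Proof.
move=> x0 y0 z0 h; rewrite -(ler_pXn2r (_ : 0 < 2)%N) ?nnegrE ?addr_ge0//.
apply: le_trans h _; rewrite sqrrD; have : 0 <= y * z by rewrite mulr_ge0.
lra.
Qed.

(** V is comparable to the squared distance of x from the minimizer, so distances decay at half the
    rate of V, and the additive error is taken out of the square by [sqr_le_add]. The constants [c1]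
    and [c2] precede the compact set and nu. The uniform bound [B] is kept for completeness of
    solutions. *)
Lemma robust_exp (R : realType) (n : nat) (phi : 'rV[R]_n -> R) (g : 'rV[R]_n -> 'rV[R]_n)
    (theta L : R) (zs : 'rV[R]_n) (kappa : nat -> rat) (k Tmin Tmax : R) :
  is_gradient phi g -> 0 < theta -> 0 < L ->
  (forall x y, enorm (g x - g y) <= L * enorm (x - y)) ->
  (forall x y, dotv (g x - g y) (x - y) >= theta * enorm (x - y) ^+ 2) ->
  (forall z, phi zs <= phi z) ->
  (forall i, (i < n)%N -> 0 < kappa i) ->
  (forall i j, (i < n)%N -> (j < n)%N -> kappa i = kappa j -> i = j) ->
  0 < k -> 0 < Tmin -> Tmin < Tmax -> gam theta k Tmin Tmax <= 1 ->
  exists c1 c2 : R, [/\ 0 < c1, 0 < c2 &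
  forall K : set 'rV[R]_(4 * n).+1, compact K -> forall nu, 0 < nu ->
  exists B, exists2 as_, 0 < as_ & forall a, 0 < a < as_ ->
  exists2 es, 0 < es & forall eps, 0 < eps < es ->
  exists2 eb, 0 < eb & forall ebar, ebar <= eb ->
  forall e : R -> 'rV[R]_(4 * n).+1, (forall t, 0 <= t -> `|e t| <= ebar) ->
  forall E x, is_solution (perturb (H_ae kappa k Tmin Tmax phi a eps) e) E x ->
  K (x 0 0%N) -> forall t j, E (t, j) ->
  `|x t j| <= B /\
  dist_set (Aset zs Tmin Tmax) (x t j) <=
    c1 * dist_set (Aset zs Tmin Tmax) (x 0 0%N) * expR (- (c2 * (t + j%:R))) + nu].
Proof.
move=> grad theta0 L0 g_lip g_mono zs_min kappa0 kappa_inj k0 Tmin0 Tlt gm1.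
have [Ku Ku0 hKu] := V_upper grad L0 g_lip zs_min k0 Tmin0 Tlt.
have [Kl Kl0 hKl] := V_lower grad theta0 L0 g_lip g_mono zs_min k0 Tmin0.
pose c := @rateV R n theta L k Tmin Tmax.
have c0 : 0 < c := rateV_gt0 theta0 L0 k0 Tmin0 Tlt.
have hcore M0 nu r0 := @core_estimate R n phi g theta L zs kappa k Tmin Tmax M0 nu r0
  grad theta0 L0 g_lip g_mono zs_min kappa0 kappa_inj k0 Tmin0 Tlt gm1.
rewrite -/c in hcore.
have gm0 : 0 <= gam theta k Tmin Tmax by exact: gam_ge0.
have Tm0 : 0 < Tmax by exact: lt_trans Tlt.
clearbody c.
pose d := (Tmax - Tmin) / 2.
have d0 : 0 < d by rewrite divr_gt0// subr_gt0.
(* Since d j <= t + Tmax + 1 by [dwell], c t is at least c' (t + j) minus the constant 2 [h0]. *)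
pose c' := c / (1 + d^-1).
have d10 : 0 < 1 + d^-1 by rewrite addr_gt0// invr_gt0.
have c'0 : 0 < c' by rewrite divr_gt0.
have cE : c = c' * (1 + d^-1) by rewrite /c' divfK// gt_eqF.
pose c2 := c' / 2.
pose h0 := c2 * ((Tmax + 1) / d).
pose m : R := (4 * n).+1%:R.
have m0 : 0 < m by rewrite /m ltr0n.
(* Adding 1 makes A^2 at least Kl Ku, which avoids a square root. *)
pose A := Kl * Ku + 1.
have KK0 : 0 <= Kl * Ku by rewrite mulr_ge0// ltW.
have A0 : 0 < A by rewrite /A; move: KK0; clear; lra.
exists (2 * m * A * expR h0), c2; split; [|by rewrite divr_gt0|].
  by rewrite !mulr_gt0// expR_gt0.
move=> K Kc nu nu0.
have [BK BK0 hBK] := compact_norm_bound Kc.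
pose M0 := Ku * (BK + `|zs|) ^+ 2 + 1.
have M00 : 0 < M0 by rewrite /M0 ltr_wpDl// mulr_ge0// sqr_ge0.
pose r0 := Num.min (nu / (4 * m)) (Tmin / 2).
have nm0 : 0 < nu / (4 * m) by rewrite divr_gt0// mulr_gt0.
have r00 : 0 < r0 by rewrite lt_min nm0 divr_gt0.
have r0m : r0 <= nu / (4 * m) by rewrite /r0 ge_min lexx.
have r0T : r0 <= Tmin / 2 by rewrite /r0 ge_min lexx orbT.
(* Multiplication by [Kl] turns the error into the square of nu / (4 m). The two blocks of x and
   [r0] then contribute three errors nu / (4 m), hence 3 nu / 4 after the factor m. *)
pose nu1 := (nu / (4 * m)) ^+ 2 / Kl.
have nu10 : 0 < nu1 by rewrite divr_gt0// exprn_gt0.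
have [B [as_ as0 has]] := hcore M0 nu1 r0 M00 nu10 r00.
exists B, as_ => // a /has[es es0 hes]; exists es => // eps /hes[eb eb0 heb].
pose ed := Num.min (Num.min (1 / 2) (Tmin / 4)) ((Tmax - Tmin) / 4).
have ed0 : 0 < ed by rewrite !lt_min !divr_gt0// subr_gt0.
have ed1 : ed <= 1 / 2 by rewrite /ed !ge_min lexx.
have ed2 : ed <= Tmin / 4 by rewrite /ed !ge_min lexx orbT.
have ed3 : ed <= (Tmax - Tmin) / 4 by rewrite /ed !ge_min lexx !orbT.
exists (Num.min eb ed); first by rewrite lt_min eb0.
move=> ebar; rewrite le_min => /andP[ebb ebd] e he E x xs Kx t j Etj.
have n0 := solution_init_near (@D_sub_C _ _ _ _ Tlt) ed0 (le_trans (he 0 (lexx _)) ebd) xs.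
have [y0 Cy0 xy0] := n0.
have Ay := project_A zs Cy0.
have [dl1 dl2] := dist_lower (x 0 0%N) Ay.
have T0 := near_tau n0.
set D0 := dist_set _ (x 0 0%N) in dl1 dl2 *.
have D00 : 0 <= D0 by apply: le_trans dl1.
have tau0 : 0 <= tau_of (x 0 0%N) by move: T0 ed2 Tmin0; clear; lra.
have tau1 : tau_of (x 0 0%N) <= Tmax + 1 by move: T0 ed1; clear; lra.
have V0 : Vf phi zs k (x 0 0%N) <= Ku * D0 ^+ 2 by exact: hKu.
have V0M : Vf phi zs k (x 0 0%N) < M0.
  apply: (@le_lt_trans _ _ (Ku * (BK + `|zs|) ^+ 2)); last by rewrite /M0 ltrDl.
  apply: hKu => //; apply: le_trans (ler_normB _ _) _; rewrite lerD2r.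
    by apply: le_trans (x1_of_norm _) _; exact: hBK.
  apply: (le_trans _ (hBK _ Kx)).
  by apply: norm_le_coord => // i; rewrite !mxE st_norm.
have [nx xB Vx] := heb ebar ebb e he E x xs V0M t j Etj.
split => //.
have Tt := near_tau nx.
have tT : Tmin / 2 <= tau_of (x t j) by move: Tt r0T; clear; lra.
have [l1 l2] := hKl _ tT.
have dw := @dwell R n kappa k Tmin Tmax phi a eps e ebar E x Tlt he (le_trans ebd ed1) (le_trans ebd ed3) xs t j Etj.
have t0 : 0 <= t by case: xs => [[h _] _]; exact: (h (t, j)).
pose Ee := expR (h0 - c2 * (t + j%:R)).
have thE : gam theta k Tmin Tmax ^+ j * expR (- (c * t)) <= Ee ^+ 2.
  apply: (@le_trans _ _ (expR (- (c * t)))).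
    by rewrite ler_piMl ?expR_ge0// exprn_ile1.
  rewrite expr2 /Ee -expRD ler_expR.
  have dj : j%:R <= (t + Tmax + 1) / d.
    rewrite ler_pdivlMr// mulrC -/d; move: dw tT Tmin0; rewrite -/d; clear; lra.
  have -> : h0 - c2 * (t + j%:R) + (h0 - c2 * (t + j%:R)) = c' * ((Tmax + 1) / d - t - j%:R).
    by rewrite /h0 /c2; field; rewrite gt_eqF.
  have -> : - (c * t) = c' * ((Tmax + 1) / d - t - (t + Tmax + 1) / d).
    by rewrite cE; field; rewrite gt_eqF.
  apply: ler_wpM2l; first exact: ltW.
  by move: dj; clear; lra.
have V00 : 0 <= Vf phi zs k (x 0 0%N).
  apply: le_trans (Vq_gap phi zs k _ _); apply: mulr_ge0; first by rewrite mulr_ge0 ?sqr_ge0// ltW.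
  by rewrite subr_ge0.
have Ee0 : 0 <= Ee by exact: expR_ge0.
have KlV : Kl * Vf phi zs k (x t j) <= (A * D0 * Ee) ^+ 2 + (nu / (4 * m)) ^+ 2.
  apply: (@le_trans _ _ (Kl * (Ee ^+ 2 * (Ku * D0 ^+ 2) + nu1))).
    apply: ler_wpM2l; first exact: ltW.
    apply: le_trans Vx _; rewrite lerD2r; apply: ler_pM => //.
    by rewrite mulr_ge0 ?exprn_ge0 ?expR_ge0.
  rewrite mulrDr (_ : Kl * nu1 = (nu / (4 * m)) ^+ 2); last by rewrite /nu1 mulrC divfK// gt_eqF.
  rewrite lerD2r.
  have -> : Kl * (Ee ^+ 2 * (Ku * D0 ^+ 2)) = Kl * Ku * (D0 * Ee) ^+ 2 by ring.
  have -> : (A * D0 * Ee) ^+ 2 = A ^+ 2 * (D0 * Ee) ^+ 2 by ring.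
  apply: ler_wpM2r; first exact: sqr_ge0.
  by rewrite /A; move: KK0; clear; move: (Kl * Ku) => z z0; nra.
have AE0 : 0 <= A * D0 * Ee by rewrite !mulr_ge0// ltW.
have nm0' := ltW nm0.
have b1 : `|x1_of (x t j) - zs| <= A * D0 * Ee + nu / (4 * m).
  by apply: sqr_le_add => //; exact: le_trans l1 KlV.
have b2 : `|x2_of (x t j) - zs| <= A * D0 * Ee + nu / (4 * m).
  by apply: sqr_le_add => //; exact: le_trans l2 KlV.
apply: le_trans (dist_upper zs nx) _; rewrite -/m.
apply: (@le_trans _ _ (m * (2 * (A * D0 * Ee) + 3 * (nu / (4 * m))))).
  by apply: ler_wpM2l; [exact: ltW|move: b1 b2 r0m; move: (nu / (4 * m)) (A * D0 * Ee) => q z; clear; lra].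
have -> : m * (2 * (A * D0 * Ee) + 3 * (nu / (4 * m))) = 2 * m * A * D0 * Ee + 3 / 4 * nu.
  by field; rewrite gt_eqF.
have -> : 2 * m * A * expR h0 * D0 * expR (- (c2 * (t + j%:R))) = 2 * m * A * D0 * Ee.
  by rewrite /Ee expRD; ring.
by rewrite lerD2l; move: nu0; clear; lra.
Qed.

Lemma perturb0 (R : realType) (m : nat) (C D : set 'rV[R]_m) (F G : 'rV[R]_m -> 'rV[R]_m) :
  perturb (HSys (fun=> C) (fun=> F) (fun=> D) (fun=> G)) (fun=> 0) =
  HSys (fun=> C) (fun=> F) (fun=> D) (fun=> G).
Proof.
by rewrite /perturb /=; congr HSys; apply: funext => t; apply: funext => s; rewrite ?addr0.
Qed.

Lemma perturb_H_ae0 (R : realType) (n : nat) (kappa : nat -> rat) (k Tmin Tmax : R)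
    (phi : 'rV[R]_n -> R) (a eps : R) :
  perturb (H_ae kappa k Tmin Tmax phi a eps) (fun=> 0) = H_ae kappa k Tmin Tmax phi a eps.
Proof. exact: perturb0. Qed.

(** The zero perturbation is bounded by every positive number, so the state is arbitrarily near the
    flow set, endpoints of flow intervals included, and closedness concludes. *)
Lemma nominal_in_flow_set (R : realType) (n : nat) (kappa : nat -> rat) (k Tmin Tmax : R)
    (phi : 'rV[R]_n -> R) (a eps : R) E x : Tmin < Tmax ->
  is_solution (H_ae kappa k Tmin Tmax phi a eps) E x ->
  forall t j, E (t, j) -> flow_set Tmin Tmax (x t j).
Proof.
move=> Tlt; rewrite -perturb_H_ae0 => xs t j Etj; apply: flow_set_closed => r r0.
have r20 : 0 < r / 2 by rewrite divr_gt0.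
rewrite (_ : r = 2 * (r / 2)); last by field.
apply: (solution_near (@D_sub_C _ _ _ _ Tlt) (@jump_C _ _ _ _ Tlt) r20 _ xs Etj).
by move=> u _; rewrite normr0 ltW.
Qed.

(** From x1 = x2 and tau = Tmin, the computation behind [Vf_jump] bounds V initially by k Tmax^2
    times the gap, while V is never below k Tmin^2 times the gap: the ratio is Tmax^2 / Tmin^2.
    Reading [phi] at z instead of x1 costs O(a). *)
Lemma suboptimality_bound (R : realType) (n : nat) (phi : 'rV[R]_n -> R) (g : 'rV[R]_n -> 'rV[R]_n)
    (theta L : R) (zs : 'rV[R]_n) (kappa : nat -> rat) (k Tmin Tmax : R) :
  is_gradient phi g -> 0 < theta -> 0 < L ->
  (forall x y, enorm (g x - g y) <= L * enorm (x - y)) ->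
  (forall x y, dotv (g x - g y) (x - y) >= theta * enorm (x - y) ^+ 2) ->
  (forall z, phi zs <= phi z) ->
  (forall i, (i < n)%N -> 0 < kappa i) ->
  (forall i j, (i < n)%N -> (j < n)%N -> kappa i = kappa j -> i = j) ->
  0 < k -> 0 < Tmin -> Tmin < Tmax -> gam theta k Tmin Tmax <= 1 ->
  forall K0 : set ('rV[R]_n * 'rV[R]_n), compact K0 ->
   forall nu : R, 0 < nu ->
   exists2 as_ : R, 0 < as_ & forall a : R, 0 < a < as_ ->
   exists2 es : R, 0 < es & forall eps : R, 0 < eps < es ->
   forall E x, is_solution (H_ae kappa k Tmin Tmax phi a eps) E x ->
     K0 (x1_of (x 0 0%N), x2_of (x 0 0%N)) ->
     tau_of (x 0 0%N) = Tmin ->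
     x1_of (x 0 0%N) = x2_of (x 0 0%N) ->
     forall (t : R) (j : nat), E (t, j) ->
       phi (z_of a (x t j)) - phi zs <=
         (Tmax ^+ 2 / Tmin ^+ 2) * gam theta k Tmin Tmax ^+ j
         * (phi (z_of a (x 0 0%N)) - phi zs) + nu.
Proof.
move=> grad theta0 L0 g_lip g_mono zs_min kappa0 kappa_inj k0 Tmin0 Tlt gm1 K0 K0c nu nu0.
have [Ku Ku0 hKu] := V_upper grad L0 g_lip zs_min k0 Tmin0 Tlt.
pose c := @rateV R n theta L k Tmin Tmax.
have c0 : 0 < c := rateV_gt0 theta0 L0 k0 Tmin0 Tlt.
have hcore M0 nu r0 := @core_estimate R n phi g theta L zs kappa k Tmin Tmax M0 nu r0
  grad theta0 L0 g_lip g_mono zs_min kappa0 kappa_inj k0 Tmin0 Tlt gm1.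
rewrite -/c in hcore.
have gm0 : 0 <= gam theta k Tmin Tmax by exact: gam_ge0.
have Tm0 : 0 < Tmax by exact: lt_trans Tlt.
clearbody c.
pose al := Tmax ^+ 2 / Tmin ^+ 2.
have al0 : 0 <= al by rewrite divr_ge0// exprn_ge0// ltW.
have [BK BK0 hBK] := compact_norm_bound K0c.
pose M0 := Ku * (BK + `|zs|) ^+ 2 + 1.
have M00 : 0 < M0 by rewrite /M0 ltr_wpDl// mulr_ge0// sqr_ge0.
have kT : 0 < k * Tmin ^+ 2 by rewrite mulr_gt0// exprn_gt0.
(* Becomes nu / 2 after division by k Tmin^2; the other nu / 2 pays for the dither. *)
pose nu1 := k * Tmin ^+ 2 * (nu / 2).
have nu10 : 0 < nu1 by rewrite mulr_gt0// divr_gt0.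
have [B [a1 a10 ha1]] := hcore M0 nu1 1 M00 nu10 ltr01.
pose KB := n%:R * (n%:R * L * (`|B| + `|zs|)) + @quadC R n L.
have qc0 : 0 <= @quadC R n L by exact: quadC_ge0.
have nd0 : 0 <= n%:R * L * (`|B| + `|zs|) by rewrite !mulr_ge0 ?addr_ge0// ltW.
have KB0 : 0 <= KB by rewrite /KB addr_ge0// mulr_ge0.
have dither a (s : 'rV[R]_(4 * n).+1) : 0 < a -> a <= 1 -> flow_set Tmin Tmax s -> `|s| <= B ->
    `|phi (z_of a s) - phi (x1_of s)| <= a * KB.
  move=> p0 p1 [_ ts] sB; have := phi_quad grad L0 g_lip (x1_of s) (z_of a s).
  have -> : z_of a s - x1_of s = a *: mut_of s by rewrite /z_of addrC addKr.
  have zn : `|a *: mut_of s : 'rV[R]_n| <= a.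
    apply: norm_le_coord; first exact: ltW.
    by move=> i; rewrite !mxE normrM (gtr0_norm p0) ler_piMr ?(ltW p0)//; exact: torus_cc.
  set T := \sum_(i < n) _ => h.
  have hT : `|T| <= a * (n%:R * (n%:R * L * (`|B| + `|zs|))).
    apply: le_trans (ler_norm_sum _ _ _) _.
    apply: (@le_trans _ _ (\sum_(i < n) (n%:R * L * (`|B| + `|zs|)) * a)); last first.
      rewrite sumr_const card_ord -[leLHS]mulr_natl le_eqVlt; apply/orP; left; apply/eqP; ring.
    apply: ler_sum => i _; rewrite normrM; apply: ler_pM => //.
      apply: le_trans (grad_ub grad L0 g_lip zs_min _ _) _.
      apply: ler_wpM2l; first by rewrite mulr_ge0// ltW.
      apply: le_trans (ler_normB _ _) _; rewrite lerD2r.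
      by apply: le_trans (x1_of_norm s) _; apply: le_trans sB (ler_norm _).
    by apply: le_trans zn; exact: coord_le_norm.
  rewrite -[phi (z_of a s) - _](subrK T); apply: le_trans (ler_normD _ _) _.
  rewrite /KB mulrDr addrC; apply: lerD => //.
  apply: le_trans h _; rewrite mulrC; apply: ler_wpM2r => //.
  apply: (@le_trans _ _ (a ^+ 2)); first by apply: lerXn2r; rewrite ?nnegrE ?(ltW p0).
  by rewrite expr2 ler_piMl// ltW.
(* The dither is paid once at the current time, and once at the initial time with a weight of at
   most [al]. *)
have ca0 : 0 <= (al + 1) * KB by rewrite mulr_ge0// addr_ge0.
have [a2 a20 ha2] := small_mul ca0 (divr_gt0 nu0 (ltr0Sn _ 1)).
exists (Num.min (Num.min a1 1) a2); first by rewrite !lt_min a10 ltr01.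
move=> a /andP[p0]; rewrite !lt_min => /andP[/andP[aa1 /ltW aa2] aa3].
have [es es0 hes] := ha1 a ltac:(by rewrite p0).
exists es => // eps /hes[eb eb0 heb] E x xs Kx tauT x12 t j Etj.
have inC := nominal_in_flow_set Tlt xs.
have E00 : E (0, 0%N) by case: xs => _ [].
have C0 := inC _ _ E00; have Ct := inC _ _ Etj.
have bk := hBK _ Kx.
have x1B : `|x1_of (x 0 0%N)| <= BK.
  by apply: le_trans bk; rewrite prod_normE /= le_max lexx.
have V0M : Vf phi zs k (x 0 0%N) < M0.
  apply: (@le_lt_trans _ _ (Ku * (BK + `|zs|) ^+ 2)); last by rewrite /M0 ltrDl.
  have x1z : `|x1_of (x 0 0%N) - zs| <= BK + `|zs|.
    by apply: le_trans (ler_normB _ _) _; rewrite lerD2r.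
  apply: hKu; rewrite ?tauT -?x12 //; first exact: ltW.
  by move: Tlt; clear; lra.
have xs' := xs; rewrite -perturb_H_ae0 in xs'.
have e0 (u : R) : 0 <= u -> `|(fun=> 0 : 'rV[R]_(4 * n).+1) u| <= eb by move=> _ /=; rewrite normr0 ltW.
have hx := heb eb (lexx _) (fun=> 0) e0 E x xs' V0M.
have [_ xB0 _] := hx _ _ E00.
have [_ xB Vx] := hx _ _ Etj.
have t0 : 0 <= t by case: xs => [[h _] _]; exact: (h (t, j)).
set ga := gam _ _ _ _ in gm0 gm1 Vx *.
pose De s := phi (x1_of s) - phi zs.
have De0 s : 0 <= De s by rewrite subr_ge0.
have gaj0 : 0 <= ga ^+ j by exact: exprn_ge0.
have V0 : Vf phi zs k (x 0 0%N) <= k * Tmax ^+ 2 * De (x 0 0%N).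
  apply: (@le_trans _ _ (ga * (k * Tmax ^+ 2 * De (x 0 0%N)))); last first.
    by rewrite ler_piMl// mulr_ge0// mulr_ge0 ?sqr_ge0// ltW.
  have -> : ga * (k * Tmax ^+ 2 * De (x 0 0%N)) =
     (2 * theta)^-1 * De (x 0 0%N) + k * Tmin ^+ 2 * De (x 0 0%N).
    by rewrite /ga /gam; field; rewrite !gt_eqF.
  rewrite /Vf /Vq tauT lerD2r.
  have -> : \sum_(i < n) (1 / 4 * (pc (x 0 0%N) i - qc (x 0 0%N) i) ^+ 2 +
      1 / 4 * (qc (x 0 0%N) i - zs ord0 i) ^+ 2) =
      (2 * theta)^-1 * (theta / 2 * \sum_(i < n) (x1_of (x 0 0%N) - zs) ord0 i ^+ 2).
    rewrite mulrA mulr_sumr; apply: eq_bigr => i _.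
    have -> : pc (x 0 0%N) i = x1_of (x 0 0%N) ord0 i by rewrite mxE.
    rewrite -x2_of_qc -x12 subrr expr0n mulr0 add0r !mxE; field.
    by rewrite gt_eqF.
  apply: ler_wpM2l; first by rewrite invr_ge0 mulr_ge0// ltW.
  exact: phi_lb grad L0 g_lip g_mono zs_min _.
have Dt : De (x t j) <= al * ga ^+ j * De (x 0 0%N) + nu / 2.
  have h1 : k * Tmin ^+ 2 * De (x t j) <= Vf phi zs k (x t j).
    apply: le_trans (Vq_gap phi zs k _ _); apply: ler_wpM2r; first exact: De0.
    apply: ler_wpM2l; first exact: ltW.
    have [/andP[? _] _] := Ct; apply: lerXn2r => //; rewrite nnegrE; first exact: ltW.
    by apply: le_trans (ltW Tmin0) _.
  have h2 : ga ^+ j * expR (- (c * t)) * Vf phi zs k (x 0 0%N) <= ga ^+ j * (k * Tmax ^+ 2 * De (x 0 0%N)).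
    apply: (@le_trans _ _ (ga ^+ j * expR (- (c * t)) * (k * Tmax ^+ 2 * De (x 0 0%N)))).
      by apply: ler_wpM2l => //; rewrite mulr_ge0// expR_ge0.
    apply: ler_wpM2r; first by rewrite mulr_ge0// mulr_ge0 ?sqr_ge0// ltW.
    rewrite -[leRHS]mulr1; apply: ler_wpM2l => //.
    by rewrite -expR0 ler_expR oppr_le0 mulr_ge0// ltW.
  rewrite -(ler_pM2l kT).
  have -> : k * Tmin ^+ 2 * (al * ga ^+ j * De (x 0 0%N) + nu / 2) =
    ga ^+ j * (k * Tmax ^+ 2 * De (x 0 0%N)) + nu1.
    by rewrite /al /nu1; field; rewrite gt_eqF.
  by move: h1 h2 Vx; clear; lra.
have z0 := dither a _ p0 aa2 C0 xB0; have zt := dither a _ p0 aa2 Ct xB.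
rewrite !ler_norml in z0 zt; case/andP: z0 => z01 z02; case/andP: zt => zt1 zt2.
have aKB := ha2 a ltac:(by rewrite p0).
have h3 : al * ga ^+ j * De (x 0 0%N) <= al * ga ^+ j * (phi (z_of a (x 0 0%N)) - phi zs) + al * (a * KB).
  apply: (@le_trans _ _ (al * ga ^+ j * ((phi (z_of a (x 0 0%N)) - phi zs) + a * KB))).
    apply: ler_wpM2l; first by rewrite mulr_ge0.
    by rewrite /De; move: z01 z02; clear; lra.
  rewrite mulrDr lerD2l -mulrA; apply: ler_wpM2l => //.
  by rewrite ler_piMl ?exprn_ile1// mulr_ge0// ltW.
have h4 : a * ((al + 1) * KB) = al * (a * KB) + a * KB by ring.
rewrite h4 in aKB; rewrite -/al; move: Dt zt2 h3 aKB; rewrite /De; clear; lra.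
Qed.

(** * Local existence and prolongation of solutions *)

Lemma lip_continuous (R : realType) (f : R -> R) (K : R) :
  (forall x y, `|f x - f y| <= K * `|x - y|) -> continuous f.
Proof.
move=> h x; apply/cvgrPdist_lt => e e0; apply/nbhs_ballP.
have K1 : 0 < `|K| + 1 by rewrite ltr_wpDl.
exists (e / (`|K| + 1)) => [|y]; first exact: divr_gt0.
rewrite /ball /= ltr_pdivlMr// mulrC => xy.
apply: le_lt_trans (h x y) _; apply: le_lt_trans xy; apply: ler_wpM2r => //.
by have := ler_norm K; lra.
Qed.

Lemma primitive (R : realType) (f : R -> R) (a : R) : continuous f ->
  exists F : R -> R, forall t, a < t -> is_derive t 1 F (f t).
Proof.
move=> cf; exists (fun t => \int[lebesgue_measure]_(u in `[a, t]) f u)%R => t at_.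
have tt1 : t < t + 1 by rewrite ltrDl.
have fi : lebesgue_measure.-integrable `[a, t + 1] (EFin \o f).
  apply: continuous_compact_integrable; first exact: segment_compact.
  by apply: continuous_subspaceT => x; exact: cf.
have [h1 h2] := continuous_FTC1_closed tt1 fi at_ (cf t).
by split; [exact: h1|rewrite -derive1E; exact: h2].
Qed.

Lemma deriv_bound (R : realType) (F f : R -> R) (a b K : R) : a <= b ->
  (forall t, a <= t <= b -> is_derive t 1 F (f t)) ->
  (forall t, a <= t <= b -> `|f t| <= K) -> `|F b - F a| <= K * (b - a).
Proof.
move=> ab dF fK.
have [||c cab ->] := @MVT_segment R F f a b ab.
- by move=> t; rewrite in_itv/= => /andP[t1 t2]; apply: dF; rewrite !ltW.
- apply: derivable_within_continuous => t; rewrite in_itv/= => h.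
  by have [] := dF t h.
rewrite normrM (ger0_norm (_ : 0 <= b - a)) ?subr_ge0//.
by apply: ler_wpM2r; rewrite ?subr_ge0//; apply: fK; rewrite in_itv/= in cab.
Qed.

Lemma deriv_boundV (R : realType) (m : nat) (x f : R -> 'rV[R]_m) (a b K : R) : a <= b ->
  (forall t i, a <= t <= b -> is_derive t 1 (fun s => x s ord0 i) (f t ord0 i)) ->
  (forall t, a <= t <= b -> `|f t| <= K) -> `|x b - x a| <= K * (b - a).
Proof.
move=> ab dF fK.
have K0 : 0 <= K by apply: le_trans (fK a _); rewrite ?lexx.
apply: norm_le_coord; first by rewrite mulr_ge0// subr_ge0.
move=> i; rewrite !mxE; apply: (@deriv_bound R (fun s => x s ord0 i) (fun t => f t ord0 i)) => // t tab.
by apply: le_trans (coord_le_norm _ _) _; exact: fK.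
Qed.

Lemma geometric_small (R : realType) (M e : R) : 0 < e -> exists k : nat, M / 2 ^+ k <= e.
Proof.
move=> e0; pose k := Num.bound (`|M| / e); exists k.
have h : `|M| / e < k%:R by apply: archi_boundP; rewrite divr_ge0// ltW.
rewrite ler_pdivrMr ?exprn_gt0//; apply: le_trans (ler_norm _) _.
rewrite ltr_pdivrMr// mulrC in h; apply: le_trans (ltW h) _.
by apply: ler_wpM2l; [exact: ltW|rewrite -natrX ler_nat ltnW// ltn_expl].
Qed.

(** Nested intervals: u_k - 2 M / 2^k increases, u_k + 2 M / 2^k decreases, and the supremum of the
    left ends lies in all of them. *)
Lemma geometric_limit (R : realType) (u : nat -> R) (M : R) :
  (forall k, `|u k.+1 - u k| <= M / 2 ^+ k) ->
  exists l, forall k, `|u k - l| <= 2 * M / 2 ^+ k.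
Proof.
move=> h.
have hk k : M / 2 ^+ k = 2 * M / 2 ^+ k - 2 * M / 2 ^+ k.+1.
  by rewrite exprS; field; rewrite gt_eqF// exprn_gt0.
have M0 k : 0 <= 2 * M / 2 ^+ k.
  apply: divr_ge0; last by rewrite exprn_ge0.
  by have := le_trans (normr_ge0 _) (h 0%N); rewrite expr0 divr1; lra.
pose b k := u k - 2 * M / 2 ^+ k; pose c k := u k + 2 * M / 2 ^+ k.
have bS k : b k <= b k.+1 by have := h k; rewrite hk /b ler_norml => /andP[]; lra.
have cS k : c k.+1 <= c k by have := h k; rewrite hk /c ler_norml => /andP[]; lra.
have bm j k : b j <= b (j + k)%N by elim: k => [|k ih]; rewrite ?addn0// addnS; exact: le_trans ih (bS _).
have cm j k : c (j + k)%N <= c j by elim: k => [|k ih]; rewrite ?addn0// addnS; exact: le_trans (cS _) ih.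
have bc j k : b j <= c k.
  apply: le_trans (bm j k) _; apply: le_trans (_ : c (k + j)%N <= _); last exact: cm.
  by rewrite addnC /b /c; have := M0 (k + j)%N; lra.
have ub : has_ubound (range b) by exists (c 0%N) => _ [k _ <-]; exact: bc.
exists (sup (range b)) => k.
have h1 : b k <= sup (range b) by apply: ub_le_sup => //; exists k.
have h2 : sup (range b) <= c k by apply: ge_sup; [exists (b 0%N); exists 0%N|move=> _ [j _ <-]; exact: bc].
by rewrite ler_norml; rewrite /b /c in h1 h2; lra.
Qed.

(* [v] is iterated in the class [X] of curves with speed at most [Ga] in the ball, the
   integral operator being extended to all times by clamping to [0, d]. *)
Lemma picard (R : realType) (m : nat) (G : 'rV[R]_m -> 'rV[R]_m) (s0 : 'rV[R]_m) (r Lc : R) :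
  0 < r -> 0 <= Lc ->
  (forall s s', `|s - s0| <= r -> `|s' - s0| <= r -> `|G s - G s'| <= Lc * `|s - s'|) ->
  exists2 d, 0 < d & exists u : R -> 'rV[R]_m, u 0 = s0 /\
    forall t, 0 <= t <= d -> `|u t - s0| <= r /\
      forall i, is_derive t 1 (fun s => u s ord0 i) (G (u t) ord0 i).
Proof.
move=> r0 Lc0 GL.
pose Ga := `|G s0| + Lc * r.
have Ga0 : 0 <= Ga by rewrite addr_ge0// mulr_ge0// ltW.
have GB s : `|s - s0| <= r -> `|G s| <= Ga.
  move=> sr; rewrite -[G s](subrK (G s0)); apply: le_trans (ler_normD _ _) _.
  rewrite addrC /Ga lerD2l; apply: le_trans (GL _ _ sr _) _; first by rewrite subrr normr0 ltW.
  exact: ler_wpM2l.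
(* The first bound keeps curves of speed [Ga] in the ball; the second makes the integral operator a
   contraction of ratio 1/2. *)
pose d := Num.min (r / (Ga + 1)) (1 / (2 * (Lc + 1))).
have d0 : 0 < d.
  by rewrite lt_min !divr_gt0// ?mulr_gt0// ltr_wpDl.
have dG : d * Ga <= r.
  have : d <= r / (Ga + 1) by rewrite /d ge_min lexx.
  rewrite ler_pdivlMr ?ltr_wpDl// => h; apply: le_trans h.
  by apply: ler_wpM2l; [exact: ltW|rewrite lerDl].
have dL : Lc * d <= 1 / 2.
  have : d <= 1 / (2 * (Lc + 1)) by rewrite /d ge_min lexx orbT.
  rewrite ler_pdivlMr ?mulr_gt0 ?ltr_wpDl// => h.
  by move: h d0; clear; move: d => z h z0; lra.
exists d => //.
pose X (v : R -> 'rV[R]_m) := (forall t t', `|v t - v t'| <= Ga * `|t - t'|) /\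
  (forall t, `|v t - s0| <= r).
(* The primitives start at -1 so that two-sided derivatives exist at 0 itself. *)
have /choice[Phi hPhi] : forall v, exists Ph : R -> 'rV[R]_m, X v -> Ph 0 = 0 /\
    forall (t : R) (i : 'I_m), -1 < t -> is_derive t 1 (fun s => Ph s ord0 i) (G (v t) ord0 i).
  move=> v; have [Xv|nX] := pselect (X v); last by exists (fun=> 0) => /nX.
  have /choice[F hF] : forall i : 'I_m, exists F : R -> R, forall t : R, -1 < t ->
      is_derive t 1 F (G (v t) ord0 i).
    move=> i; apply: primitive; apply: (@lip_continuous _ _ (Lc * Ga)) => x y.
    have := coord_le_norm (G (v x) - G (v y)) i; rewrite !mxE => /le_trans; apply.
    case: Xv => X1 X2; apply: le_trans (GL _ _ (X2 x) (X2 y)) _.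
    by rewrite -mulrA; apply: ler_wpM2l.
  exists (fun t => \row_i (F i t - F i 0)) => _; split.
    by apply/rowP => i; rewrite !mxE subrr.
  move=> t i t1; have := is_deriveB (hF i t t1) (is_derive_cst (F i 0) t 1); rewrite subr0.
  rewrite (_ : F i - cst _ = (fun s => (\row_i0 (F i0 s - F i0 0) : 'rV[R]_m) ord0 i))//.
  by apply: funext => s; rewrite mxE.
pose cl (t : R) := Num.max 0 (Num.min d t).
have cl0 t : 0 <= cl t by rewrite /cl le_max lexx.
have cld t : cl t <= d by rewrite /cl ge_max (ltW d0) ge_min lexx.
have clid t : 0 <= t <= d -> cl t = t.
  by move=> /andP[t0 td]; rewrite /cl min_r// max_r.
have clL t t' : t' <= t -> `|cl t - cl t'| <= t - t'.
  move=> tt; rewrite /cl; case: (leP d t); case: (leP d t'); rewrite /Num.max;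
    repeat case: ifP => ?; move=> *; rewrite ler_norml; apply/andP; split; lra.
have PhL v : X v -> forall a b, 0 <= a -> a <= b -> b <= d ->
    `|Phi v b - Phi v a| <= Ga * (b - a).
  move=> Xv a b a0 ab bd; have [_ dPh] := hPhi v Xv.
  apply: (@deriv_boundV R m (Phi v) (fun t => G (v t))) => // t.
    by move=> i /andP[ta tb]; apply: dPh; lra.
  by move=> _; apply: GB; case: Xv.
pose T v t := s0 + Phi v (cl t).
have XT v : X v -> X (T v).
  move=> Xv; split.
    move=> t t'; wlog tt : t t' / t' <= t.
      move=> H; have [|/ltW] := leP t' t; first exact: H.
      by move=> h; rewrite distrC (distrC t); exact: H.
    rewrite /T opprD addrACA subrr add0r (ger0_norm (_ : 0 <= t - t')) ?subr_ge0//.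
    have ctt : cl t' <= cl t.
      by rewrite /cl; apply: le_max2 => //; apply: le_min2.
    apply: le_trans (PhL v Xv _ _ (cl0 t') ctt (cld t)) _; apply: ler_wpM2l => //.
    by apply: le_trans (ler_norm _) _; exact: clL.
  move=> t; rewrite /T addrAC subrr add0r.
  have := PhL v Xv 0 (cl t) (lexx _) (cl0 t) (cld t); have [-> _] := hPhi v Xv.
  rewrite !subr0 => /le_trans; apply; apply: le_trans dG; rewrite mulrC.
  by apply: ler_wpM2r.
have TC v w e : X v -> X w -> (forall t, `|v t - w t| <= e) -> forall t, `|T v t - T w t| <= e / 2.
  move=> Xv Xw vw t; rewrite /T opprD addrACA subrr add0r.
  have e0 : 0 <= e by apply: le_trans (vw 0).
  have [P1 dP1] := hPhi v Xv; have [P2 dP2] := hPhi w Xw.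
  have := @deriv_boundV R m (fun t => Phi v t - Phi w t) (fun t => G (v t) - G (w t)) 0 (cl t) (Lc * e) (cl0 t).
  rewrite P1 P2 subrr !subr0 => H.
  apply: le_trans (H _ _) _.
  - move=> u i /andP[u0 ud]; have u1 : -1 < u by lra.
    have := is_deriveB (dP1 u i u1) (dP2 u i u1); rewrite [X in _ -> is_derive _ _ _ X]mxE [in X in _ -> is_derive _ _ _ X]mxE.
    rewrite (_ : _ - _ = (fun s => (Phi v s - Phi w s) ord0 i))//.
    by apply: funext => s; rewrite !mxE.
  - move=> u _; have [_ Xv2] := Xv; have [_ Xw2] := Xw.
    by apply: le_trans (GL _ _ (Xv2 u) (Xw2 u)) _; apply: ler_wpM2l.
  rewrite mulrAC; apply: (@le_trans _ _ (Lc * d * e)).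
    by apply: ler_wpM2r => //; apply: ler_wpM2l.
  by apply: le_trans (ler_wpM2r e0 dL) _; move: e0; clear; lra.
pose v k := iter k T (fun=> s0).
have Xv k : X (v k).
  elim: k => [|k ih]; last exact: XT.
  by split => *; rewrite subrr normr0 ?mulr_ge0// ltW.
have vS k t : `|v k.+1 t - v k t| <= r / 2 ^+ k.
  elim: k t => [|k ih] t; first by rewrite expr0 divr1; case: (Xv 1%N).
  rewrite (_ : r / 2 ^+ k.+1 = r / 2 ^+ k / 2); last by rewrite exprS invfM mulrCA mulrC.
  exact: (TC (v k.+1) (v k) _ (Xv _) (Xv _) ih).
have /choice[w hw] : forall t : R, exists w : 'rV[R]_m, forall k, `|v k t - w| <= 2 * r / 2 ^+ k.
  move=> t; have /choice[l hl] : forall i : 'I_m, exists l : R, forall k, `|v k t ord0 i - l| <= 2 * r / 2 ^+ k.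
    move=> i; apply: geometric_limit => k; have := le_trans (coord_le_norm _ i) (vS k t).
    by rewrite !mxE.
  exists (\row_i l i) => k; apply: norm_le_coord.
    by rewrite divr_ge0 ?mulr_ge0 ?exprn_ge0// ltW.
  by move=> i; rewrite !mxE; exact: hl.
have small M (x y : 'rV[R]_m) (z : R) : (forall k, `|x - y| <= z + M / 2 ^+ k) -> `|x - y| <= z.
  by move=> h; apply/ler_addgt0Pr => e e0; have [k hk] := geometric_small M e0; apply: le_trans (h k) _; rewrite lerD2l.
have Xw : X w.
  split.
    move=> t t'; apply: (small (4 * r)) => k.
    have -> : w t - w t' = (v k t - v k t') - (v k t - w t) + (v k t' - w t').
      by apply/rowP => i; rewrite !mxE; ring.
    apply: le_trans (ler_normD _ _) _.
    have := ler_normB (v k t - v k t') (v k t - w t).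
    have [h1 _] := Xv k; have := h1 t t'; have := hw t k; have := hw t' k.
    rewrite -!mulrA; move: (r / 2 ^+ k) => z; clear; lra.
  move=> t; apply: (small (2 * r)) => k.
  have -> : w t - s0 = (v k t - s0) - (v k t - w t) by apply/rowP => i; rewrite !mxE; ring.
  apply: le_trans (ler_normB _ _) _; have [_ h1] := Xv k; have := h1 t; have := hw t k; clear; lra.
have Tw t : T w t = w t.
  apply/eqP; rewrite -subr_eq0 -normr_le0; apply: (small (2 * r)) => k; rewrite add0r.
  have -> : T w t - w t = (v k.+1 t - w t) - (v k.+1 t - T w t).
    by rewrite opprB [RHS]addrC addrA subrK.
  apply: le_trans (ler_normB _ _) _.
  have h1 := hw t k.+1; have h2 := TC (v k) w _ (Xv k) Xw (fun t => hw t k) t.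
  apply: le_trans (lerD h1 h2) _; rewrite exprS invfM; move: (2 ^+ k)^-1 => z.
  by rewrite le_eqVlt; apply/orP; left; apply/eqP; field.
have [P0 dP] := hPhi w Xw.
(* Not [w] itself: clamping makes it constant outside [0, d], whereas [Phi w] has two-sided
   derivatives at 0 and d and agrees with w - s0 in between. *)
exists (fun t => s0 + Phi w t); split; first by rewrite P0 addr0.
move=> t /andP[t0 td].
have wt : s0 + Phi w t = w t by rewrite -[RHS]Tw /T clid// t0.
rewrite wt; split; first by case: Xw.
move=> i; have t1 : -1 < t by move: t0; clear; lra.
have := is_deriveD (is_derive_cst (s0 ord0 i) t 1) (dP t i t1); rewrite add0r.
rewrite (_ : cst _ + _ = (fun s => (s0 + Phi w s) ord0 i))//.
by apply: funext => s; rewrite !mxE.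
Qed.

(** * Structure and prolongation of hybrid time domains *)

Lemma htd_corner (R : realType) (E : set (R * nat)) (T : R) (J : nat) :
  htd E -> E (T, J) -> exists (K : nat) (tt : nat -> R),
  [/\ tt 0%N = 0, (forall i, (i < K)%N -> tt i <= tt i.+1), (J < K)%N,
      tt J <= T <= tt J.+1 &
      forall u i, (E (u, i) /\ u <= T /\ (i <= J)%N) <-> ((i < K)%N /\ tt i <= u <= tt i.+1)].
Proof.
move=> [_ hE] ETJ; have [K [tt [tt0 [ttm EK]]]] := hE _ _ ETJ.
have iffE u i : (E (u, i) /\ u <= T /\ (i <= J)%N) <-> ((i < K)%N /\ tt i <= u <= tt i.+1).
  split=> [[h1 [h2 h3]]|[h1 /andP[h2 h3]]].
    have : (E `&` [set p | p.1 <= T /\ (p.2 <= J)%N]) (u, i) by [].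
    by rewrite EK => -[/= ? [-> ->]].
  have : (E `&` [set p | p.1 <= T /\ (p.2 <= J)%N]) (u, i) by rewrite EK.
  by case=> ? [].
have [JK TJ] : (J < K)%N /\ tt J <= T <= tt J.+1 by apply/iffE; rewrite lexx leqnn.
by exists K, tt.
Qed.

Lemma htd_interval (R : realType) (E : set (R * nat)) w t u i :
  htd E -> E (w, i) -> E (u, i) -> w <= t <= u -> E (t, i).
Proof.
move=> hE Ew Eu /andP[wt tu]; have [K [tt [_ _ iK _ h]]] := htd_corner hE Eu.
have [_ /andP[h1 _]] : (i < K)%N /\ tt i <= w <= tt i.+1.
  by apply/h; rewrite leqnn; split => //; split => //; exact: le_trans wt tu.
have [_ /andP[_ h2]] : (i < K)%N /\ tt i <= u <= tt i.+1 by apply/h; rewrite lexx leqnn.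
have [] : E (t, i) /\ t <= u /\ (i <= i)%N; last by [].
by apply/h; split => //; rewrite (le_trans h1 wt) (le_trans tu h2).
Qed.

Lemma htd_start (R : realType) (E : set (R * nat)) v J : htd E -> E (v, J) ->
  exists2 tJ, E (tJ, J) & forall t, E (t, J) -> tJ <= t.
Proof.
move=> hE Ev; have [K [tt [_ ttm JK /andP[h1 h2] h]]] := htd_corner hE Ev.
have [EJ _] : E (tt J, J) /\ tt J <= v /\ (J <= J)%N by apply/h; split => //; rewrite lexx ttm.
exists (tt J) => // t Et; have [tv|/ltW vt] := leP t v; last exact: le_trans h1 vt.
have [_ /andP[-> //]] : (J < K)%N /\ tt J <= t <= tt J.+1 by apply/h; rewrite leqnn.
Qed.

Lemma htd_jump_before (R : realType) (E : set (R * nat)) v l i : htd E -> E (v, l) -> (i < l)%N ->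
  exists w, [/\ w <= v, E (w, i) & E (w, i.+1)].
Proof.
move=> hE Ev il; have [K [tt [_ ttm lK /andP[h1 h2] h]]] := htd_corner hE Ev.
have mono j k : (j + k <= K)%N -> tt j <= tt (j + k)%N.
  elim: k => [|k ih]; rewrite ?addn0// addnS => jk.
  by apply: le_trans (ih (ltnW jk)) _; exact: ttm.
have iv : tt i.+1 <= v.
  by apply: le_trans h1; rewrite -(subnKC il); apply: mono; rewrite subnKC// ltnW.
exists (tt i.+1); split => //.
  have [] : E (tt i.+1, i) /\ tt i.+1 <= v /\ (i <= l)%N; last by [].
  have iK : (i < K)%N by exact: ltn_trans lK.
  by apply/h; split => //; rewrite lexx ttm.
have [] : E (tt i.+1, i.+1) /\ tt i.+1 <= v /\ (i.+1 <= l)%N; last by [].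
have iK : (i.+1 < K)%N by exact: leq_ltn_trans il lK.
by apply/h; split => //; rewrite lexx ttm.
Qed.

Lemma interior_itv_strict (R : realType) (a b t : R) (A : set R) :
  (forall u, A u -> a <= u <= b) -> A° t -> a < t < b.
Proof.
move=> hA; rewrite /interior /= => /nbhs_ballP[d /= d0 hd].
have h1 : A (t - d / 2).
  by apply: hd; rewrite /ball /= opprB addrC subrK ger0_norm; lra.
have h2 : A (t + d / 2).
  by apply: hd; rewrite /ball /= opprD addrA subrr sub0r normrN ger0_norm; lra.
have := hA _ h1; have := hA _ h2; lra.
Qed.

Section Extension.
Context {R : realType} {m : nat}.
Local Notation V := 'rV[R]_m.
Variables (C D : set V) (F G : V -> V) (E : set (R * nat)) (x : R -> nat -> V) (J : nat).
Local Notation H := (HSys (fun=> C) (fun=> F) (fun=> D) (fun=> G)).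
Hypothesis xs : is_solution H E x.
Hypothesis Jmax : forall t j, E (t, j) -> (j <= J)%N.

(** Prolongs the last flow interval. [before] says that no earlier interval reaches beyond [tJ],
    which is what makes the truncations of the new domain compact hybrid time domains. *)
Lemma extend_flow (tJ T : R) (y : R -> V) :
  E (tJ, J) -> (forall t, E (t, J) -> tJ <= t <= T) ->
  (forall u i, E (u, i) -> (i < J)%N -> u <= tJ) ->
  (forall t, E (t, J) -> y t = x t J) ->
  (forall t, tJ < t < T -> C (y t)) ->
  (forall i, abs_cont_on (fun t => y t ord0 i) tJ T) ->
  {ae (@lebesgue_measure R), forall t, tJ < t < T ->
     forall i, is_derive t 1 (fun s => y s ord0 i) (F (y t) ord0 i)} ->
  is_solution H (E `|` [set p | p.2 = J /\ tJ <= p.1 <= T])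
    (fun t j => if j == J then y t else x t j).
Proof.
move=> EtJ EJ before yx Cy acy dy.
have [hE [E00 [x0 [xflow xjump]]]] := xs.
set E' := E `|` _.
have E'J t : E' (t, J) <-> tJ <= t <= T.
  by split=> [[/EJ//|[/= _]]//|h]; right.
have E'j t j : j != J -> E' (t, j) <-> E (t, j).
  by move=> /eqP jJ; split=> [[//|[]]//|]; left.
have x'E t j : E (t, j) -> (if j == J then y t else x t j) = x t j.
  by case: eqP => // -> /yx.
have [K [tt [tt0 ttm JK /andP[h1 h2] h]]] := htd_corner hE EtJ.
have ttJ : tt J = tJ.
  apply/eqP; rewrite eq_le h1 /=.
  have [/EJ/andP[]//] : E (tt J, J) /\ tt J <= tJ /\ (J <= J)%N.
  by apply/h; split => //; rewrite lexx ttm.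
have tJ0 : 0 <= tJ by case: hE => h0 _; exact: (h0 (tJ, J)).
split.
  split.
    move=> [t j] [Etj|[/= _ /andP[ht _]]] /=; last exact: le_trans ht.
    by case: hE => h0 _; exact: (h0 (t, j)).
  move=> t j Etj; have [jJ|jJ] := eqVneq j J; last first.
    have {}Etj : E (t, j) by apply/E'j.
    have jJ' : (j < J)%N by rewrite ltn_neqAle jJ (Jmax Etj).
    case: hE => _ /(_ t j Etj); rewrite (_ : E `&` _ = E' `&` [set p | p.1 <= t /\ (p.2 <= j)%N])//.
    apply/seteqP; split => [[u i]|[u i]] [] /= Eui [ut ij]; (split; last by []); first by left.
    by apply/E'j => //; rewrite neq_ltn (leq_ltn_trans ij jJ').
  move: Etj; rewrite jJ => /E'J/andP[tJt tT].
  (* The old switching times up to index J, then [t] as the end of the last interval. *)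
  exists J.+1, (fun i => if (i <= J)%N then tt i else t); split; first by rewrite leq0n.
  split.
    move=> i iJ; rewrite ltnS in iJ; rewrite iJ; case: ltnP => iJ'; first by apply: ttm; exact: leq_ltn_trans JK.
    by have -> : i = J; [apply/eqP; rewrite eqn_leq iJ|rewrite ttJ].
  apply/seteqP; split => [[u i] [Eui [/= ut iJ]]|[u i] [/= iJ [hu1 hu2]]].
    rewrite ltnS; split => //; rewrite iJ.
    have [iEJ|iJ'] := eqVneq i J.
      by rewrite iEJ ltnn ttJ; move: Eui; rewrite iEJ => /E'J/andP[].
    have {}iJ' : (i < J)%N by rewrite ltn_neqAle iJ'.
    have {}Eui : E (u, i) by apply/E'j => //; rewrite neq_ltn iJ'.
    rewrite iJ'; have [_ /andP[]//] : (i < K)%N /\ tt i <= u <= tt i.+1.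
    by apply/h; split => //; split => //; exact: before Eui iJ'.
  rewrite ltnS in iJ; rewrite iJ in hu1; have [iEJ|iJ'] := eqVneq i J.
    rewrite iEJ ltnn in hu2; rewrite iEJ ttJ in hu1.
    split; last by rewrite iEJ.
    by rewrite iEJ; apply/E'J; rewrite hu1 (le_trans hu2 tT).
  have {}iJ' : (i < J)%N by rewrite ltn_neqAle iJ'.
  rewrite iJ' in hu2.
  have [Eui [utJ _]] : E (u, i) /\ u <= tJ /\ (i <= J)%N.
    by apply/h; rewrite hu1 hu2; split => //; exact: ltn_trans JK.
  by split; [left|split => //; exact: le_trans tJt].
split; first by left.
split; first by rewrite x'E.
split.
  move=> j [t0 ht0]; have [jJ|jJ] := eqVneq j J; last first.
    have IE : Ij E' j = Ij E j by apply/seteqP; split=> t /=; rewrite /Ij /= E'j.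
    by rewrite IE in ht0 *; apply: xflow; exists t0.
  have IE t : Ij E' J t -> tJ <= t <= T by move/E'J.
  rewrite jJ; split.
    by move=> t /(interior_itv_strict IE) /Cy.
  split.
    move=> a b /IE/andP[a1 a2] /IE/andP[b1 b2] i.
    exact: ac_sub a1 b2 (acy i).
  by have := ae_closed_interval dy; apply: ae_imply => t + /IE; apply.
move=> t j Etj Etj1.
have jJ : j != J.
  apply/eqP => jJ; move: Etj1; rewrite jJ => /(proj1 (E'j _ _ _)); rewrite neq_ltn ltnSn orbT.
  by move=> /(_ isT)/Jmax; rewrite ltnn.
have {}Etj : E (t, j) by apply/E'j.
have {}Etj1 : E (t, j.+1).
  have [jJ1|jJ1] := eqVneq j.+1 J; last by apply/E'j.
  rewrite jJ1 in Etj1 *; have /andP[t1 _] := (E'J t).1 Etj1.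
  have t2 : t <= tJ by apply: before Etj _; rewrite -jJ1.
  by have -> : t = tJ by apply/eqP; rewrite eq_le t1 t2.
rewrite (x'E _ _ Etj) (x'E _ _ Etj1); exact: xjump.
Qed.

Lemma extend_jump (T : R) :
  E (T, J) -> (forall t, E (t, J) -> t <= T) ->
  (forall u i, E (u, i) -> (i < J)%N -> u <= T) -> D (x T J) ->
  is_solution H (E `|` [set (T, J.+1)]) (fun t j => if j == J.+1 then G (x T J) else x t j).
Proof.
move=> ETJ EJ before Dx.
have [hE [E00 [x0 [xflow xjump]]]] := xs.
set E' := E `|` _.
have E'J t : E' (t, J.+1) <-> t = T.
  split=> [[/Jmax|[->]]//|->]; last by right.
  by rewrite ltnn.
have E'j t j : j != J.+1 -> E' (t, j) <-> E (t, j).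
  by move=> /eqP jJ; split=> [[//|[_ /jJ]]//|]; left.
have x'E t j : E (t, j) -> (if j == J.+1 then G (x T J) else x t j) = x t j.
  by case: eqP => // -> /Jmax; rewrite ltnn.
have [K [tt [tt0 ttm JK /andP[h1 h2] h]]] := htd_corner hE ETJ.
split.
  split.
    move=> [t j] [Etj|[-> ->]] /=; first by case: hE => h0 _; exact: (h0 (t, j)).
    by case: hE => h0 _; exact: (h0 (T, J)).
  move=> t j Etj; have [jJ|jJ] := eqVneq j J.+1; last first.
    have {}Etj : E (t, j) by apply/E'j.
    have jJ' : (j < J.+1)%N by rewrite ltnS (Jmax Etj).
    case: hE => _ /(_ t j Etj); rewrite (_ : E `&` _ = E' `&` [set p | p.1 <= t /\ (p.2 <= j)%N])//.
    apply/seteqP; split => [[u i]|[u i]] [] /= Eui [ut ij]; (split; last by []); first by left.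
    by apply/E'j => //; rewrite neq_ltn (leq_ltn_trans ij jJ').
  move: Etj; rewrite jJ => /E'J ->.
  (* The interval of index J + 1 is the single point T, hence two final switching times equal to
     T. *)
  exists J.+2, (fun i => if (i <= J)%N then tt i else T); split; first by rewrite leq0n.
  split.
    move=> i iJ; case: (leqP i J) => iJ1; last by rewrite ltnNge (ltnW iJ1).
    case: ltnP => iJ'; first by apply: ttm; exact: ltn_trans JK.
    by have -> : i = J by apply/eqP; rewrite eqn_leq iJ1.
  have inE u i : (i <= J)%N -> u <= T -> E (u, i) -> (i < K)%N /\ tt i <= u <= tt i.+1.
    by move=> iJ uT Eui; apply/h.
  apply/seteqP; split => [[u i] [Eui [/= ut iJ]]|[u i] [/= iJ [hu1 hu2]]].
    split => //; have [iEJ|iJ1] := eqVneq i J.+1.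
      by move: Eui; rewrite iEJ => /E'J ->; rewrite ltnn leqNgt ltnW.
    have {}iJ1 : (i <= J)%N by rewrite -ltnS ltn_neqAle iJ1.
    have {}Eui : E (u, i) by apply/E'j => //; rewrite neq_ltn ltnS iJ1.
    have [_ /andP[a1 a2]] := inE _ _ iJ1 ut Eui.
    by rewrite iJ1 a1; split => //; case: ifP.
  have [iEJ|iJ1] := eqVneq i J.+1.
    rewrite iEJ ltnn in hu1; rewrite iEJ leqNgt (ltnW (ltnSn _)) /= in hu2.
    have uT : u = T by apply/eqP; rewrite eq_le hu1 hu2.
    by rewrite iEJ uT; split; [apply/E'J|split].
  have {}iJ1 : (i <= J)%N by rewrite -ltnS ltn_neqAle iJ1.
  rewrite iJ1 in hu1.
  have [Eui [uT _]] : E (u, i) /\ u <= T /\ (i <= J)%N.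
    apply/h; split; first exact: leq_ltn_trans JK.
    rewrite hu1; move: hu2; case: ltnP => // iJ2 uT.
    have -> : i = J by apply/eqP; rewrite eqn_leq iJ1.
    exact: le_trans uT h2.
  by split; [left|split => //; exact: leqW].
split; first by left.
split; first exact: x0.
split.
  move=> j [t0 ht0]; have [jJ|jJ] := eqVneq j J.+1; last first.
    have IE : Ij E' j = Ij E j by apply/seteqP; split=> t /=; rewrite /Ij /= E'j.
    by rewrite IE in ht0 *; apply: xflow; exists t0.
  have IE t : Ij E' J.+1 t -> T <= t <= T by move/E'J => ->; rewrite lexx.
  (* A one-point interval has empty interior, so its flow conditions are vacuous. *)
  rewrite jJ in ht0; have /andP[a1 a2] := interior_itv_strict IE ht0.
  by have := lt_trans a1 a2; rewrite ltxx.
move=> t j Etj Etj1.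
have jJ : j != J.+1.
  apply/eqP => jJ; move: Etj1; rewrite jJ => /(proj1 (E'j _ _ _)); rewrite neq_ltn ltnSn orbT.
  by move=> /(_ isT)/Jmax; rewrite ltnNge leqnSn.
have {}Etj : E (t, j) by apply/E'j.
rewrite (x'E _ _ Etj); have [[jJ1]|jJ1] := eqVneq j.+1 J.+1.
  by rewrite jJ1 in Etj1 *; have -> := (E'J t).1 Etj1.
exact: xjump Etj ((E'j _ _ jJ1).1 Etj1).
Qed.

End Extension.

Section ContinueFlow.
Context {R : realType} {m : nat}.
Local Notation V := 'rV[R]_m.
Variables (C D : set V) (F G : V -> V) (E : set (R * nat)) (x : R -> nat -> V) (J : nat).
Local Notation H := (HSys (fun=> C) (fun=> F) (fun=> D) (fun=> G)).

(** Covers both prolongations by flow: [T' = T] adds a missing right end with value [w T], and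
    [T < T'] appends an actual flow. A common Lipschitz constant on the two pieces makes the glued
    curve absolutely continuous across T. *)
Lemma continue_flow (tJ T T' K : R) (w : R -> V) :
  is_solution H E x -> (forall t j, E (t, j) -> (j <= J)%N) ->
  E (tJ, J) -> (forall t, E (t, J) -> tJ <= t <= T) -> (forall t, tJ <= t < T -> E (t, J)) ->
  (forall u i, E (u, i) -> (i < J)%N -> u <= tJ) ->
  (forall t, E (t, J) -> C (x t J)) ->
  (forall a b, E (a, J) -> E (b, J) -> a <= b -> `|x b J - x a J| <= K * (b - a)) ->
  T <= T' -> 0 <= K ->
  (E (T, J) -> w T = x T J) ->
  (forall t, tJ <= t < T -> `|x t J - w T| <= K * (T - t)) ->
  (forall a b, T <= a -> a <= b -> b <= T' -> `|w b - w a| <= K * (b - a)) ->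
  (forall t, T <= t < T' -> C (w t)) ->
  (forall t, T < t < T' -> forall i, is_derive t 1 (fun s => w s ord0 i) (F (w t) ord0 i)) ->
  exists2 x', is_solution H (E `|` [set p | p.2 = J /\ tJ <= p.1 <= T']) x' &
    forall p, E p -> x' p.1 p.2 = x p.1 p.2.
Proof.
move=> xs Jmax EtJ EJ EtT before xC xK TT' K0 wT xw wK wC dw.
pose y t := if t < T then x t J else w t.
have yx t : E (t, J) -> y t = x t J.
  move=> Et; rewrite /y; case: ltP => // Tt; have /andP[_ tT] := EJ t Et.
  have tE : t = T by apply/eqP; rewrite eq_le tT.
  by rewrite tE in Et *; exact: wT.
have tJT : tJ <= T by have /andP[] := EJ _ EtJ.
have yK a b : tJ <= a -> a <= b -> b <= T' -> `|y b - y a| <= K * (b - a).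
  move=> Ja ab bT; rewrite /y; case: (ltP a T) => aT; case: (ltP b T) => bT'.
  - by apply: xK => //; apply: EtT; rewrite ?aT ?bT' ?Ja ?(le_trans Ja ab).
  - have h1 : `|x a J - w T| <= K * (T - a) by apply: xw; rewrite Ja.
    have h2 := wK T b (lexx _) bT' bT.
    have -> : w b - x a J = (w b - w T) - (x a J - w T) by rewrite opprB addrA subrK.
    apply: le_trans (ler_normB _ _) _; apply: le_trans (lerD h2 h1) _.
    by rewrite -mulrDr le_eqVlt; apply/orP; left; apply/eqP; ring.
  - by have := lt_le_trans bT' aT; rewrite ltNge ab.
  - exact: wK.
have yJ t : t < T -> \forall s \near t, x s J = y s.
  move=> tT; have : nbhs t `]-oo, T[%classic.
    by apply: open_nbhs_nbhs; split; [exact: interval_open|rewrite /= in_itv].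
  by apply: filterS => s; rewrite /= in_itv/= /y => ->.
have yw t : T < t -> \forall s \near t, w s = y s.
  move=> tT; have : nbhs t `]T, +oo[%classic.
    by apply: open_nbhs_nbhs; split; [exact: interval_open|rewrite /= in_itv/= andbT].
  by apply: filterS => s; rewrite /= in_itv/= andbT /y => Ts; rewrite ltNge (ltW Ts).
have EJ' t : E (t, J) -> tJ <= t <= T'.
  by move=> /EJ/andP[-> tT]; exact: le_trans TT'.
have yC t : tJ < t < T' -> C (y t).
  move=> /andP[t1 t2]; rewrite /y; case: ltP => tT; last by apply: wC; rewrite tT.
  by apply: xC; apply: EtT; rewrite tT ltW.
have acy i : abs_cont_on (fun t => y t ord0 i) tJ T'.
  apply: (@ac_lipschitz _ _ K) => a b Ja ab bT.
  by have := le_trans (coord_le_norm _ i) (yK a b Ja ab bT); rewrite !mxE.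
have dy : {ae (@lebesgue_measure R), forall t, tJ < t < T' ->
     forall i, is_derive t 1 (fun s => y s ord0 i) (F (y t) ord0 i)}.
  have dw' t : T < t < T' -> forall i, is_derive t 1 (fun s => y s ord0 i) (F (y t) ord0 i).
    move=> tT i; have /andP[Tt _] := tT.
    have -> : F (y t) ord0 i = F (w t) ord0 i by rewrite /y ltNge (ltW Tt).
    apply: near_eq_is_derive (dw t tT i).
    by have := yw t Tt; apply: filterS => s ->.
  have ae1 : {ae (@lebesgue_measure R), forall t, tJ < t < T ->
     forall i, is_derive t 1 (fun s => y s ord0 i) (F (y t) ord0 i)}.
    have [JT|TJ] := ltP tJ T; last first.
      by apply/aeW => t /andP[t1 t2]; have := lt_le_trans (lt_trans t1 t2) TJ; rewrite ltxx.
    have [_ [_ [_ [xflow _]]]] := xs.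
    have [|_ [_ h]] := xflow J.
      exists ((tJ + T) / 2); apply: (@interior_segment _ _ _ tJ ((tJ + 3 * T) / 4)); last by lra.
      by move=> u /andP[u1 u2]; apply: EtT; rewrite u1 /=; lra.
    move: h; apply: ae_imply => t h /andP[t1 t2] i.
    have -> : F (y t) ord0 i = F (x t J) ord0 i by rewrite /y t2.
    apply: near_eq_is_derive (h _ i); last by apply: EtT; rewrite t2 ltW.
    by have := yJ t t2; apply: filterS => s ->.
  have := ae_closed_interval ae1; apply: ae_imply => t h /andP[t1 t2] i.
  have [tT|Tt] := leP t T; first by apply: h; rewrite tT ltW.
  by apply: dw'; rewrite Tt.
exists (fun t j => if j == J then y t else x t j).
  exact: (extend_flow xs Jmax EtJ EJ' before yx yC acy dy).
by move=> [t j] Etj /=; case: eqP => // jJ; rewrite jJ in Etj *; exact: yx.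
Qed.

End ContinueFlow.

(** In each coordinate x_i(t) - K (T - t) is non-decreasing and x_i(t) + K (T - t) non-increasing;
    the supremum of the former is the limit, with the required rate. *)
Lemma lipschitz_left_limit (R : realType) (m : nat) (x : R -> 'rV[R]_m) (a T K : R) :
  a < T -> (forall t t', a <= t -> t <= t' -> t' < T -> `|x t' - x t| <= K * (t' - t)) ->
  exists l, forall t, a <= t < T -> `|x t - l| <= K * (T - t).
Proof.
move=> aT xK.
have K0 : 0 <= K.
  have := xK a ((a + T) / 2) ltac:(lra) ltac:(lra) ltac:(lra) => /(le_trans (normr_ge0 _)) h.
  have : 0 < (a + T) / 2 - a by lra.
  by move=> /pmulr_lge0 <-.
have /choice[l hl] : forall i : 'I_m, exists l : R, forall t, a <= t < T ->
    `|x t ord0 i - l| <= K * (T - t).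
  move=> i; pose A := [set x t ord0 i - K * (T - t) | t in [set t | a <= t < T]].
  have le t t' : a <= t < T -> a <= t' < T ->
      x t' ord0 i - K * (T - t') <= x t ord0 i + K * (T - t).
    move=> /andP[t1 t2] /andP[t3 t4].
    have [tt|/ltW tt] := leP t t'.
      have := le_trans (coord_le_norm _ i) (xK _ _ t1 tt t4); rewrite !mxE ler_norml => /andP[_ h].
      have : 0 <= K * (T - t') by rewrite mulr_ge0// subr_ge0 ltW.
      lra.
    have := le_trans (coord_le_norm _ i) (xK _ _ t3 tt t2); rewrite !mxE ler_norml => /andP[h _].
    have : 0 <= K * (T - t) by rewrite mulr_ge0// subr_ge0 ltW.
    lra.
  exists (sup A) => t ht.
  have ub : has_ubound A.
    by exists (x a ord0 i + K * (T - a)) => _ [t' ht' <-]; apply: le => //=; rewrite lexx.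
  have h1 : x t ord0 i - K * (T - t) <= sup A by apply: ub_le_sup => //; exists t.
  have h2 : sup A <= x t ord0 i + K * (T - t).
    apply: ge_sup; first by exists (x t ord0 i - K * (T - t)), t.
    by move=> _ [t' ht' <-]; exact: le.
  by rewrite ler_norml; lra.
exists (\row_i l i) => t ht; apply: norm_le_coord.
  by rewrite mulr_ge0// subr_ge0 ltW//; case/andP: ht.
by move=> i; rewrite !mxE; exact: hl.
Qed.

(** Boundedness is paired with the Lipschitz property because together they are stable under
    products, from which the coordinates of the flow map are built. *)
Definition lip_on (R : realType) (m : nat) (P : set 'rV[R]_m) (f : 'rV[R]_m -> R) :=
  (exists2 B, 0 <= B & forall s, P s -> `|f s| <= B) /\
  exists2 K, 0 <= K & forall s s', P s -> P s' -> `|f s - f s'| <= K * `|s - s'|.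

Lemma lip_onM (R : realType) (m : nat) (P : set 'rV[R]_m) f g :
  lip_on P f -> lip_on P g -> lip_on P (fun s => f s * g s).
Proof.
move=> [[Bf Bf0 fB] [Kf Kf0 fK]] [[Bg Bg0 gB] [Kg Kg0 gK]]; split.
  exists (Bf * Bg); first exact: mulr_ge0.
  by move=> s Ps; rewrite normrM; apply: ler_pM => //; [exact: fB|exact: gB].
exists (Bf * Kg + Bg * Kf); first by rewrite addr_ge0// mulr_ge0.
move=> s s' Ps Ps'.
have -> : f s * g s - f s' * g s' = f s * (g s - g s') + g s' * (f s - f s') by ring.
apply: le_trans (ler_normD _ _) _; rewrite !normrM mulrDl -!mulrA.
by apply: lerD; apply: ler_pM => //; [exact: fB|exact: gK|exact: gB|exact: fK].
Qed.

Lemma lip_on_cst (R : realType) (m : nat) (P : set 'rV[R]_m) c : lip_on P (fun=> c).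
Proof.
split; first by exists `|c|.
by exists 0 => // s s' _ _; rewrite subrr normr0 mul0r.
Qed.

Lemma lip_onB (R : realType) (m : nat) (P : set 'rV[R]_m) f g :
  lip_on P f -> lip_on P g -> lip_on P (fun s => f s - g s).
Proof.
move=> [[Bf Bf0 fB] [Kf Kf0 fK]] [[Bg Bg0 gB] [Kg Kg0 gK]]; split.
  exists (Bf + Bg); first exact: addr_ge0.
  by move=> s Ps; apply: le_trans (ler_normB _ _) _; apply: lerD; [exact: fB|exact: gB].
exists (Kf + Kg); first exact: addr_ge0.
move=> s s' Ps Ps'.
have -> : f s - g s - (f s' - g s') = (f s - f s') - (g s - g s') by ring.
by apply: le_trans (ler_normB _ _) _; rewrite mulrDl; apply: lerD; [exact: fK|exact: gK].
Qed.

Lemma lip_on_rV (R : realType) (m : nat) (P : set 'rV[R]_m) (F : 'rV[R]_m -> 'rV[R]_m) :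
  (forall i, lip_on P (fun s => F s ord0 i)) ->
  exists2 K, 0 <= K & forall s s', P s -> P s' -> `|F s - F s'| <= K * `|s - s'|.
Proof.
move=> h.
have /choice[K hK] : forall i : 'I_m, exists K, 0 <= K /\ forall s s', P s -> P s' ->
    `|F s ord0 i - F s' ord0 i| <= K * `|s - s'|.
  by move=> i; have [_ [K K0 ?]] := h i; exists K.
exists (\sum_i K i); first by apply: sumr_ge0 => i _; case: (hK i).
move=> s s' Ps Ps'; apply: le_trans (norm_le_sum _) _; rewrite mulr_suml.
by apply: ler_sum => i _; rewrite !mxE; apply: (hK i).2.
Qed.

(** The radius Tmin / 2 keeps tau away from the singularity of 2 / tau. *)
Lemma flow_lip (R : realType) (n : nat) (phi : 'rV[R]_n -> R) (g : 'rV[R]_n -> 'rV[R]_n)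
    (L : R) (zs : 'rV[R]_n) (kappa : nat -> rat) (k Tmin a eps : R) (s0 : 'rV[R]_(4 * n).+1) :
  is_gradient phi g -> 0 < L -> (forall x y, enorm (g x - g y) <= L * enorm (x - y)) ->
  (forall z, phi zs <= phi z) -> 0 < Tmin -> Tmin <= tau_of s0 ->
  exists2 K, 0 <= K & forall s s', `|s - s0| <= Tmin / 2 -> `|s' - s0| <= Tmin / 2 ->
    `|flow_map kappa k phi a eps s - flow_map kappa k phi a eps s'| <= K * `|s - s'|.
Proof.
move=> grad L0 g_lip zs_min Tmin0 tau0.
pose P := [set s : 'rV[R]_(4 * n).+1 | `|s - s0| <= Tmin / 2].
pose B := `|s0| + Tmin / 2.
have PB s : P s -> `|s| <= B.
  by move=> Ps; rewrite -[s](subrK s0) addrC; apply: le_trans (ler_normD _ _) _; rewrite lerD2l.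
have B0 : 0 <= B by apply: addr_ge0 => //; rewrite divr_ge0// ltW.
have Pst q : lip_on P (fun s => st s q).
  split; first by exists B => // s /PB; apply: le_trans; exact: st_norm.
  by exists 1 => // s s' _ _; rewrite mul1r -stB st_norm.
have tauP s : P s -> Tmin / 2 <= tau_of s.
  move=> Ps; have := le_trans (st_norm (s - s0) (4 * n)) Ps; rewrite stB ler_norml => /andP[+ _].
  move: tau0; rewrite /tau_of; lra.
have Pinv : lip_on P (fun s => (tau_of s)^-1).
  have T20 : 0 < Tmin / 2 by rewrite divr_gt0.
  have tau_gt0 s : P s -> 0 < tau_of s by move/tauP; apply: lt_le_trans.
  have invB s : P s -> `|(tau_of s)^-1| <= (Tmin / 2)^-1.
    move=> Ps; rewrite ger0_norm; last by rewrite invr_ge0 ltW// tau_gt0.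
    by rewrite lef_pV2 ?posrE ?tau_gt0//; exact: tauP.
  split; first by exists (Tmin / 2)^-1 => //; rewrite invr_ge0 ltW.
  exists ((Tmin / 2)^-1 * (Tmin / 2)^-1); first by rewrite mulr_ge0// invr_ge0 ltW.
  move=> s s' Ps Ps'.
  have -> : (tau_of s)^-1 - (tau_of s')^-1 = (tau_of s)^-1 * (tau_of s')^-1 * (tau_of s' - tau_of s).
    by field; rewrite !gt_eqF ?tau_gt0.
  rewrite normrM; apply: ler_pM => //.
    by rewrite normrM; apply: ler_pM => //; exact: invB.
  by rewrite distrC /tau_of -stB st_norm.
have Pphi : lip_on P (fun s => phi (z_of a s)).
  have zL (s s' : 'rV[R]_(4 * n).+1) : `|z_of a s - z_of a s'| <= (1 + `|a|) * `|s - s'|.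
    apply: norm_le_coord; first by rewrite mulr_ge0// addr_ge0.
    move=> i; rewrite !mxE.
    have E4 (p q p' q' : R) : p + a * q - (p' + a * q') = (p - p') + a * (q - q') by ring.
    rewrite E4.
    apply: le_trans (ler_normD _ _) _; rewrite normrM mulrDl mul1r -!stB.
    by apply: lerD; rewrite ?st_norm// ler_wpM2l// st_norm.
  have zB s : P s -> `|z_of a s| <= (1 + `|a|) * B.
    move=> Ps; have := zL s 0; rewrite (_ : z_of a 0 = 0) ?subr0; last first.
      by apply/rowP => i; rewrite !mxE /st !mxE mulr0 addr0.
    by move=> h; apply: le_trans h _; rewrite ler_wpM2l ?addr_ge0// PB.
  have [K K0 hK] := phi_lip grad L0 g_lip zs_min ((1 + `|a|) * B).
  have Ps0 : P s0 by rewrite /P /= subrr normr0 divr_ge0// ltW.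
  have KL s s' : P s -> P s' -> `|phi (z_of a s) - phi (z_of a s')| <= K * (1 + `|a|) * `|s - s'|.
    move=> Ps Ps'; apply: le_trans (hK _ _ (zB _ Ps) (zB _ Ps')) _.
    by rewrite -mulrA ler_wpM2l.
  have K1 : 0 <= K * (1 + `|a|) by rewrite mulr_ge0// addr_ge0.
  split; last by exists (K * (1 + `|a|)).
  exists (`|phi (z_of a s0)| + K * (1 + `|a|) * (Tmin / 2)).
    by rewrite addr_ge0// mulr_ge0// divr_ge0// ltW.
  move=> s Ps; rewrite -[phi (z_of a s)](subrK (phi (z_of a s0))) addrC.
  apply: le_trans (ler_normD _ _) _; rewrite lerD2l; apply: le_trans (KL _ _ Ps Ps0) _.
  by apply: ler_wpM2l => //; exact: Ps.
have := @lip_on_rV R _ P (flow_map kappa k phi a eps); apply => j.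
have Pext (f h : 'rV[R]_(4 * n).+1 -> R) : (forall s, f s = h s) -> lip_on P f -> lip_on P h.
  by move=> fh; rewrite (funext fh).
rewrite /flow_map; set q := nat_of_ord j.
apply: (Pext (fun s => if (q < n)%N then 2 / tau_of s * (st s (n + q) - st s q)
    else if (q < 2 * n)%N then
      - (4 / a) * k * tau_of s * phi (z_of a s) * st s (2 * n + 2 * (q - n))
    else if (q < 4 * n)%N then eps^-1 * Rmu kappa s (q - 2 * n)
    else 1 / 2)); first by move=> s; rewrite mxE.
case: (q < n)%N; first exact: lip_onM (lip_onM (lip_on_cst _ _) Pinv) (lip_onB (Pst _) (Pst _)).
case: (q < 2 * n)%N.
  exact: lip_onM (lip_onM (lip_onM (lip_on_cst _ _) (Pst _)) Pphi) (Pst _).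
case: (q < 4 * n)%N; last exact: lip_on_cst.
apply: lip_onM (lip_on_cst _ _) _; rewrite /Rmu.
by case: (odd _); exact: lip_onM (lip_on_cst _ _) (Pst _).
Qed.

Lemma ac_opp (R : realType) (f : R -> R) (a b : R) :
  abs_cont_on f a b -> abs_cont_on (fun t => - f t) a b.
Proof.
move=> acf e e0; have [d d0 h] := acf e e0; exists d => // N s t h1 h2 h3.
have -> : \sum_(k < N) `|- f (t k) - - f (s k)| = \sum_(k < N) `|f (t k) - f (s k)|.
  by apply: eq_bigr => k _; rewrite -opprD normrN.
exact: h.
Qed.

Lemma ac_bound (R : realType) (f : R -> R) (a b K : R) : a <= b -> abs_cont_on f a b ->
  {ae (@lebesgue_measure R), forall t, a < t < b -> exists2 v, is_derive t 1 f v & `|v| <= K} ->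
  `|f b - f a| <= K * (b - a).
Proof.
move=> ab acf df; rewrite ler_norml; apply/andP; split; last first.
  apply: ac_ub => //; move: df; apply: ae_imply => t h /h[v dv vK].
  by exists v => //; apply: le_trans (ler_norm _) vK.
rewrite lerNl opprB addrC.
have := @ac_ub R (fun t => - f t) a b K ab (ac_opp acf); rewrite opprK; apply.
move: df; apply: ae_imply => t h /h[v dv vK].
exists (- v); first exact: is_deriveN.
by apply: le_trans (ler_norm _) _; rewrite normrN.
Qed.

(** * Nominal solutions: timer, order of the flow intervals, viability, completeness *)

Section Flowing.
Context {R : realType} {n : nat}.
Local Notation S := 'rV[R]_(4 * n).+1.
Variables (phi : 'rV[R]_n -> R) (kappa : nat -> rat) (k Tmin Tmax a eps : R).
Hypothesis Tlt : Tmin < Tmax.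
Variables (E : set (R * nat)) (x : R -> nat -> S).
Hypothesis xs : is_solution (H_ae kappa k Tmin Tmax phi a eps) E x.

Lemma nominal_flow t1 t2 j : E (t1, j) -> E (t2, j) -> t1 < t2 ->
  [/\ forall i, abs_cont_on (fun t => x t j ord0 i) t1 t2,
   forall t, t1 <= t <= t2 -> E (t, j) &
   {ae (@lebesgue_measure R), forall t, t1 < t < t2 -> forall i,
     is_derive t 1 (fun s => x s j ord0 i) (flow_map kappa k phi a eps (x t j) ord0 i)}].
Proof.
move=> E1 E2 t12; have [hE [_ [_ [xflow _]]]] := xs.
have EI t : t1 <= t <= t2 -> E (t, j) by exact: htd_interval.
have [|_ [ac d]] := xflow j.
  exists ((t1 + t2) / 2); apply: (interior_segment EI); lra.
split => //; first by move=> i; exact: ac.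
move: d; apply: ae_imply => t h /andP[h1 h2] i; apply: h.
by apply: EI; rewrite !ltW.
Qed.

Lemma tau_rate t1 t2 j : E (t1, j) -> E (t2, j) -> t1 <= t2 ->
  (t2 - t1) / 2 <= tau_of (x t2 j) - tau_of (x t1 j).
Proof.
move=> E1 E2; rewrite le_eqVlt => /orP[/eqP <-|t12]; first by rewrite !subrr mul0r.
have [ac _ d] := nominal_flow E1 E2 t12.
have := @ac_ub R (fun t => - tau_of (x t j)) t1 t2 (- (1 / 2)) (ltW t12) (ac_opp (ac _)).
have h : {ae (@lebesgue_measure R), forall t, t1 < t < t2 -> exists2 v,
    is_derive t 1 (fun t => - tau_of (x t j)) v & v <= - (1 / 2)}.
  move: d; apply: ae_imply => t h /h {}h.
  exists (- tau_of (flow_map kappa k phi a eps (x t j))); first by apply: is_deriveN; exact: h.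
  by rewrite flow_tau.
by move=> /(_ h); lra.
Qed.

Lemma nominal_lipschitz B CF t1 t2 j : 0 <= CF ->
  (forall s : S, flow_set Tmin Tmax s -> `|s| <= B -> `|flow_map kappa k phi a eps s| <= CF) ->
  (forall t i, E (t, i) -> `|x t i| <= B) ->
  E (t1, j) -> E (t2, j) -> t1 <= t2 -> `|x t2 j - x t1 j| <= CF * (t2 - t1).
Proof.
move=> CF0 FB xB E1 E2; rewrite le_eqVlt => /orP[/eqP <-|t12].
  by rewrite !subrr mulr0 normr0.
have [ac EI d] := nominal_flow E1 E2 t12.
apply: norm_le_coord => [|i]; first by rewrite mulr_ge0// subr_ge0 ltW.
rewrite !mxE; apply: (@ac_bound R (fun t => x t j ord0 i)); [exact: ltW|exact: ac|].
move: d; apply: ae_imply => t h tt; eexists; first exact: h.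
have Et : E (t, j) by apply: EI; case/andP: tt => *; rewrite !ltW.
apply: le_trans (coord_le_norm _ _) _; apply: FB; last exact: xB.
exact: nominal_in_flow_set xs _ _ Et.
Qed.

(** Flow past a jump time w is impossible, since tau equals Tmax there and grows along flows. The
    truncations in [htd] do not exclude it by themselves: a domain could branch, jumping at w and
    also flowing on. *)
Lemma jump_ends u w i : E (u, i) -> E (w, i) -> E (w, i.+1) -> u <= w.
Proof.
move=> Eu Ew Ew1; case: leP => // wu.
have [_ [_ [_ [_ xjump]]]] := xs.
have [[tauw _] _] := xjump _ _ Ew Ew1.
have [/andP[_ tauu] _] := nominal_in_flow_set Tlt xs Eu.
have := tau_rate Ew Eu (ltW wu); lra.
Qed.

Lemma flow_before u v i l : E (u, i) -> E (v, l) -> (i < l)%N -> u <= v.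
Proof.
move=> Eu Ev il; have [hE _] := xs.
have [w [wv Ew Ew1]] := htd_jump_before hE Ev il.
exact: le_trans (jump_ends Eu Ew Ew1) wv.
Qed.

End Flowing.

(** Viability below Tmax: the rotation preserves each circle and tau grows at rate 1/2, so the
    Picard solution, built in the ambient space, remains in the flow set. *)
Lemma flow_start (R : realType) (n : nat) (phi : 'rV[R]_n -> R) (g : 'rV[R]_n -> 'rV[R]_n)
    (L : R) (zs : 'rV[R]_n) (kappa : nat -> rat) (k Tmin Tmax a eps : R) (s0 : 'rV[R]_(4 * n).+1) :
  is_gradient phi g -> 0 < L -> (forall x y, enorm (g x - g y) <= L * enorm (x - y)) ->
  (forall z, phi zs <= phi z) -> 0 < Tmin -> flow_set Tmin Tmax s0 -> tau_of s0 < Tmax ->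
  exists2 d, 0 < d & exists u : R -> 'rV[R]_(4 * n).+1, u 0 = s0 /\ forall t, 0 <= t <= d ->
    [/\ flow_set Tmin Tmax (u t), `|u t - s0| <= Tmin / 2 &
        forall i, is_derive t 1 (fun s => u s ord0 i) (flow_map kappa k phi a eps (u t) ord0 i)].
Proof.
move=> grad L0 g_lip zs_min Tmin0 [/andP[tau1 tau2] ts0] tau3.
have [K K0 FL] := flow_lip kappa k a eps grad L0 g_lip zs_min Tmin0 tau1.
have r0 : 0 < Tmin / 2 by rewrite divr_gt0.
have [d0 d00 [u [u0 hu]]] := picard r0 K0 FL.
(* With tau' = 1/2 the timer does not exceed Tmax within this time. *)
exists (Num.min d0 (2 * (Tmax - tau_of s0))).
  by rewrite lt_min d00 mulr_gt0// subr_gt0.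
exists u; split => // t /andP[t0]; rewrite le_min => /andP[td0 td1].
have hut v : 0 <= v <= t -> 0 <= v <= d0 by move=> /andP[-> vt]; exact: le_trans td0.
have const (f : 'rV[R]_(4 * n).+1 -> R) df : C11 f df ->
    (forall v, 0 <= v <= t -> df (u v) (flow_map kappa k phi a eps (u v)) = 0) -> f (u t) = f s0.
  move=> nf f0; have := @deriv_bound R (fun v => f (u v)) (fun=> 0) 0 t 0 t0; rewrite mul0r u0 => H.
  apply/eqP; rewrite -subr_eq0 -normr_le0; apply: H => [v vt|v _]; last by rewrite normr0.
  by rewrite -(f0 v vt); apply: (C11_chain nf) => i; apply: (hu v (hut v vt)).2.
have tauE : tau_of (u t) = tau_of s0 + t / 2.
  have := @deriv_bound R (fun v => tau_of (u v) - v / 2) (fun=> 0) 0 t 0 t0; rewrite mul0r u0 => H.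
  apply/eqP; rewrite -subr_eq0 opprD addrA addrAC; rewrite mul0r subr0 in H.
  rewrite -normr_le0; apply: H => [v vt|v _]; last by rewrite normr0.
  have := is_deriveB ((hu v (hut v vt)).2 (inord (4 * n)))
    (is_deriveZ (2^-1 : R) (is_derive_id v (1 : R))).
  rewrite -/(st _ _) -/(tau_of _) flow_tau div1r (_ : 2^-1 - 2^-1 *: 1 = 0); last first.
    by rewrite /GRing.scale /= mulr1 subrr.
  rewrite (_ : _ - _ = (fun v => tau_of (u v) - v / 2))//.
  by apply: funext => z; rewrite mulrC.
split; [split|by have [] := hu t (hut t _); rewrite ?t0 ?lexx|]; last first.
- by move=> i; apply: (hu t _).2; rewrite t0.
- move=> i ni; rewrite -(ts0 i ni).
  have nc := C11_st R n (2 * n + 2 * i); have ns := C11_st R n (2 * n + 2 * i + 1).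
  apply: (const _ _ (C11_add (C11_mul nc nc) (C11_mul ns ns))) => v _ /=.
  have := flow_cc phi kappa k a eps (u v) ni; have := flow_sc phi kappa k a eps (u v) ni.
  by rewrite /cc /sc => -> ->; ring.
- by rewrite tauE; apply/andP; split; move: t0 td1 tau1; clear; lra.
Qed.

Lemma bounded_complete (R : realType) (n : nat) (phi : 'rV[R]_n -> R) (g : 'rV[R]_n -> 'rV[R]_n)
    (L : R) (zs : 'rV[R]_n) (kappa : nat -> rat) (k Tmin Tmax a eps B : R) E x :
  is_gradient phi g -> 0 < L -> (forall x y, enorm (g x - g y) <= L * enorm (x - y)) ->
  (forall z, phi zs <= phi z) -> 0 < k -> 0 < Tmin -> Tmin < Tmax ->
  maximal_solution (H_ae kappa k Tmin Tmax phi a eps) E x ->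
  (forall t j, E (t, j) -> `|x t j| <= B) -> complete_dom E.
Proof.
move=> grad L0 g_lip zs_min k0 Tmin0 Tlt [xs xmax] xB M; apply: contrapT => hM0.
have hM t j : E (t, j) -> t + j%:R < M.
  by move=> Etj; rewrite ltNge; apply/negP => h; apply: hM0; exists (t, j).
have [hE [E00 _]] := xs.
have E0 t j : E (t, j) -> 0 <= t by case: hE => h _ /h.
have M0 : 0 <= M by have := hM _ _ E00; rewrite addr0 => /ltW.
have [J [[tm EJ0] Jmax]] : exists J, (exists t, E (t, J)) /\ forall t j, E (t, j) -> (j <= J)%N.
  pose P j := `[< exists t, E (t, j) >].
  have exP : exists j, P j by exists 0%N; apply/asboolP; exists 0.
  have ubP j : P j -> (j <= Num.bound M)%N.
    move=> /asboolP[t Etj]; rewrite -(ler_nat R); apply: le_trans (ltW (archi_boundP M0)).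
    by have := hM _ _ Etj; have := E0 _ _ Etj; clear; lra.
  case: (ex_maxnP exP ubP) => J /asboolP PJ Jm; exists J; split => // t j Etj.
  by apply: Jm; apply/asboolP; exists t.
have [tJ EtJ tJmin] := htd_start hE EJ0.
pose T := sup (Ij E J).
have EJ t : E (t, J) -> tJ <= t <= T.
  move=> Et; rewrite tJmin//=; apply: ub_le_sup => //; exists M => u /hM.
  by have : (0 : R) <= J%:R by []; clear; lra.
have tJT : tJ <= T by case/andP: (EJ _ EtJ).
have EtT t : tJ <= t < T -> E (t, J).
  move=> /andP[t1 /sup_gt[|u Eu tu]]; first by exists tJ.
  by apply: (htd_interval hE EtJ Eu); rewrite t1 ltW.
have before u i : E (u, i) -> (i < J)%N -> u <= tJ.
  by move=> Eui iJ; apply: (flow_before Tlt xs _ EtJ iJ).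
(* The ball is enlarged by the radius allowed in [flow_start], so that one constant [CF] serves the
   solution and its continuation. *)
have [CF CF0 FB] := flow_bound grad L0 g_lip zs_min kappa k0 Tmin0 Tlt a eps (B + Tmin / 2).
have BB : B <= B + Tmin / 2 by rewrite lerDl divr_ge0// ltW.
have xC := nominal_in_flow_set Tlt xs.
have xK t1 t2 : E (t1, J) -> E (t2, J) -> t1 <= t2 -> `|x t2 J - x t1 J| <= CF * (t2 - t1).
  apply: (nominal_lipschitz Tlt xs CF0 FB) => t i /xB xtB; exact: le_trans BB.
(* Any admissible continuation that lengthens the last interval, or closes it at its missing end,
   contradicts maximality. *)
have stop T' w : T <= T' -> (T < T' \/ ~ E (T', J)) -> (E (T, J) -> w T = x T J) ->
    (forall t, tJ <= t < T -> `|x t J - w T| <= CF * (T - t)) ->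
    (forall t1 t2, T <= t1 -> t1 <= t2 -> t2 <= T' -> `|w t2 - w t1| <= CF * (t2 - t1)) ->
    (forall t, T <= t < T' -> flow_set Tmin Tmax (w t)) ->
    (forall t, T < t < T' -> forall i,
      is_derive t 1 (fun s => w s ord0 i) (flow_map kappa k phi a eps (w t) ord0 i)) -> False.
  move=> TT' new wT xw wK wC dw.
  have [x' xs' xx'] := continue_flow xs Jmax EtJ EJ EtT before (fun t => @xC t J) xK
    TT' CF0 wT xw wK wC dw.
  have EE : E (T', J).
    by rewrite -(xmax _ _ xs' (@subsetUl _ _ _) xx'); right; split => //=; rewrite lexx (le_trans tJT).
  by case: new => // TltT'; have /andP[_] := EJ _ EE; rewrite leNgt TltT'.
(* If the right end is missing, the left limit is attached with [T' = T]; the conditions on times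
   strictly between, or in the half-open interval from T, are then empty. *)
have [ET|nET] := pselect (E (T, J)); last first.
  have tJT' : tJ < T.
    rewrite lt_neqAle tJT andbT; apply/eqP => tE; apply: nET; by rewrite -tE.
  have [l hl] : exists l, forall t, tJ <= t < T -> `|x t J - l| <= CF * (T - t).
    apply: lipschitz_left_limit => // t t' t1 tt t2.
    by apply: xK => //; apply: EtT; rewrite ?t1 ?t2 ?(le_lt_trans tt)// (le_trans t1).
  apply: (stop T (fun=> l)) => //; first by right.
  - by move=> t1 t2 _ tt _; rewrite subrr normr0 mulr_ge0// subr_ge0.
  - by move=> t /andP[/le_lt_trans/[apply]]; rewrite ltxx.
  - by move=> t /andP[/lt_trans/[apply]]; rewrite ltxx.
(* At T either tau = Tmax and a jump is possible, or tau < Tmax and the flow can start again. *)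
have xTC := xC _ _ ET; have [/andP[_]] := xTC; rewrite le_eqVlt => /orP[/eqP tauT ts|tauT _].
  have Jbefore u i : E (u, i) -> (i < J)%N -> u <= T.
    by move=> Eui iJ; exact: le_trans (before _ _ Eui iJ) tJT.
  have EJT t : E (t, J) -> t <= T by move=> /EJ/andP[].
  have xs' := extend_jump xs Jmax ET EJT Jbefore (conj tauT ts : jump_set Tmax (x T J)).
  have := xmax _ _ xs' (@subsetUl _ _ _); move=> EE.
  have : E (T, J.+1).
    rewrite -EE; first by right.
    by move=> [t j] /Jmax /= jJ; case: eqP => // jJ1; move: jJ; rewrite jJ1 ltnn.
  by move=> /Jmax; rewrite ltnn.
have [d d0 [u [u0 hu]]] := flow_start kappa k a eps grad L0 g_lip zs_min Tmin0 xTC tauT.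
have shift t : T <= t <= T + d -> 0 <= t - T <= d.
  by move=> /andP[h1 h2]; rewrite subr_ge0 h1 lerBlDl.
have dshift (t : R) i : T <= t <= T + d ->
    is_derive t 1 (fun s => u (s - T) ord0 i) (flow_map kappa k phi a eps (u (t - T)) ord0 i).
  move=> /shift/hu[_ _ /(_ i) h].
  have := is_deriveB (is_derive_id t (1 : R)) (is_derive_cst T t 1); rewrite subr0 => h'.
  have := @is_derive1_comp _ (fun s => u s ord0 i) (fun s => s - T) t _ _ h h'.
  by rewrite mulr1.
apply: (stop (T + d) (fun t => u (t - T))).
- by rewrite lerDl ltW.
- by left; rewrite ltrDl.
- by rewrite subrr u0.
- move=> t /andP[t1 t2]; rewrite subrr u0 distrC; apply: xK => //; last exact: ltW.
  by apply: EtT; rewrite t1.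
- move=> t1 t2 Tt1 t12 t2d.
  apply: (@deriv_boundV R _ (fun t => u (t - T)) (fun t => flow_map kappa k phi a eps (u (t - T)))) => //.
    by move=> t i /andP[h1 h2]; apply: dshift; rewrite (le_trans Tt1 h1) (le_trans h2).
  move=> t /andP[h1 h2]; have [|c1 c2 _] := hu (t - T).
    by apply: shift; rewrite (le_trans Tt1 h1) (le_trans h2).
  apply: FB => //; rewrite -[u _](subrK (x T J)) addrC; apply: le_trans (ler_normD _ _) _.
  by apply: lerD => //; exact: xB.
- by move=> t /andP[h1 /ltW h2]; have [|//] := hu (t - T); apply: shift; rewrite h1.
- by move=> t /andP[/ltW h1 /ltW h2] i; apply: dshift; rewrite h1.
Qed.

Theorem theorem2 (R : realType) (n : nat) (phi : 'rV[R]_n -> R)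
  (gradphi : 'rV[R]_n -> 'rV[R]_n) (theta L : R) (zstar : 'rV[R]_n)
  (kappa : nat -> rat) (k Tmin Tmax : R) :
  C2 phi -> is_gradient phi gradphi ->
  0 < theta -> 0 < L ->
  (forall z1 z2, enorm (gradphi z1 - gradphi z2) <= L * enorm (z1 - z2)) ->
  (forall z1 z2, dotv (gradphi z1 - gradphi z2) (z1 - z2) >= theta * enorm (z1 - z2) ^+ 2) ->
  (forall z, phi zstar <= phi z) ->
  (forall i, (i < n)%N -> 0 < kappa i) ->
  (forall i j, (i < n)%N -> (j < n)%N -> kappa i = kappa j -> i = j) ->
  0 < k -> 0 < Tmin -> Tmin < Tmax ->
  Tmax ^+ 2 - Tmin ^+ 2 >= 1 / (2 * theta * k) ->
  (* (a) *)
  (exists c1 c2 : R, 0 < c1 /\ 0 < c2 /\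
     SGPES (H_ae kappa k Tmin Tmax phi) (Aset zstar Tmin Tmax)
       (fun r s => c1 * r * expR (- (c2 * s))) /\
     struct_robust (H_ae kappa k Tmin Tmax phi) (Aset zstar Tmin Tmax)
       (fun r s => c1 * r * expR (- (c2 * s)))) /\
  (* (b) *)
  (forall K0 : set ('rV[R]_n * 'rV[R]_n), compact K0 ->
     [set (zstar, zstar)] `<=` K0° ->
   forall nu : R, 0 < nu ->
   exists2 astar : R, 0 < astar & forall a : R, 0 < a < astar ->
   exists2 estar : R, 0 < estar & forall eps : R, 0 < eps < estar ->
   forall E x, is_solution (H_ae kappa k Tmin Tmax phi a eps) E x ->
     K0 (x1_of (x 0 0%N), x2_of (x 0 0%N)) ->
     tau_of (x 0 0%N) = Tmin ->
     x1_of (x 0 0%N) = x2_of (x 0 0%N) ->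
     forall (t : R) (j : nat), E (t, j) -> inf (Ij E j) < t ->
       phi (z_of a (x t j)) - phi zstar <=
         (Tmax ^+ 2 / Tmin ^+ 2)
         * ((k * Tmax ^+ 2)^-1 * ((2 * theta)^-1 + k * Tmin ^+ 2)) ^+ j
         * (phi (z_of a (x 0 0%N)) - phi zstar) + nu).
Proof.
move=> _ grad theta0 L0 g_lip g_mono zs_min kappa0 kappa_inj k0 Tmin0 Tlt Tgap.
have gm1 : gam theta k Tmin Tmax <= 1 by exact: gam_le1.
split; last first.
  move=> K0 K0c _ nu nu0.
  have [as_ as0 ha] := suboptimality_bound grad theta0 L0 g_lip g_mono zs_min kappa0 kappa_inj
    k0 Tmin0 Tlt gm1 K0c nu0.
  exists as_ => // a /ha[es es0 hes]; exists es => // eps /hes h E x xs xK tau0 x12 t j Etj _.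
  exact: h xs xK tau0 x12 t j Etj.
have [c1 [c2 [c10 c20 h]]] := robust_exp grad theta0 L0 g_lip g_mono zs_min kappa0 kappa_inj
  k0 Tmin0 Tlt gm1.
exists c1, c2; do 2!split => //; split=> K Kc nu nu0.
  have [B [as_ as0 ha]] := h K Kc nu nu0.
  exists as_ => // a /ha[es es0 hes]; exists es => // eps /hes[eb eb0 heb].
  have bound E x : is_solution (H_ae kappa k Tmin Tmax phi a eps) E x -> K (x 0 0%N) ->
      forall t j, E (t, j) -> `|x t j| <= B /\
        dist_set (Aset zstar Tmin Tmax) (x t j) <=
          c1 * dist_set (Aset zstar Tmin Tmax) (x 0 0%N) * expR (- (c2 * (t + j%:R))) + nu.
    rewrite -perturb_H_ae0; apply: (heb eb) => // t _; rewrite normr0; exact: ltW.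
  split=> E x xs xK; first by move=> t j /(bound _ _ xs xK)[].
  apply: (bounded_complete (B := B) grad L0 g_lip zs_min k0 Tmin0 Tlt xs) => t j Etj.
  by have [] := bound _ _ xs.1 xK t j Etj.
have [B [as_ as0 ha]] := h K Kc nu nu0.
exists as_ => // a /ha[es es0 hes]; exists es => // eps /hes[eb eb0 heb].
exists eb => // ebar /andP[_ /ltW ebar_le] e _ he E x xs xK t j Etj.
(* The perturbation is given in the Euclidean norm, which dominates the max norm used in the
   estimates. *)
have he' u : 0 <= u -> `|e u| <= ebar by move=> /he; apply: le_trans; exact: norm_le_enorm.
by have [] := heb ebar ebar_le e he' E x xs xK t j Etj.
Qed.
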